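(* Let $A$ be a Hopf algebra with bijective antipode, $\Lambda^1$ a right $A$-crossed module, $\theta^*\in\Lambda^{1*}$ right invariant, and $A\#B_{\theta^*}(\Lambda^1)$ the associated coinner strongly bicovariant codifferential exterior algebra on $A$. Let $\omega:A^+\to\Lambda^1$ be a right $A$-crossed module map and $\tilde\omega=\omega\circ\pi$. Then $\omega$ makes $A\#B_{\theta^*}(\Lambda^1)$ an augmented strongly bicovariant exterior algebra, with $\mathrm{d}$ inherited from $A\#\mathrm{Sh}_-(\Lambda^1)$, if and only if $$\langle\theta^*\otimes\theta^*,w_0\otimes\tilde\omega(w_1)\rangle\,w_2=\langle\theta^*\otimes\theta^*,w_0\otimes\tilde\omega(w_1)\rangle\,1_A,$$ $$\langle\theta^*\otimes\theta^*,(v_1)_0\otimes\tilde\omega((v_1)_1)\rangle\,v_2\otimes\cdots\otimes v_n=(-1)^{n-1}v_1\otimes\cdots\otimes v_{n-1}\langle\theta^*\otimes\theta^*,(v_n)_0\otimes\tilde\omega((v_n)_1)\rangle$$ for any $w\in\Lambda^1\subseteq B_{\theta^*}(\Lambda^1)$ and any $v_1\otimes\cdots\otimes v_n\in B_{\theta^*}(\Lambda^1)$ (linear combinations understood).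
   Context: We work over a field $k$ of characteristic not $2$. $A^+=\ker\epsilon$, $\pi(a)=a-\epsilon(a)1$. A right $A$-crossed module is a vector space $V$ with right action $\triangleleft$ and right coaction $\Delta_Rv=v_0\otimes v_1$ (iterated: $v_0\otimes v_1\otimes v_2$) of $A$ such that $\Delta_R(v\triangleleft a)=v_0\triangleleft a_{(2)}\otimes(Sa_{(1)})v_1a_{(3)}$; these form a braided category with $\Psi(v\otimes w)=w_0\otimes v\triangleleft w_1$. For $\omega$, $A^+$ has the crossed module structure $a\triangleleft b=ab$, $\Delta_R(a)=a_{(2)}\otimes(Sa_{(1)})a_{(3)}$. $\mathrm{Sh}_-(V)$ is the braided-super Hopf algebra on $\oplus_nV^{\otimes n}$ with deconcatenation coproduct and product $(v_1\otimes\cdots\otimes v_r)\bullet_-(v_{r+1}\otimes\cdots\otimes v_n)=\left(\binom{n}{r};-\Psi\right)(v_1\otimes\cdots\otimes v_n)$, where $\left(\binom{n}{r};\Psi\right)=\left(\left(\binom{n-1}{r-1};\Psi\right)\otimes\mathrm{id}\right)\Psi_{n-1}\cdots\Psi_r+\left(\binom{n-1}{r};\Psi\right)\otimes\mathrm{id}$, $\left(\binom{n}{0};\Psi\right)=\mathrm{id}$, $\left(\binom{n}{r};\Psi\right)=0$ for $r>n$, and $\Psi_i$ is $\Psi$ in factors $i,i+1$. $\theta^*\in V^*$ is right invariant if $\langle\theta^*,v\triangleleft a\rangle=\epsilon(a)\langle\theta^*,v\rangle$. $B_{\theta^*}(V)\subseteq\mathrm{Sh}_-(V)$ is the sub-graded-braided-super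 Hopf algebra of all $b$ such that $$b^1\otimes\langle\theta^*\otimes\theta^*,(b^2)_0\otimes(b^3)_0\rangle(b^2)_1(b^3)_1\otimes b^4=b^1\otimes\langle\theta^*\otimes\theta^*,b^2\otimes b^3\rangle1_A\otimes b^4=\langle\theta^*\otimes\theta^*,b^1\otimes b^2\rangle b^3\otimes1_A\otimes b^4,$$ with $b^1\otimes b^2\otimes b^3\otimes b^4$ the iterated coproduct and $\theta^*$ extended by zero to degrees other than $1$. For a braided-super Hopf algebra $\Lambda$ in this category, $A\#\Lambda$ is the super-Hopf algebra $A\otimes\Lambda$ with $(a\otimes\eta)(b\otimes\zeta)=ab_{(1)}\otimes(\eta\triangleleft b_{(2)})\zeta$ and $\Delta(a\otimes\eta)=a_{(1)}\otimes(\eta^1)_0\otimes a_{(2)}(\eta^1)_1\otimes\eta^2$. The codifferential on $A\#B_{\theta^*}(\Lambda^1)$ is $i(a\otimes v_1\otimes\cdots\otimes v_n)=\langle\theta^*,(v_1)_0\rangle a(v_1)_1\otimes(v_2\otimes\cdots\otimes v_n)+(-1)^na\otimes(v_1\otimes\cdots\otimes v_{n-1})\langle\theta^*,v_n\rangle$. The differential on $A\#\mathrm{Sh}_-(\Lambda^1)$ is $\mathrm{d}(a\otimes\eta)=a_{(1)}\otimes\tilde\omega(a_{(2)})\bullet_-\eta+a\otimes\delta\eta$ with $\delta(1)=0$ and $\delta(v_1\otimes\cdots\otimes v_n)=\delta(v_1\otimes\cdots\otimes v_{n-1})\otimes v_n+(-1)^n(v_1)_0\otimes\cdots\otimes(v_n)_0\otimes\tilde\omega((v_1)_1\cdots(v_n)_1)$;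 ''inherited'' means that $\mathrm{d}$ restricts to the subalgebra. An augmented strongly bicovariant exterior algebra is a graded super-Hopf algebra $\Omega$ with $\Omega^0=A$ and square-zero maps $\mathrm{d}$ of degree $1$ and $i$ of degree $-1$, each both a super-derivation and a super-coderivation ($\Delta\mathrm{d}=(\mathrm{d}\otimes\mathrm{id}+(-1)^{|\ |}\otimes\mathrm{d})\Delta$ and likewise for $i$). *)

(* Defs.v *)
From HB Require Import structures.
From mathcomp Require Import all_boot all_algebra boolp.

Set Implicit Arguments.
Unset Strict Implicit.
Unset Printing Implicit Defensive.

Import GRing.Theory.
Local Open Scope ring_scope.
Local Open Scope quotient_scope.

(* The vector space generated by a set X of symbols subject to a class C of
   constraints, presented by its universal property: two formal combinations of
   symbols are identified when every map X -> U satisfying C takes the same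
   value on them. *)
Section UniversalQuotient.

Variables (k : fieldType) (X : choiceType).
Variable C : forall U : lmodType k, (X -> U) -> Prop.

Definition fsum (U : lmodType k) (f : X -> U) (s : seq (k * X)) : U :=
  \sum_(p <- s) p.1 *: f p.2.

Definition uq_rel (s t : seq (k * X)) : bool :=
  `[< forall (U : lmodType k) (f : X -> U), C f -> fsum f s = fsum f t >].

Fact uq_rel_equiv : equiv_class_of uq_rel.
Proof.
split=> [s|s t|t s u]; first by apply/asboolP.
  by apply/asboolP/asboolP => h U f Cf; rewrite h.
by move/asboolP=> h1 /asboolP h2; apply/asboolP => U f Cf; rewrite h1 // h2.
Qed.

Canonical uq_equiv := EquivRelPack uq_rel_equiv.

Definition univ_quot := {eq_quot uq_rel}.

HB.instance Definition _ := Choice.on univ_quot.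
HB.instance Definition _ := EqQuotient.on univ_quot.

Definition uq_gen (x : X) : univ_quot := \pi_univ_quot [:: (1, x)].

(* The linear extension of f. It is evaluated on a representative, so that it
   is meaningful (and then linear, see uq_lift_linear) only when C f holds. *)
Definition uq_lift (U : lmodType k) (f : X -> U) (q : univ_quot) : U :=
  fsum f (repr q).

Definition uq_add (p q : univ_quot) : univ_quot :=
  \pi_univ_quot (repr p ++ repr q).
Definition uq_scale (c : k) (q : univ_quot) : univ_quot :=
  \pi_univ_quot [seq (c * p.1, p.2) | p <- repr q].

Lemma uq_eqP (p q : univ_quot) :
  (forall (U : lmodType k) (f : X -> U), C f -> uq_lift f p = uq_lift f q) ->
  p = q.
Proof.
move=> h; rewrite -[p]reprK -[q]reprK; apply/eqmodP/asboolP => U f Cf.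
exact: h.
Qed.

Lemma uq_lift_pi (U : lmodType k) (f : X -> U) s :
  C f -> uq_lift f (\pi_univ_quot s) = fsum f s.
Proof.
move=> Cf; rewrite /uq_lift.
have /eqmodP/asboolP h : repr (\pi_univ_quot s) = s %[mod univ_quot] by rewrite reprK.
exact: h.
Qed.

Lemma uq_lift_add (U : lmodType k) (f : X -> U) p q :
  C f -> uq_lift f (uq_add p q) = uq_lift f p + uq_lift f q.
Proof. by move=> Cf; rewrite uq_lift_pi // /fsum big_cat. Qed.

Lemma uq_lift_scale (U : lmodType k) (f : X -> U) c q :
  C f -> uq_lift f (uq_scale c q) = c *: uq_lift f q.
Proof.
move=> Cf; rewrite uq_lift_pi // /fsum big_map scaler_sumr.
by apply: eq_bigr => p _; rewrite scalerA.
Qed.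

Lemma uq_lift_zero (U : lmodType k) (f : X -> U) :
  C f -> uq_lift f (\pi_univ_quot [::]) = 0.
Proof. by move=> Cf; rewrite uq_lift_pi // /fsum big_nil. Qed.

Fact uq_addA : associative uq_add.
Proof. by move=> p q r; apply: uq_eqP => U f Cf; rewrite !uq_lift_add // addrA. Qed.
Fact uq_addC : commutative uq_add.
Proof. by move=> p q; apply: uq_eqP => U f Cf; rewrite !uq_lift_add // addrC. Qed.
Fact uq_add0 : left_id (\pi_univ_quot [::]) uq_add.
Proof.
by move=> p; apply: uq_eqP => U f Cf; rewrite uq_lift_add // uq_lift_zero // add0r.
Qed.
Fact uq_addN : left_inverse (\pi_univ_quot [::]) (uq_scale (-1)) uq_add.
Proof.
move=> p; apply: uq_eqP => U f Cf.
by rewrite uq_lift_add // uq_lift_scale // uq_lift_zero // scaleN1r addNr.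
Qed.

HB.instance Definition _ :=
  GRing.isZmodule.Build univ_quot uq_addA uq_addC uq_add0 uq_addN.

Fact uq_scaleA a b v : uq_scale a (uq_scale b v) = uq_scale (a * b) v.
Proof. by apply: uq_eqP => U f Cf; rewrite !uq_lift_scale // scalerA. Qed.
Fact uq_scale1 : left_id 1 uq_scale.
Proof. by move=> p; apply: uq_eqP => U f Cf; rewrite uq_lift_scale // scale1r. Qed.
Fact uq_scaleDr : right_distributive uq_scale +%R.
Proof.
move=> c p q; apply: uq_eqP => U f Cf.
by rewrite uq_lift_scale // !uq_lift_add // !uq_lift_scale // scalerDr.
Qed.
Fact uq_scaleDl v : {morph uq_scale^~ v : a b / a + b}.
Proof.
move=> a b; apply: uq_eqP => U f Cf.
by rewrite uq_lift_scale // !uq_lift_add // !uq_lift_scale // scalerDl.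
Qed.

HB.instance Definition _ := GRing.Zmodule_isLmodule.Build k univ_quot
  uq_scaleA uq_scale1 uq_scaleDr uq_scaleDl.

Lemma uq_lift_linear (U : lmodType k) (f : X -> U) : C f -> linear (uq_lift f).
Proof. by move=> Cf c p q; rewrite uq_lift_add // uq_lift_scale. Qed.

Lemma uq_lift_gen (U : lmodType k) (f : X -> U) x : C f -> uq_lift f (uq_gen x) = f x.
Proof. by move=> Cf; rewrite uq_lift_pi // /fsum big_seq1 scale1r. Qed.

Lemma uq_genE (q : univ_quot) : q = \sum_(p <- repr q) p.1 *: uq_gen p.2.
Proof.
apply: uq_eqP => U f Cf; rewrite {1}/uq_lift /fsum.
elim: (repr q) => [|p s IH]; first by rewrite !big_nil uq_lift_zero.
by rewrite !big_cons uq_lift_linear // uq_lift_gen // IH.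
Qed.

End UniversalQuotient.

(* V ⊗ W: universal for bilinear maps. *)
Section Tensor.

Variables (k : fieldType) (V W : lmodType k).

Definition bilin (U : lmodType k) (f : V -> W -> U) : Prop :=
  (forall w, linear (f^~ w)) /\ (forall v, linear (f v)).

Definition tens : Type :=
  univ_quot (fun (U : lmodType k) (f : V * W -> U) => bilin (fun v w => f (v, w))).

HB.instance Definition _ := GRing.Lmodule.on tens.

Definition tpure (v : V) (w : W) : tens := uq_gen _ (v, w).

Definition tlift (t : tens) (U : lmodType k) (f : V -> W -> U) : U :=
  uq_lift (fun p => f p.1 p.2) t.

Lemma tlift_pure (U : lmodType k) (f : V -> W -> U) v w :
  bilin f -> tlift (tpure v w) f = f v w.
Proof. by move=> bf; apply: uq_lift_gen. Qed.

Lemma tlift_linear (U : lmodType k) (f : V -> W -> U) : bilin f -> linear (fun t => tlift t f).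
Proof. by move=> bf; apply: uq_lift_linear. Qed.

Lemma tens_span (t : tens) :
  exists s : seq (k * (V * W)), t = \sum_(p <- s) p.1 *: tpure p.2.1 p.2.2.
Proof.
exists (repr t); rewrite {1}[t]uq_genE.
by apply: eq_bigr => -[c [v w]] _.
Qed.

Lemma tpure_bilin : bilin tpure.
Proof.
split=> [w c v v'|v c w w']; apply: uq_eqP => U f [fl fr];
  rewrite uq_lift_linear // !uq_lift_gen //; [exact: fl | exact: fr].
Qed.

(* tlift t f is always linear in parameters occurring linearly in f. *)
Lemma tlift_param (P U : lmodType k) (f : P -> V -> W -> U) (t : tens) :
  (forall v w, linear (fun p => f p v w)) -> linear (fun p => tlift t (f p)).
Proof.
move=> fl c p q; rewrite /tlift /uq_lift /fsum scaler_sumr -big_split /=.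
by apply: eq_bigr => i _; rewrite fl scalerDr !scalerA mulrC.
Qed.

Lemma tlift_comp (U U' : lmodType k) (g : U -> U') (f : V -> W -> U) (t : tens) :
  linear g -> g (tlift t f) = tlift t (fun v w => g (f v w)).
Proof.
move=> lg; rewrite /tlift /uq_lift /fsum.
have g0 : g 0 = 0 by have := lg (-1) 0 0; rewrite !scaleN1r !addNr.
elim: (repr t) => [|p s IH]; first by rewrite !big_nil.
by rewrite !big_cons lg IH.
Qed.

End Tensor.

Arguments tens {k} (V W)%_type_scope.

Notation "V ⊗ W" := (tens V W) (at level 41, right associativity) : type_scope.
Notation "v ⊗ w" := (tpure v w) (at level 41, right associativity) : ring_scope.
(* Sweedler notation: t = x ⊗ y, summation understood. *)
Notation "\sw_ ( x , y <- t ) E" := (tlift t (fun x y => E))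
  (at level 41, x name, y name, t at level 200, E at level 41, right associativity,
   format "\sw_ ( x ,  y  <-  t )  E") : ring_scope.

Definition tmap (k : fieldType) (V V' W W' : lmodType k)
  (f : V -> V') (g : W -> W') (t : V ⊗ W) : V' ⊗ W' := \sw_(v, w <- t) (f v ⊗ g w).

(* T(V), the direct sum of the tensor powers of V: generated by the words
   v1 ... vn, multilinear in the letters, with [::] spanning the degree 0 part. *)
Section TensorAlgebra.

Variables (k : fieldType) (V : lmodType k).

Definition multilin (U : lmodType k) (f : seq V -> U) : Prop :=
  forall s1 s2, linear (fun v => f (s1 ++ v :: s2)).

Definition talg : Type := univ_quot multilin.

HB.instance Definition _ := GRing.Lmodule.on talg.

Definition word (s : seq V) : talg := uq_gen multilin s.

Definition wlift (t : talg) (U : lmodType k) (f : seq V -> U) : U := uq_lift f t.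

Lemma wlift_word (U : lmodType k) (f : seq V -> U) s :
  multilin f -> wlift (word s) f = f s.
Proof. exact: uq_lift_gen. Qed.

Lemma wlift_linear (U : lmodType k) (f : seq V -> U) : multilin f -> linear (fun t => wlift t f).
Proof. exact: uq_lift_linear. Qed.

Lemma talg_span (t : talg) :
  exists s : seq (k * seq V), t = \sum_(p <- s) p.1 *: word p.2.
Proof. by exists (repr t); exact: uq_genE. Qed.

Lemma word_multilin : multilin word.
Proof.
move=> s1 s2 c v v'; apply: uq_eqP => U f mf.
by rewrite uq_lift_linear // !uq_lift_gen // mf.
Qed.

Lemma wlift_param (P U : lmodType k) (f : P -> seq V -> U) (t : talg) :
  (forall s, linear (fun p => f p s)) -> linear (fun p => wlift t (f p)).
Proof.
move=> fl c p q; rewrite /wlift /uq_lift /fsum scaler_sumr -big_split /=.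
by apply: eq_bigr => i _; rewrite fl scalerDr !scalerA mulrC.
Qed.

End TensorAlgebra.

(* The linear extension to t of an expression given on words s. *)
Notation "\word_ ( s <- t ) E" := (wlift t (fun s => E))
  (at level 41, s name, t at level 200, E at level 41, right associativity,
   format "\word_ ( s  <-  t )  E") : ring_scope.

Section TensorAlgebraOps.

Variables (k : fieldType) (V : lmodType k).
Implicit Types (s : seq V) (t : talg V).

Definition tproj (n : nat) t : talg V :=
  \word_(s <- t) (if size s == n then word s else 0).

Definition tcat t t' : talg V := \word_(s <- t) \word_(s' <- t') word (s ++ s').

Definition decon t : talg V ⊗ talg V :=
  \word_(s <- t) (\sum_(i < (size s).+1) word (take i s) ⊗ word (drop i s)).

Definition tcou t : k := wlift (U := k^o) t (fun s => if s is [::] then 1 else 0).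

(* A linear form on V, extended by zero to the degrees other than 1. *)
Definition ext0 (theta : V -> k) t : k :=
  wlift (U := k^o) t (fun s => if s is [:: v] then theta v else 0).

Lemma tproj_linear n : linear (tproj n).
Proof.
apply: wlift_linear => s1 s2 c v v'; rewrite !size_cat /=.
by case: ifP => _; rewrite ?word_multilin // scaler0 addr0.
Qed.

Lemma tcat_bilin : bilin tcat.
Proof.
split=> [t'|t].
  by apply: wlift_linear => s1 s2; apply: wlift_param => s c v v';
    rewrite -!catA /= word_multilin.
by apply: wlift_param => s; apply: wlift_linear => s1 s2 c v v'; rewrite !catA word_multilin.
Qed.

Lemma decon_linear : linear decon.
Proof.
apply: wlift_linear => s1 s2 c v v'.
rewrite !size_cat /= scaler_sumr -big_split /=; apply: eq_bigr => i _.
rewrite !take_cat !drop_cat; case: ltnP => hi.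
  by rewrite word_multilin (tpure_bilin _ _).2.
case: (_ - _)%N => [|j] /=; first by rewrite (word_multilin [::]) (tpure_bilin _ _).2.
by rewrite word_multilin (tpure_bilin _ _).1.
Qed.

Lemma ext0_scalar (theta : {scalar V}) : scalar (ext0 theta).
Proof.
apply: (@wlift_linear k V k^o) => -[|u s1] s2 c v v' /=; last first.
  by case: s1 => [|? ?] /=; rewrite scaler0 addr0.
by case: s2 => [|? ?]; rewrite ?linearP // scaler0 addr0.
Qed.

End TensorAlgebraOps.

Record hopf_algebra (k : fieldType) := HopfAlgebra {
  hopf_sort :> algType k;
  cop : {linear hopf_sort -> (hopf_sort ⊗ hopf_sort)%type};
  cou : {scalar hopf_sort};
  ant : {linear hopf_sort -> hopf_sort};
  copA : forall a,
    \sw_(a1, a2 <- cop a) \sw_(a11, a12 <- cop a1) (a11 ⊗ a12 ⊗ a2)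
    = \sw_(a1, a2 <- cop a) \sw_(a21, a22 <- cop a2) (a1 ⊗ a21 ⊗ a22);
  couL : forall a, \sw_(a1, a2 <- cop a) (cou a1 *: a2) = a;
  couR : forall a, \sw_(a1, a2 <- cop a) (cou a2 *: a1) = a;
  cop1 : cop 1 = 1 ⊗ 1;
  copM : forall a b, cop (a * b)
    = \sw_(a1, a2 <- cop a) \sw_(b1, b2 <- cop b) (a1 * b1 ⊗ a2 * b2);
  cou1 : cou 1 = 1;
  couM : forall a b, cou (a * b) = cou a * cou b;
  antL : forall a, \sw_(a1, a2 <- cop a) (ant a1 * a2) = (cou a)%:A;
  antR : forall a, \sw_(a1, a2 <- cop a) (a1 * ant a2) = (cou a)%:A
}.

Arguments cop {k A} : rename.
Arguments cou {k A} : rename.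
Arguments ant {k A} : rename.

Record crossed_module (k : fieldType) (A : hopf_algebra k) := CrossedModule {
  crossed_sort :> lmodType k;
  act : crossed_sort -> A -> crossed_sort;
  coact : {linear crossed_sort -> (crossed_sort ⊗ A)%type};
  act_bilin : bilin act;
  act1 : forall v, act v 1 = v;
  actM : forall v a b, act v (a * b) = act (act v a) b;
  coactA : forall v,
    \sw_(v0, v1 <- coact v) \sw_(v00, v01 <- coact v0) (v00 ⊗ v01 ⊗ v1)
    = \sw_(v0, v1 <- coact v) \sw_(v11, v12 <- cop v1) (v0 ⊗ v11 ⊗ v12);
  coact_cou : forall v, \sw_(v0, v1 <- coact v) (cou v1 *: v0) = v;
  coact_act : forall v a,
    coact (act v a)
    = \sw_(v0, v1 <- coact v) \sw_(a1, b <- cop a) \sw_(a2, a3 <- cop b)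
        (act v0 a2 ⊗ ant a1 * v1 * a3)
}.

Arguments coact {k A V} : rename.

Notation "v ◁ a" := (act v a) (at level 40, left associativity) : ring_scope.

Section AugmentationIdeal.

Variables (k : fieldType) (A : hopf_algebra k).

Definition aug_ker : {pred A} := fun a => cou a == 0.

Fact aug_ker_submod : submod_closed aug_ker.
Proof.
split=> [|c a b /eqP a0 /eqP b0]; rewrite /in_mem /= /aug_ker ?linear0 //.
by rewrite linearP /= a0 b0 mulr0 addr0.
Qed.

HB.instance Definition _ := GRing.isSubmodClosed.Build k A aug_ker aug_ker_submod.

(* A^+ *)
Record aug_ideal := AugIdeal { aug_val : A; _ : aug_val \in aug_ker }.

HB.instance Definition _ := [isSub for aug_val].
HB.instance Definition _ := [Choice of aug_ideal by <:].
HB.instance Definition _ := [SubChoice_isSubLmodule of aug_ideal by <:].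

Fact aug_proj_subproof (a : A) : a - (cou a)%:A \in aug_ker.
Proof.
by rewrite /in_mem /= /aug_ker linearB linearZ /= cou1 mulr1 subrr.
Qed.

Definition aug_proj (a : A) : aug_ideal := AugIdeal (aug_proj_subproof a).

Fact aug_act_subproof (a : aug_ideal) (b : A) : aug_val a * b \in aug_ker.
Proof. by case: a => a /eqP /= a0; rewrite /in_mem /= /aug_ker couM a0 mul0r. Qed.

Definition aug_act (a : aug_ideal) (b : A) : aug_ideal :=
  AugIdeal (aug_act_subproof a b).

(* For a in A^+, a_(2) ⊗ (S a_(1)) a_(3) lies in A^+ ⊗ A, where the projection
   of A onto A^+ acts trivially on the first factor: see aug_coact_val. *)
Definition aug_coact (a : aug_ideal) : aug_ideal ⊗ A :=
  \sw_(a1, b <- cop (aug_val a)) \sw_(a2, a3 <- cop b) (aug_proj a2 ⊗ ant a1 * a3).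

Lemma aug_coact_val (a : aug_ideal) :
  tmap (@aug_val) id (aug_coact a)
  = \sw_(a1, b <- cop (aug_val a)) \sw_(a2, a3 <- cop b) (a2 ⊗ ant a1 * a3).
Proof.
have lin_val : linear aug_val by move=> c x y; exact: (linearP (val : aug_ideal -> A)).
have bl : bilin (fun (x : aug_ideal) (y : A) => aug_val x ⊗ y).
  by split=> [y c x x'|x c y y']; rewrite ?lin_val ((tpure_bilin _ _).1, (tpure_bilin _ _).2).
have lin_map : linear (tmap aug_val (@id A)) by exact: tlift_linear.
rewrite /aug_coact (tlift_comp _ _ lin_map).
have E a1 b : tmap aug_val id
      (\sw_(a2, a3 <- cop b) (aug_proj a2 ⊗ ant a1 * a3))
    = \sw_(a2, a3 <- cop b) (a2 ⊗ ant a1 * a3) - 1 ⊗ (ant a1 * b).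
  rewrite (tlift_comp _ _ lin_map) -{3}[b]couL.
  rewrite (tlift_comp _ _ (g := fun x => 1 ⊗ (ant a1 * x))); last first.
    move=> c x y; rewrite mulrDr -scalerAr; exact: (tpure_bilin _ _).2.
  rewrite /tlift /uq_lift /fsum -sumrB; apply: eq_bigr => -[c [x y]] _ /=.
  rewrite -scalerBr; congr (_ *: _).
  rewrite /tmap tlift_pure //= -scalerAr.
  have [lt1 lt2] := tpure_bilin A A.
  have t10 : 1 ⊗ 0 = 0 :> A ⊗ A.
    by have := lt2 1 (-1) 0 0; rewrite scaleN1r oppr0 addr0 scaleN1r addNr.
  have -> : 1 ⊗ (cou x *: (ant a1 * y)) = cou x *: (1 ⊗ (ant a1 * y)) :> A ⊗ A.
    by have := lt2 1 (cou x) (ant a1 * y) 0; rewrite addr0 t10 addr0.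
  by have := lt1 (ant a1 * y) (- cou x) 1 x; rewrite !scaleNr ![- _ + _]addrC.
transitivity (\sw_(a1, b <- cop (aug_val a)) \sw_(a2, a3 <- cop b) (a2 ⊗ ant a1 * a3)
  - \sw_(a1, b <- cop (aug_val a)) (1 ⊗ (ant a1 * b))).
  rewrite /tlift /uq_lift /fsum -sumrB; apply: eq_bigr => -[c [a1 b]] _ /=.
  by rewrite -scalerBr; congr (_ *: _); exact: E.
rewrite -(tlift_comp (g := fun x : A => 1 ⊗ x)); last exact: (tpure_bilin _ _).2.
rewrite antL; case: a => a /= /eqP -> ; rewrite scale0r.
have := (tpure_bilin A A).2 1 (-1) 0 0.
by rewrite scaleN1r oppr0 addr0 scaleN1r addNr => ->; rewrite subr0.
Qed.

End AugmentationIdeal.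

Section CrossedModuleMaps.

Variables (k : fieldType) (A : hopf_algebra k) (V : crossed_module A).

Definition right_invariant (theta : {scalar V}) : Prop :=
  forall (v : V) (a : A), theta (v ◁ a) = cou a * theta v.

Definition aug_crossed_map (omega : {linear aug_ideal A -> V}) : Prop :=
  (forall (a : aug_ideal A) (b : A), omega (aug_act a b) = omega a ◁ b) /\
  (forall a : aug_ideal A, coact (omega a) = tmap omega id (aug_coact a)).

Definition omega_tilde (omega : {linear aug_ideal A -> V}) (a : A) : V :=
  omega (aug_proj a).

End CrossedModuleMaps.

(* The structure of T(V) as a crossed module, and the product of Sh_-(V). *)
Section ShuffleAlgebra.

Variables (k : fieldType) (A : hopf_algebra k) (V : crossed_module A).
Implicit Types (s : seq V) (t : talg V).

Fixpoint word_act s (a : A) : talg V :=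
  if s is v :: s' then
    \sw_(a1, a2 <- cop a) tcat (word [:: v ◁ a1]) (word_act s' a2)
  else cou a *: word [::].

Definition tact t (a : A) : talg V := \word_(s <- t) word_act s a.

Fixpoint word_coact s : talg V ⊗ A :=
  if s is v :: s' then
    \sw_(v0, v1 <- coact v) \sw_(t0, t1 <- word_coact s')
      (tcat (word [:: v0]) t0 ⊗ v1 * t1)
  else word [::] ⊗ 1.

Definition tcoact t : talg V ⊗ A := \word_(s <- t) word_coact s.

(* Psi_i, acting on the factors i and i+1 (counted from 1); only meaningful on
   words with at least i+1 letters. *)
Definition braid (i : nat) t : talg V :=
  \word_(s <- t)
    (if drop i.-1 s is v :: w :: s2 then
       \sw_(w0, w1 <- coact w) word (take i.-1 s ++ [:: w0, v ◁ w1 & s2])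
     else word s).

(* f ⊗ id, where f acts on all the factors but the last one. *)
Definition on_belast (f : talg V -> talg V) t : talg V :=
  \word_(s <- t) tcat (f (word (take (size s).-1 s))) (word (drop (size s).-1 s)).

(* P_(n-1) ... P_r, with P_r applied first. *)
Definition braid_chain (P : nat -> talg V -> talg V) (r n : nat) t : talg V :=
  foldl (fun t' i => P i t') t (iota r (n - r)).

(* The braided binomial (binom(n, r); P), as an operator on V^{⊗ n}. *)
Fixpoint braided_binom (P : nat -> talg V -> talg V) (n r : nat) t : talg V :=
  match n, r with
  | _, 0 => t
  | 0, _.+1 => 0
  | n'.+1, r'.+1 =>
      on_belast (braided_binom P n' r') (braid_chain P r n t)
      + on_belast (braided_binom P n' r) t
  end.

Definition sh_mul t t' : talg V :=
  \word_(s <- t) \word_(s' <- t')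
    braided_binom (fun i x => - braid i x) (size s + size s') (size s) (word (s ++ s')).

Lemma word_coact_multilin : multilin word_coact.
Proof.
have [tl1 tl2] := tcat_bilin V; have [lt1 lt2] := tpure_bilin (talg V) A.
elim=> [|u s1 IH] s2 c v v' /=.
  rewrite linearP tlift_linear //; split=> [v1|v0]; apply: tlift_param => t0 t1 d x y.
    by rewrite (word_multilin [::]) tl1 lt1.
  by rewrite mulrDl -scalerAl lt2.
move: c v v'; apply: tlift_param => u0 u1 c v v'.
rewrite IH tlift_linear //; split=> [t1|t0] e z z'.
  by rewrite tl2 lt1.
by rewrite mulrDr -scalerAr lt2.
Qed.

Lemma tcoact_linear : linear tcoact.
Proof. exact: wlift_linear word_coact_multilin. Qed.

End ShuffleAlgebra.

Section Btheta.

Variables (k : fieldType) (A : hopf_algebra k) (V : crossed_module A).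
Variable theta : {scalar V}.

(* F b^1 b^2 b^3 b^4, summed over the iterated coproduct of b. *)
Definition decon4 (U : lmodType k) (F : talg V -> talg V -> talg V -> talg V -> U) (b : talg V) : U :=
  \sw_(b1, c1 <- decon b) \sw_(b2, c2 <- decon c1) \sw_(b3, b4 <- decon c2) F b1 b2 b3 b4.

Definition B_lhs (b : talg V) : talg V ⊗ A ⊗ talg V :=
  decon4 (fun b1 b2 b3 b4 =>
    \sw_(b20, b21 <- tcoact b2) \sw_(b30, b31 <- tcoact b3)
      ((ext0 theta b20 * ext0 theta b30) *: (b1 ⊗ (b21 * b31) ⊗ b4))) b.

Definition B_mid (b : talg V) : talg V ⊗ A ⊗ talg V :=
  decon4 (fun b1 b2 b3 b4 =>
    (ext0 theta b2 * ext0 theta b3) *: (b1 ⊗ (1 : A) ⊗ b4)) b.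

Definition B_rhs (b : talg V) : talg V ⊗ A ⊗ talg V :=
  decon4 (fun b1 b2 b3 b4 =>
    (ext0 theta b1 * ext0 theta b2) *: (b3 ⊗ (1 : A) ⊗ b4)) b.

Definition B_pred : {pred talg V} := fun b => (B_lhs b == B_mid b) && (B_mid b == B_rhs b).

Lemma decon4_linear (U : lmodType k) (F : talg V -> talg V -> talg V -> talg V -> U) :
  (forall b2 b3 b4, linear (fun b => F b b2 b3 b4)) ->
  (forall b1 b3 b4, linear (fun b => F b1 b b3 b4)) ->
  (forall b1 b2 b4, linear (fun b => F b1 b2 b b4)) ->
  (forall b1 b2 b3, linear (F b1 b2 b3)) -> linear (decon4 F).
Proof.
move=> l1 l2 l3 l4 c x y; rewrite /decon4 decon_linear.
have bl3 b1 b2 : bilin (F b1 b2) by split.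
have bl2 b1 : bilin (fun b2 c2 => tlift (decon c2) (F b1 b2)).
  split=> [t|t]; first exact: tlift_param.
  by move=> d u v; rewrite decon_linear tlift_linear.
apply: (@tlift_linear _ _ _ _ (fun b1 c1 =>
  tlift (decon c1) (fun b2 c2 => tlift (decon c2) (F b1 b2)))).
split=> [t|t]; first by apply: tlift_param => u v; apply: tlift_param.
by move=> d u v; rewrite decon_linear tlift_linear.
Qed.

Lemma B_lhs_linear : linear B_lhs.
Proof.
have [p1 p2] := tpure_bilin (talg V) (A ⊗ talg V)%type.
have [q1 q2] := tpure_bilin A (talg V).
have es := ext0_scalar theta.
pose G b1 b4 (b20 : talg V) (b21 : A) (b30 : talg V) (b31 : A) : talg V ⊗ A ⊗ talg V :=
  (ext0 theta b20 * ext0 theta b30) *: (b1 ⊗ (b21 * b31) ⊗ b4).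
have scAC (W : lmodType k) (c d e : k) (w w' : W) : e *: (c *: w + w') = c *: (e *: w) + e *: w'.
  by rewrite scalerDr !scalerA [e * c]mulrC.
have bl3 b1 b4 b20 b21 : bilin (G b1 b4 b20 b21).
  split=> [b31|b30] c x y; rewrite /G.
    by rewrite es mulrDr scalerDl scalerA mulrCA.
  by rewrite mulrDr -scalerAr q1 p2 scAC.
have bl2 b1 b4 b3 : bilin (fun b20 b21 => tlift (tcoact b3) (G b1 b4 b20 b21)).
  split=> [b21|b20]; apply: tlift_param => b30 b31 c x y; rewrite /G.
    by rewrite es mulrDl scalerDl scalerA mulrA.
  by rewrite mulrDl -scalerAl q1 p2 scAC.
apply: decon4_linear => [b2 b3 b4|b1 b3 b4|b1 b2 b4|b1 b2 b3].
- apply: tlift_param => b20 b21; apply: tlift_param => b30 b31 c x y.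
  by rewrite p1 scAC.
- by move=> c x y; rewrite tcoact_linear (tlift_linear (bl2 _ _ _)).
- by apply: tlift_param => b20 b21 c x y; rewrite tcoact_linear (tlift_linear (bl3 _ _ _ _)).
- apply: tlift_param => b20 b21; apply: tlift_param => b30 b31 c x y.
  by rewrite q2 p2 scAC.
Qed.

Lemma B_mid_linear : linear B_mid.
Proof.
have [p1 p2] := tpure_bilin (talg V) (A ⊗ talg V)%type.
have [q1 q2] := tpure_bilin A (talg V).
have es := ext0_scalar theta.
apply: decon4_linear => [b2 b3 b4|b1 b3 b4|b1 b2 b4|b1 b2 b3] c x y.
- by rewrite p1 scalerDr !scalerA mulrC.
- by rewrite es mulrDl scalerDl scalerA mulrA.
- by rewrite es mulrDr scalerDl scalerA mulrCA.
- by rewrite q2 p2 scalerDr !scalerA [_ * c]mulrC.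
Qed.

Lemma B_rhs_linear : linear B_rhs.
Proof.
have [p1 p2] := tpure_bilin (talg V) (A ⊗ talg V)%type.
have [q1 q2] := tpure_bilin A (talg V).
have es := ext0_scalar theta.
apply: decon4_linear => [b2 b3 b4|b1 b3 b4|b1 b2 b4|b1 b2 b3] c x y.
- by rewrite es mulrDl scalerDl scalerA mulrA.
- by rewrite es mulrDr scalerDl scalerA mulrCA.
- by rewrite p1 scalerDr !scalerA [_ * c]mulrC.
- by rewrite q2 p2 scalerDr !scalerA [_ * c]mulrC.
Qed.

Fact B_submod : submod_closed B_pred.
Proof.
have lin0 (U U' : lmodType k) (f : U -> U') : linear f -> f 0 = 0.
  by move=> lf; have := lf (-1) 0 0; rewrite !scaleN1r !addNr.
split; first by rewrite /in_mem /= /B_pred !lin0 ?eqxx //;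
  [exact: B_rhs_linear | exact: B_mid_linear | exact: B_lhs_linear].
move=> c x y /andP[/eqP x1 /eqP x2] /andP[/eqP y1 /eqP y2].
rewrite /in_mem /= /B_pred B_lhs_linear B_mid_linear B_rhs_linear.
by rewrite x1 y1 -x2 -y2 !eqxx.
Qed.

HB.instance Definition _ := GRing.isSubmodClosed.Build k (talg V) B_pred B_submod.

(* B_theta(V), whose inclusion in Sh_-(V) is B_val. *)
Record B_theta := BTheta { B_val : talg V; _ : B_val \in B_pred }.

HB.instance Definition _ := [isSub for B_val].
HB.instance Definition _ := [Choice of B_theta by <:].
HB.instance Definition _ := [SubChoice_isSubLmodule of B_theta by <:].

End Btheta.

(* The algebra A # Sh_-(V), its differential, and the codifferential i of
   A # B_theta(V). *)
Section Bosonization.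

Variables (k : fieldType) (A : hopf_algebra k) (V : crossed_module A).
Variables (theta : {scalar V}) (omega : {linear aug_ideal A -> V}).
Implicit Types (x y : A ⊗ talg V).

Definition smash_mul x y : A ⊗ talg V :=
  \sw_(a, e <- x) \sw_(b, z <- y) \sw_(b1, b2 <- cop b)
    (a * b1 ⊗ sh_mul (tact e b2) z).

Definition smash_one : A ⊗ talg V := 1 ⊗ word [::].

Definition smash_cop x : (A ⊗ talg V) ⊗ (A ⊗ talg V) :=
  \sw_(a, e <- x) \sw_(a1, a2 <- cop a) \sw_(e1, e2 <- decon e)
    \sw_(e10, e11 <- tcoact e1) ((a1 ⊗ e10) ⊗ (a2 * e11 ⊗ e2)).

Definition smash_cou x : k := tlift (U := k^o) x (fun a e => cou a * tcou e).

Definition smash_proj (n : nat) x : A ⊗ talg V := tmap id (tproj n) x.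

Definition smash_codiff x : A ⊗ talg V :=
  \sw_(a, e <- x) \word_(s <- e)
    (if s is v :: s' then
       \sw_(v0, v1 <- coact v) (theta v0 *: (a * v1 ⊗ word s'))
       + ((-1) ^+ size s * theta (last v s')) *: (a ⊗ word (belast v s'))
     else 0).

(* delta (v1 ⊗ ... ⊗ vn), for n = size s. *)
Fixpoint word_delta (n : nat) (s : seq V) : talg V :=
  if n is m.+1 then
    tcat (word_delta m (take m s)) (word (drop m s))
    + (-1) ^+ n *: \sw_(t0, t1 <- word_coact s) tcat t0 (word [:: omega_tilde omega t1])
  else 0.

Definition sh_delta (t : talg V) : talg V := \word_(s <- t) word_delta (size s) s.

Definition smash_diff x : A ⊗ talg V :=
  \sw_(a, e <- x)
    ((\sw_(a1, a2 <- cop a) (a1 ⊗ sh_mul (word [:: omega_tilde omega a2]) e))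
     + a ⊗ sh_delta e).

End Bosonization.

(* An N-grading of W, given by the projections onto the homogeneous components. *)
Record grading (k : fieldType) (W : lmodType k) := Grading {
  gproj : nat -> {linear W -> W};
  gprojK : forall m n x, gproj m (gproj n x) = if m == n then gproj n x else 0;
  gproj_sum : forall x, exists N, x = \sum_(n < N) gproj n x
}.

Definition homog (k : fieldType) (W : lmodType k) (G : grading W) (n : nat) (x : W) : Prop :=
  gproj G n x = x.

(* A graded super-Hopf algebra structure on W. The Koszul signs are written out on
   homogeneous elements x, whose coproduct is the sum of its components in
   W^p ⊗ W^(n-p), where n is the degree of x. *)
Record super_hopf (k : fieldType) (W : lmodType k) := SuperHopf {
  sgr :> grading W;
  smul : W -> W -> W;
  sone : W;
  scop : {linear W -> (W ⊗ W)%type};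
  scou : {scalar W};
  sant : {linear W -> W};
  smul_bilin : bilin smul;
  smulA : associative smul;
  smul1 : left_id sone smul;
  smulr1 : right_id sone smul;
  smul_homog : forall m n x y,
    homog sgr m x -> homog sgr n y -> homog sgr (m + n) (smul x y);
  sone_homog : homog sgr 0 sone;
  scopA : forall x,
    \sw_(x1, x2 <- scop x) \sw_(x11, x12 <- scop x1) (x11 ⊗ x12 ⊗ x2)
    = \sw_(x1, x2 <- scop x) \sw_(x21, x22 <- scop x2) (x1 ⊗ x21 ⊗ x22);
  scouL : forall x, \sw_(x1, x2 <- scop x) (scou x1 *: x2) = x;
  scouR : forall x, \sw_(x1, x2 <- scop x) (scou x2 *: x1) = x;
  scop_homog : forall n x, homog sgr n x ->
    scop x = \sum_(p < n.+1) tmap (gproj sgr p) (gproj sgr (n - p)) (scop x);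
  scou_homog : forall n x, homog sgr n.+1 x -> scou x = 0;
  scop1 : scop sone = sone ⊗ sone;
  scopM : forall m n x y, homog sgr m x -> homog sgr n y ->
    scop (smul x y) = \sum_(p < m.+1) \sum_(q < n.+1) (-1) ^+ ((m - p) * q) *:
      \sw_(x1, x2 <- scop x) \sw_(y1, y2 <- scop y)
        (smul (gproj sgr p x1) (gproj sgr q y1)
         ⊗ smul (gproj sgr (m - p) x2) (gproj sgr (n - q) y2));
  scou1 : scou sone = 1;
  scouM : forall x y, scou (smul x y) = scou x * scou y;
  sant_homog : forall n x, homog sgr n x -> homog sgr n (sant x);
  santL : forall x, \sw_(x1, x2 <- scop x) smul (sant x1) x2 = scou x *: sone;
  santR : forall x, \sw_(x1, x2 <- scop x) smul x1 (sant x2) = scou x *: sone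
}.

Section SuperDerivations.

Variables (k : fieldType) (W : lmodType k) (H : super_hopf W) (D : W -> W).

Definition super_derivation : Prop := forall n x y, homog H n x ->
  D (smul H x y) = smul H (D x) y + (-1) ^+ n *: smul H x (D y).

Definition super_coderivation : Prop := forall n x, homog H n x ->
  scop H (D x) = \sw_(x1, x2 <- scop H x) (D x1 ⊗ x2)
    + \sum_(p < n.+1) (-1) ^+ p *: \sw_(x1, x2 <- scop H x) (gproj H p x1 ⊗ D x2).

End SuperDerivations.

Record aug_ext_algebra (k : fieldType) (A : hopf_algebra k) (W : lmodType k) := AugExtAlgebra {
  ext_hopf :> super_hopf W;
  ext_inj : {linear A -> W};
  ext_diff : {linear W -> W};
  ext_codiff : {linear W -> W};
  (* W^0 = A as a Hopf algebra *)
  ext_inj_inj : injective ext_inj;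
  ext_inj_im : forall x, homog ext_hopf 0 x <-> exists a, x = ext_inj a;
  ext_inj1 : ext_inj 1 = sone ext_hopf;
  ext_injM : forall a b, ext_inj (a * b) = smul ext_hopf (ext_inj a) (ext_inj b);
  ext_inj_cop : forall a, scop ext_hopf (ext_inj a) = tmap ext_inj ext_inj (cop a);
  ext_inj_cou : forall a, scou ext_hopf (ext_inj a) = cou a;
  ext_inj_ant : forall a, sant ext_hopf (ext_inj a) = ext_inj (ant a);
  ext_diff_homog : forall n x, homog ext_hopf n x -> homog ext_hopf n.+1 (ext_diff x);
  ext_diff2 : forall x, ext_diff (ext_diff x) = 0;
  ext_diff_der : super_derivation ext_hopf ext_diff;
  ext_diff_coder : super_coderivation ext_hopf ext_diff;
  ext_codiff_homog0 : forall x, homog ext_hopf 0 x -> ext_codiff x = 0;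
  ext_codiff_homog : forall n x, homog ext_hopf n.+1 x -> homog ext_hopf n (ext_codiff x);
  ext_codiff2 : forall x, ext_codiff (ext_codiff x) = 0;
  ext_codiff_der : super_derivation ext_hopf ext_codiff;
  ext_codiff_coder : super_coderivation ext_hopf ext_codiff
}.

(* E is the structure of A # B_theta(V), with its codifferential i and with the
   differential of A # Sh_-(V): every operation of E is the restriction along
   the inclusion A ⊗ B_theta(V) -> A ⊗ Sh_-(V) of the one given there. *)
Section Inherited.

Variables (k : fieldType) (A : hopf_algebra k) (V : crossed_module A).
Variables (theta : {scalar V}) (omega : {linear aug_ideal A -> V}).

Definition smash_incl : A ⊗ B_theta theta -> A ⊗ talg V := tmap id (@B_val _ _ _ theta).

Record inherited (E : aug_ext_algebra A (A ⊗ B_theta theta)%type) : Prop := Inherited {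
  inh_inj : forall a, smash_incl (ext_inj E a) = a ⊗ word [::];
  inh_grading : forall n x, smash_incl (gproj E n x) = smash_proj n (smash_incl x);
  inh_mul : forall x y,
    smash_incl (smul E x y) = smash_mul (smash_incl x) (smash_incl y);
  inh_one : smash_incl (sone E) = smash_one V;
  inh_cop : forall x, tmap smash_incl smash_incl (scop E x) = smash_cop (smash_incl x);
  inh_cou : forall x, scou E x = smash_cou (smash_incl x);
  inh_codiff : forall x, smash_incl (ext_codiff E x) = smash_codiff theta (smash_incl x);
  inh_diff : forall x, smash_incl (ext_diff E x) = smash_diff omega (smash_incl x)
}.

End Inherited.

Section Pairing.

Variables (k : fieldType) (A : hopf_algebra k) (V : crossed_module A).
Variables (theta : {scalar V}) (omega : {linear aug_ideal A -> V}).

(* < theta ⊗ theta, v_0 ⊗ omega~(v_1) > *)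
Definition theta_omega (v : V) : k :=
  tlift (U := k^o) (coact v) (fun v0 v1 => theta v0 * theta (omega_tilde omega v1)).

End Pairing.

(* Main.v *)
(* On A # Sh_-(V) the codifferential i is the super-commutator of the left and right
   convolutions with theta, so that i^2 is the difference of the convolutions with
   theta * theta, and A ⊗ B_theta(V) turns out to be the largest subcoalgebra on which
   i^2 vanishes. It is therefore stable under products and under i. Moreover
   i^2 d - d i^2 = - i_omega, where i_omega is the map defined as i with
   <theta ⊗ theta, v_0 ⊗ omega~(v_1)> in place of theta; hence d preserves
   A ⊗ B_theta(V) if and only if i_omega vanishes there, and the two conditions of the
   theorem express this vanishing on 1 ⊗ w and on 1 ⊗ b. Since subspaces of the infinite
   dimensional Sh_-(V) are only known as kernels, linear projections onto them (from
   Zorn's lemma) restrict the coproduct; the antipode is given by Takeuchi's formula. *)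

From HB Require Import structures.
Require Import Defs.
From mathcomp Require Import all_boot all_algebra boolp ssrAC.
From mathcomp Require classical_sets.

Set Implicit Arguments.
Unset Strict Implicit.
Unset Printing Implicit Defensive.

Import GRing.Theory.
Local Open Scope ring_scope.

(** The recursion of the braided binomials peels off the last tensor factor. So the last letter of a
    product is that of the right factor, or that of the left factor carried through the right one by
    its coaction. This describes the product with no braid operator left, and identities become
    inductions on the degree. The commutator of i^2 with d arises in two stages. The convolutions
    with theta commute with d up to sign and up to the convolution with the degree 0 form theta o
    omega~; exchanging that one with theta then produces <theta ⊗ theta, v_0 ⊗ omega~(v_1)>. As i is
    an odd derivation and coderivation, i^2 is an ordinary derivation that commutes with i; hence
    the stability under products and under i. The first condition of the theorem is the
    A-coinvariance of the form that defines i_omega. Under it i_omega acts on the second factor of A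
    ⊗ B_theta(V) only, which is why its values at a = 1 decide. *)

Definition lin (k : fieldType) (U U' : lmodType k) (f : U -> U') : Prop := linear f.
(** Both names give the tactics a head symbol to match on. Scalar forms have their own predicate
    because k is a module over itself only through [k^o]. *)
Definition scal (k : fieldType) (U : lmodType k) (f : U -> k) : Prop := scalar f.

Notation linl F := (forall y, lin (fun x => F x y)).
Notation linr F := (forall x, lin (fun y => F x y)).
Notation lin3l F := (forall y z, lin (fun x => F x y z)).
Notation lin3m F := (forall x z, lin (fun y => F x y z)).
Notation lin3r F := (forall x y, lin (fun z => F x y z)).

(** * Linear maps and Sweedler sums *)

Section Lin.

Variable k : fieldType.
Implicit Types U V W Z : lmodType k.

Lemma lin0 U V (f : U -> V) : lin f -> f 0 = 0.
Proof. by move=> lf; have := lf (-1) 0 0; rewrite !scaleN1r !addNr. Qed.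

Lemma linD U V (f : U -> V) : lin f -> {morph f : x y / x + y}.
Proof. by move=> lf x y; have := lf 1 x y; rewrite !scale1r. Qed.

Lemma linZ U V (f : U -> V) c x : lin f -> f (c *: x) = c *: f x.
Proof. by move=> lf; have := lf c x 0; rewrite (lin0 lf) !addr0. Qed.

Lemma linN U V (f : U -> V) x : lin f -> f (- x) = - f x.
Proof. by move=> lf; rewrite -scaleN1r (linZ _ _ lf) scaleN1r. Qed.

Lemma lin_sum U V (f : U -> V) I (r : seq I) (P : pred I) (F : I -> U) : lin f ->
  f (\sum_(i <- r | P i) F i) = \sum_(i <- r | P i) f (F i).
Proof. by move=> lf; apply: big_morph; [exact: linD | exact: lin0]. Qed.

Lemma scale_scale U (c d : k) (u : U) : c *: (d *: u) = (c * d) *: u.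
Proof. exact: scalerA. Qed.

Lemma lin_id U : lin (fun x : U => x). Proof. by []. Qed.

Lemma lin_cst0 U V : lin (fun _ : U => 0 : V).
Proof. by move=> c x y; rewrite scaler0 addr0. Qed.

Lemma lin_comp U V W (f : V -> W) (g : U -> V) : lin f -> lin g -> lin (fun x => f (g x)).
Proof. by move=> lf lg c x y; rewrite lg lf. Qed.

Lemma lin_add U V (f g : U -> V) : lin f -> lin g -> lin (fun x => f x + g x).
Proof. by move=> lf lg c x y; rewrite lf lg scalerDr addrACA. Qed.

Lemma lin_opp U V (f : U -> V) : lin f -> lin (fun x => - f x).
Proof. by move=> lf c x y; rewrite lf opprD scalerN. Qed.

Lemma lin_scale U V (c : k) (f : U -> V) : lin f -> lin (fun x => c *: f x).
Proof. by move=> lf d x y; rewrite lf scalerDr !scalerA mulrC. Qed.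

Lemma lin_scalel U V (s : U -> k) (v : V) : scal s -> lin (fun x => s x *: v).
Proof. by move=> ls d x y; rewrite ls scalerDl scalerA. Qed.

Lemma lin_big U V I (r : seq I) (P : pred I) (F : U -> I -> V) :
  linl F -> lin (fun x => \sum_(i <- r | P i) F x i).
Proof.
move=> lF c x y; rewrite scaler_sumr -big_split /=.
by apply: eq_bigr => i _; rewrite lF.
Qed.

Lemma lin_if U V (b : bool) (f g : U -> V) :
  lin f -> lin g -> lin (fun x => if b then f x else g x).
Proof. by case: b. Qed.

Lemma lin_linear U V (f : {linear U -> V}) : lin f.
Proof. by move=> c x y; rewrite linearP. Qed.

Lemma scal_scalar U (f : {scalar U}) : scal f.
Proof. by move=> c x y; rewrite linearP. Qed.

Lemma scal_comp U V (f : V -> k) (g : U -> V) : scal f -> lin g -> scal (fun x => f (g x)).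
Proof. by move=> lf lg c x y; rewrite lg lf. Qed.

Lemma scal_mull U (c : k) (s : U -> k) : scal s -> scal (fun x => c * s x).
Proof. by move=> ls d x y; rewrite ls mulrDr mulrCA. Qed.

Lemma scal_mulr U (c : k) (s : U -> k) : scal s -> scal (fun x => s x * c).
Proof. by move=> ls d x y; rewrite ls mulrDl -mulrA. Qed.

Lemma scal_add U (s t : U -> k) : scal s -> scal t -> scal (fun x => s x + t x).
Proof. by move=> ls lt d x y; rewrite ls lt mulrDr addrACA. Qed.

Lemma lin_mull (B : algType k) (a : B) : lin (fun x : B => a * x).
Proof. by move=> c x y; rewrite mulrDr -scalerAr. Qed.

Lemma lin_mulr (B : algType k) (a : B) : lin (fun x : B => x * a).
Proof. by move=> c x y; rewrite mulrDl -scalerAl. Qed.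

Lemma lin_tpurel V W (w : W) : lin (fun v : V => v ⊗ w).
Proof. exact: (tpure_bilin V W).1. Qed.

Lemma lin_tpurer V W (v : V) : lin (fun w : W => v ⊗ w).
Proof. exact: (tpure_bilin V W).2. Qed.

Lemma lin_tliftl U V W Z (t : Z -> (V ⊗ W)%type) (F : V -> W -> U) :
  linl F -> linr F -> lin t -> lin (fun z => tlift (t z) F).
Proof. by move=> F1 F2 lt c x y; rewrite lt tlift_linear. Qed.

Lemma lin_tliftr U V W Z (t : (V ⊗ W)%type) (F : Z -> V -> W -> U) :
  lin3l F -> lin (fun z => tlift t (F z)).
Proof. exact: tlift_param. Qed.

End Lin.

(** Hooks: later parts redefine them to recognize the operations just proved linear, and [lin_tac]
    always uses the current version. *)
Ltac scal_atom := fail.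
Ltac lin_atom := fail.

Ltac eta_lin :=
  lazymatch goal with
  | |- lin (fun _ => _) => idtac
  | |- @lin ?k ?U ?V ?f => change (@lin k U V (fun x => f x))
  end.

Ltac lin_base :=
  first
  [ eta_lin;
    lazymatch goal with
    | |- lin (fun x => @tpure _ _ _ x _) => apply lin_tpurel
    | |- lin (fun x => @tpure _ _ _ _ x) => apply lin_tpurer
    | |- lin (fun x => @GRing.mul _ x _) => apply lin_mulr
    | |- lin (fun x => @GRing.mul _ _ x) => apply lin_mull
    | |- lin (fun x => @act _ _ _ x _) => apply (proj1 (act_bilin _))
    | |- lin (fun x => @act _ _ _ _ x) => apply (proj2 (act_bilin _))
    | |- lin (fun x => @GRing.Linear.sort _ _ _ _ _ x) => apply lin_linear
    | |- _ => solve [lin_atom]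
    end
  | match goal with H : ?T |- _ =>
      lazymatch T with context [@lin] => solve [apply H] end end ].

Ltac uncst f := lazymatch f with (fun _ => ?c) => c end.

(* Writes the term E, in which exactly one argument a depends on x, as a function
   of that argument; returns the function and a. *)
Ltac split_app E x :=
  lazymatch E with
  | ?h ?a =>
    lazymatch h with
    | context [x] =>
        let p := split_app h x in
        lazymatch p with (?hf, ?b) =>
          let hf' := eval cbn beta in (fun y__ => hf y__ a) in constr:((hf', b)) end
    | _ => constr:((fun y__ => h y__, a))
    end
  end.

Ltac split_fun f :=
  lazymatch type of f with
  | ?U -> _ =>
      let p := constr:(fun x__ : U => ltac:(
        let E := eval cbn beta in (f x__) in let q := split_app E x__ in exact q)) in
      lazymatch p with (fun x => (@?h x, @?a x)) =>
        let h0 := uncst h in constr:((h0, a)) end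
  end.

(** Apart from sums, a linear expression in x contains x in exactly one argument of each operation.
    The search follows this occurrence: into the tensor or the summand of a [tlift], into the scalar
    or the vector of a scaling, and by [split_app] through any other application. *)
Ltac lin_tac :=
  intros; cbn beta;
  lazymatch goal with
  | |- lin (fun x => x) => apply lin_id
  | |- lin (fun x => 0) => apply lin_cst0
  | |- lin (fun x => @Algebra.add _ (@?f x) (@?g x)) =>
      apply (@lin_add _ _ _ f g); lin_tac
  | |- lin (fun x => @Algebra.opp _ (@?f x)) => apply (@lin_opp _ _ _ f); lin_tac
  | |- lin (fun x => @GRing.scale _ _ (@?s x) (@?f x)) =>
      first [ let c := uncst s in apply (@lin_scale _ _ _ c f); lin_tac
            | let v := uncst f in apply (@lin_scalel _ _ _ s v); lin_tac ]
  | |- lin (fun x => tlift (@?t x) (@?F x)) =>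
      first [ let t0 := uncst t in apply (@lin_tliftr _ _ _ _ _ t0 F); lin_tac
            | let F0 := uncst F in apply (@lin_tliftl _ _ _ _ _ t F0); lin_tac ]
  | |- lin (fun x => bigop.body _ _ (fun i => BigBody _ _ _ _)) => apply lin_big; lin_tac
  | |- lin (fun x => if _ then _ else _) => apply lin_if; lin_tac
  | |- lin ?f => first [ solve [lin_base] | lin_app f ]
  | |- scal (fun x => @?s x * @?t x) =>
      first [ let c := uncst s in apply (@scal_mull _ _ c t); lin_tac
            | let c := uncst t in apply (@scal_mulr _ _ c s); lin_tac ]
  | |- scal (fun x => @?s x + @?t x) => apply (@scal_add _ _ s t); lin_tac
  | |- scal ?f => first [ match goal with H : ?T |- _ =>
               lazymatch T with context [@scal] => solve [apply H] end end
             | apply scal_scalar | solve [scal_atom] | scal_app f]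
  end
with lin_app f :=
  lazymatch f with
  | (fun _ => _) =>
    let p := split_fun f in
    lazymatch p with (?h, ?a) =>
      lazymatch a with
      | (fun x => x) => fail
      | _ => apply (@lin_comp _ _ _ _ h a); lin_tac
      end end
  | _ => let g := eval hnf in f in
      lazymatch g with (fun _ => _) => change (lin g); lin_tac end
  end
with scal_app f :=
  let p := split_fun f in
  lazymatch p with (?h, ?a) =>
    lazymatch a with
    | (fun x => x) => fail
    | _ => apply (@scal_comp _ _ _ h a); lin_tac
    end end.

#[global] Hint Extern 0 (lin _) => solve [lin_tac] : core.
#[global] Hint Extern 0 (scal _) => solve [lin_tac] : core.

Section Sweedler.

Variable k : fieldType.
Implicit Types U V W Z : lmodType k.

Lemma eq_sw U V W (t : (V ⊗ W)%type) (f g : V -> W -> U) :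
  (forall v w, f v w = g v w) -> tlift t f = tlift t g.
Proof. by move=> e; rewrite /tlift; apply: eq_bigr => p _; rewrite e. Qed.

Lemma swE U V W v w (f : V -> W -> U) :
  linl f -> linr f -> tlift (v ⊗ w) f = f v w.
Proof. by move=> f1 f2; rewrite tlift_pure. Qed.

Lemma sw_flat U V W V' W' (t : (V' ⊗ W')%type) (g : V' -> W' -> (V ⊗ W)%type) (f : V -> W -> U) :
  linl f -> linr f -> tlift (tlift t g) f = \sw_(x, y <- t) tlift (g x y) f.
Proof.
by move=> f1 f2; rewrite (@tlift_comp _ _ _ _ _ (fun s => tlift s f)) //; exact: tlift_linear.
Qed.

Lemma sw_lin U V W Z (h : U -> Z) (t : (V ⊗ W)%type) (f : V -> W -> U) :
  lin h -> h (tlift t f) = \sw_(x, y <- t) h (f x y).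
Proof. exact: tlift_comp. Qed.

Section Left.
Variables (U V W : lmodType k) (f : V -> W -> U).
Hypotheses (f1 : forall w, lin (fun v => f v w)) (f2 : forall v, lin (fun w => f v w)).
Let lf : lin (fun t => tlift t f). Proof. exact: tlift_linear. Qed.
Lemma swD s t : tlift (s + t) f = tlift s f + tlift t f. Proof. exact: linD lf _ _. Qed.
Lemma swZ c t : tlift (c *: t) f = c *: tlift t f. Proof. exact: linZ lf. Qed.
Lemma swN t : tlift (- t) f = - tlift t f. Proof. exact: linN lf. Qed.
Lemma sw0 : tlift 0 f = 0. Proof. exact: lin0 lf. Qed.
Lemma sw_big I (r : seq I) (P : pred I) (F : I -> (V ⊗ W)%type) :
  tlift (\sum_(i <- r | P i) F i) f = \sum_(i <- r | P i) tlift (F i) f.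
Proof. exact: lin_sum lf. Qed.
End Left.

Lemma sw_add U V W (t : (V ⊗ W)%type) (f g : V -> W -> U) :
  \sw_(x, y <- t) (f x y + g x y) = tlift t f + tlift t g.
Proof.
rewrite /tlift /uq_lift /fsum -big_split /=.
by apply: eq_bigr => p _; rewrite scalerDr.
Qed.

Lemma sw_scale U V W (t : (V ⊗ W)%type) c (f : V -> W -> U) :
  \sw_(x, y <- t) (c *: f x y) = c *: tlift t f.
Proof.
rewrite /tlift /uq_lift /fsum scaler_sumr.
by apply: eq_bigr => p _; rewrite !scalerA mulrC.
Qed.

Lemma sw_opp U V W (t : (V ⊗ W)%type) (f : V -> W -> U) :
  \sw_(x, y <- t) (- f x y) = - tlift t f.
Proof.
by rewrite -scaleN1r -sw_scale; apply: eq_sw => x y; rewrite scaleN1r.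
Qed.

Lemma sw_sub U V W (t : (V ⊗ W)%type) (f g : V -> W -> U) :
  \sw_(x, y <- t) (f x y - g x y) = tlift t f - tlift t g.
Proof. by rewrite sw_add sw_opp. Qed.

Lemma sw_zero U V W (t : (V ⊗ W)%type) : \sw_(x, y <- t) (0 : U) = 0.
Proof. by rewrite /tlift /uq_lift /fsum big1 // => p _; rewrite scaler0. Qed.

Lemma sw_sum U V W (t : (V ⊗ W)%type) I (r : seq I) (P : pred I) (f : I -> V -> W -> U) :
  \sw_(x, y <- t) (\sum_(i <- r | P i) f i x y) = \sum_(i <- r | P i) tlift t (f i).
Proof.
rewrite /tlift /uq_lift /fsum exchange_big /=.
by apply: eq_bigr => p _; rewrite scaler_sumr.
Qed.

Lemma sw_exch U V W V' W' (t : (V ⊗ W)%type) (t' : (V' ⊗ W')%type)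
    (f : V -> W -> V' -> W' -> U) :
  \sw_(x, y <- t) \sw_(z, u <- t') f x y z u = \sw_(z, u <- t') \sw_(x, y <- t) f x y z u.
Proof.
rewrite /tlift /uq_lift /fsum.
under eq_bigr do rewrite scaler_sumr.
rewrite exchange_big /=; apply: eq_bigr => p _; rewrite scaler_sumr.
by apply: eq_bigr => q _; rewrite !scalerA mulrC.
Qed.

Lemma sw_id V W (t : (V ⊗ W)%type) : \sw_(x, y <- t) (x ⊗ y) = t.
Proof.
have [s ->] := tens_span t; rewrite (@sw_big _ _ _ (fun x y => x ⊗ y)) //.
by apply: eq_bigr => p _; rewrite swZ // swE.
Qed.

Lemma tens_ext U V W (f g : (V ⊗ W)%type -> U) : lin f -> lin g ->
  (forall v w, f (v ⊗ w) = g (v ⊗ w)) -> forall t, f t = g t.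
Proof.
move=> lf lg e t; have [s ->] := tens_span t.
by rewrite !lin_sum //; apply: eq_bigr => p _; rewrite !linZ // e.
Qed.

Lemma sw_tmap U V V' W W' (f : V -> V') (g : W -> W') t (F : V' -> W' -> U) :
  linl F -> linr F -> tlift (tmap f g t) F = \sw_(x, y <- t) F (f x) (g y).
Proof. by move=> F1 F2; rewrite sw_flat //; apply: eq_sw => x y; rewrite swE. Qed.

Lemma tmapE V V' W W' (f : V -> V') (g : W -> W') v w :
  lin f -> lin g -> tmap f g (v ⊗ w) = f v ⊗ g w.
Proof. by move=> lf lg; rewrite /tmap swE. Qed.

Lemma lin_tmap V V' W W' (f : V -> V') (g : W -> W') : lin f -> lin g -> lin (tmap f g).
Proof. by move=> lf lg; rewrite /tmap. Qed.

End Sweedler.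

(* Normal form of Sweedler expressions: goals [E = ?e] are solved by pulling all
   summations out and evaluating them on pure tensors. *)
Ltac sw_rule := fail.

Ltac swn_eq :=
  cbn beta;
  lazymatch goal with
  | |- tlift (tlift _ _) _ = _ => etransitivity; [apply sw_flat; lin_tac | swn_eq]
  | |- tlift (tmap _ _ _) _ = _ => etransitivity; [apply sw_tmap; lin_tac | swn_eq]
  | |- tlift (tpure _ _) _ = _ => etransitivity; [apply swE; lin_tac | swn_eq]
  | |- tlift (@Algebra.add _ _ _) _ = _ => etransitivity; [apply swD; lin_tac | swn_eq]
  | |- tlift (@Algebra.opp _ _) _ = _ => etransitivity; [apply swN; lin_tac | swn_eq]
  | |- tlift (@GRing.scale _ _ _ _) _ = _ => etransitivity; [apply swZ; lin_tac | swn_eq]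
  | |- tlift ?t ?f = _ =>
      first [ swn_pull t (tlift t f)
            | etransitivity; [sw_rule | swn_eq]
            | etransitivity; [apply eq_sw; intros; swn_eq | cbn beta; swn_out] ]
  | |- @Algebra.add _ _ _ = _ =>
      etransitivity; [apply (f_equal2 (@Algebra.add _)); swn_eq | reflexivity]
  | |- @Algebra.opp _ _ = _ =>
      etransitivity; [apply (f_equal (@Algebra.opp _)); swn_eq | reflexivity]
  | |- @GRing.scale _ _ _ (@GRing.scale _ _ _ _) = _ =>
      etransitivity; [apply scale_scale | swn_eq]
  | |- ?E = _ => first [ swn_pull E E | reflexivity ]
  end
with swn_pull t E :=
  lazymatch t with
  | context [tlift ?s ?g] =>
      let h := eval pattern (tlift s g) in E in
      lazymatch h with ?h' _ =>
        etransitivity; [apply (@sw_lin _ _ _ _ _ h' s g); lin_tac | swn_eq] end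
  | context [@GRing.scale ?R ?M ?c ?u] =>
      let h := eval pattern (@GRing.scale R M c u) in E in
      lazymatch h with
      | (fun x => x) _ => fail
      | ?h' _ => etransitivity; [apply (@linZ _ _ _ h' c u); lin_tac | swn_eq] end
  | context [@Algebra.add ?M ?u ?v] =>
      let h := eval pattern (@Algebra.add M u v) in E in
      lazymatch h with ?h' _ =>
        etransitivity; [apply (fun lf => @linD _ _ _ h' lf u v); lin_tac | swn_eq] end
  | context [@Algebra.opp ?M ?u] =>
      let h := eval pattern (@Algebra.opp M u) in E in
      lazymatch h with ?h' _ =>
        etransitivity; [apply (@linN _ _ _ h' u); lin_tac | swn_eq] end
  end
with swn_out :=
  lazymatch goal with
  | |- tlift ?t (fun x y => @Algebra.add _ _ _) = _ =>
      etransitivity; [apply sw_add |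
      etransitivity; [apply (f_equal2 (@Algebra.add _)); swn_out | reflexivity]]
  | |- tlift ?t (fun x y => @Algebra.opp _ _) = _ =>
      etransitivity; [apply sw_opp |
      etransitivity; [apply (f_equal (@Algebra.opp _)); swn_out | reflexivity]]
  | |- _ => reflexivity
  end.

Ltac swn_l := etransitivity; [swn_eq | cbn beta].
Ltac swn_r := symmetry; swn_l; symmetry.
Ltac swn := swn_l; swn_r.

Ltac sw_by E := refine (etrans _ (etrans E _)); cbn beta; swn; try reflexivity.

(* The Hopf and crossed module axioms inside Sweedler sums *)
Tactic Notation "swx" := apply: eq_sw => ? ?.

Section HopfTests.

Variables (k : fieldType) (A : hopf_algebra k) (V : crossed_module A) (U : lmodType k).
Implicit Types (a b : A) (v : V).

(** Here and below an axiom is paired with an arbitrary multilinear map F: the records state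
    equalities of tensors, whereas computations meet them inside larger sums. *)
Lemma sw_copA a (F : A -> A -> A -> U) :
  lin3l F -> lin3m F -> lin3r F ->
  \sw_(a1, a2 <- cop a) \sw_(x, y <- cop a1) F x y a2
  = \sw_(a1, a2 <- cop a) \sw_(y, z <- cop a2) F a1 y z.
Proof.
move=> F1 F2 F3.
sw_by (congr1 (fun t => tlift t (fun x yz => \sw_(y, z <- yz) F x y z)) (copA a)).
Qed.

Lemma sw_couL a (F : A -> U) : lin F -> \sw_(a1, a2 <- cop a) (cou a1 *: F a2) = F a.
Proof.
by move=> lF; rewrite -{2}[a]couL; swn_r.
Qed.

Lemma sw_couR a (F : A -> U) : lin F -> \sw_(a1, a2 <- cop a) (cou a2 *: F a1) = F a.
Proof.
by move=> lF; rewrite -{2}[a]couR; swn_r.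
Qed.

Lemma sw_antL a (F : A -> U) : lin F ->
  \sw_(a1, a2 <- cop a) F (ant a1 * a2) = cou a *: F 1.
Proof.
move=> lF; have := congr1 F (antL a); rewrite (linZ _ _ lF) => <-.
by swn.
Qed.

Lemma sw_antR a (F : A -> U) : lin F ->
  \sw_(a1, a2 <- cop a) F (a1 * ant a2) = cou a *: F 1.
Proof.
move=> lF; have := congr1 F (antR a); rewrite (linZ _ _ lF) => <-.
by swn.
Qed.

Lemma sw_copM a b (F : A -> A -> U) :
  linl F -> linr F -> tlift (cop (a * b)) F
  = \sw_(a1, a2 <- cop a) \sw_(b1, b2 <- cop b) F (a1 * b1) (a2 * b2).
Proof. by move=> F1 F2; rewrite copM; swn_l. Qed.

Lemma sw_cop1 (F : A -> A -> U) :
  linl F -> linr F -> tlift (cop (1 : A)) F = F 1 1.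
Proof. by move=> F1 F2; rewrite cop1 swE. Qed.

Lemma sw_coactA v (F : V -> A -> A -> U) :
  lin3l F -> lin3m F -> lin3r F ->
  \sw_(v0, v1 <- coact v) \sw_(x, y <- coact v0) F x y v1
  = \sw_(v0, v1 <- coact v) \sw_(y, z <- cop v1) F v0 y z.
Proof.
move=> F1 F2 F3.
sw_by (congr1 (fun t => tlift t (fun x yz => \sw_(y, z <- yz) F x y z)) (coactA v)).
Qed.

Lemma sw_coact_cou v (F : V -> U) : lin F ->
  \sw_(v0, v1 <- coact v) (cou v1 *: F v0) = F v.
Proof.
by move=> lF; rewrite -{2}[v]coact_cou; swn_r.
Qed.

Lemma sw_coact_act v a (F : V -> A -> U) :
  linl F -> linr F -> tlift (coact (v ◁ a)) F
  = \sw_(v0, v1 <- coact v) \sw_(a1, b <- cop a) \sw_(a2, a3 <- cop b)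
      F (v0 ◁ a2) (ant a1 * v1 * a3).
Proof. by move=> F1 F2; rewrite coact_act; swn_l. Qed.

(** Coassociativity brings the two factors of c_(1) S(c_(2)) together. This is how the antipode in
    the coaction of v ◁ a disappears. *)
Lemma sw_cop_ant a (F : A -> A -> A -> U) :
  lin3l F -> lin3m F -> lin3r F ->
  \sw_(c, a' <- cop a) \sw_(a1, b <- cop a') \sw_(a2, a3 <- cop b) F (c * ant a1) a2 a3
  = \sw_(a2, a3 <- cop a) F 1 a2 a3.
Proof.
move=> F1 F2 F3.
rewrite -(sw_copA _ (F := fun c a1 b => \sw_(a2, a3 <- cop b) F (c * ant a1) a2 a3)) //.
transitivity (\sw_(a1, a2 <- cop a) (cou a1 *: \sw_(x, y <- cop a2) F 1 x y)); last first.
  by rewrite sw_couL.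
apply: eq_sw => b c.
by rewrite (@sw_antR _ (fun x => \sw_(a2, a3 <- cop c) F x a2 a3)).
Qed.

End HopfTests.

Arguments sw_antL {k A U} a F _.
Arguments sw_antR {k A U} a F _.

(** * Splitting kernels of linear maps *)

Section GeneralizedInverse.

Variables (k : fieldType) (W W' : lmodType k) (f : W -> W').
Hypothesis fL : lin f.

(** G is the graph of a linear map g, defined on a subspace of W', with f g f = f where this makes
    sense. Single-valuedness is required at 0 only, which suffices by linearity. With graphs, the
    upper bound of a chain is its union. *)
Record partial_inv (G : W' -> W -> Prop) : Prop := PartialInv {
  pinv0 : G 0 0;
  pinvP : forall c y w y' w', G y w -> G y' w' -> G (c *: y + y') (c *: w + w');
  pinv_fun : forall w, G 0 w -> w = 0;
  pinv_f : forall x w, G (f x) w -> f w = f x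
}.

Let T := {G | partial_inv G}.
Let R (G G' : T) := forall y w, sval G y w -> sval G' y w.

Let triv : partial_inv (fun y w => y = 0 /\ w = 0).
Proof.
split=> [||w []|x w [fx0 ->]] //; last by rewrite fx0 (lin0 fL).
by move=> c y w y' w' [-> ->] [-> ->]; rewrite !scaler0 !addr0.
Qed.

Lemma pinvZ G (hG : partial_inv G) c y w : G y w -> G (c *: y) (c *: w).
Proof. by move=> h; have := pinvP hG c h (pinv0 hG); rewrite !addr0. Qed.

Lemma pinv_max : exists G : T, forall G' : T, R G G' -> G' = G.
Proof.
suff [G hG] : exists G : T, forall G' : T, `[< R G G' >] -> G' = G.
  by exists G => G' h; apply: hG; apply/asboolP.
apply: classical_sets.Zorn => [G|G1 G2 G3|G1 G2|C tot].
- by apply/asboolP.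
- by move=> /asboolP h /asboolP h'; apply/asboolP => y w /h /h'.
- move: G1 G2 => [G1 p1] [G2 p2] /asboolP h /asboolP h'; have e : G1 = G2.
    by apply/funext => y; apply/funext => w; apply/propext; split; [exact: h|exact: h'].
  by move: p1 p2 {h h'}; rewrite e => p1 p2; rewrite (Prop_irrelevance p1 p2).
have [[G0 CG0]|nC] := pselect (exists G, C G); last first.
  by exists (exist _ _ triv) => G CG; case: nC; exists G.
have pU : partial_inv (fun y w => exists2 G, C G & sval G y w).
  split.
  - by exists G0 => //; exact: pinv0 (svalP G0).
  - move=> c y w y' w' [G CG h] [G' CG' h']; have [/asboolP GG'|/asboolP G'G] := tot _ _ CG CG'.
      by exists G' => //; apply: (pinvP (svalP G')) => //; exact: GG'.
    by exists G => //; apply: (pinvP (svalP G)) => //; exact: G'G.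
  - by move=> w [G CG h]; exact: (pinv_fun (svalP G)).
  - by move=> x w [G CG h]; exact: (pinv_f (svalP G)).
by exists (exist _ _ pU) => G CG; apply/asboolP => y w h; exists G.
Qed.

(** If y were outside the domain, giving it the value w0 would extend g; the hypothesis on w0 is the
    clause [pinv_f] of the extended graph. *)
Lemma pinv_extend (G : T) y w0 : (forall G' : T, R G G' -> G' = G) ->
  (forall x' y0 w c, sval G y0 w -> f x' = y0 + c *: y -> f (w + c *: w0) = f x') ->
  exists w, sval G y w.
Proof.
move=> Gmax ext; have [//|ndom] := pselect (exists w, sval G y w).
have hG := svalP G.
pose G' y' w' := exists c y0 w, [/\ sval G y0 w, y' = y0 + c *: y & w' = w + c *: w0].
have pG' : partial_inv G'.
  split.
  - by exists 0, 0, 0; split; rewrite ?scale0r ?addr0 //; exact: pinv0 hG.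
  - move=> d y1 w1 y2 w2 [c [y0 [w [h -> ->]]]] [c' [y0' [w' [h' -> ->]]]].
    exists (d * c + c'), (d *: y0 + y0'), (d *: w + w'); split; first exact: pinvP.
      by rewrite scalerDr scalerDl !scalerA addrACA.
    by rewrite scalerDr scalerDl !scalerA addrACA.
  - move=> w' [c [y0 [w [h e ->]]]]; have [c0|c0] := eqVneq c 0.
      move: e h; rewrite c0 !scale0r !addr0 => <- h.
      exact: pinv_fun h.
    (* From 0 = y0 + c y with c nonzero, y would already be in the domain. *)
    case: ndom; exists (- c^-1 *: w).
    have -> : y = - c^-1 *: y0; last exact: pinvZ.
    have -> : y0 = - (c *: y) by apply/eqP; rewrite -addr_eq0 -e.
    by rewrite scalerN scaleNr opprK scalerA mulVf // scale1r.
  - by move=> x w' [c [y0 [w [h e ->]]]]; exact: ext h e.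
have := Gmax (exist _ _ pG') => GG'.
have {}GG' : exist _ _ pG' = G.
  apply: GG' => y1 w1 h; exists 0, y1, w1; split=> //; by rewrite scale0r addr0.
exists w0; rewrite -GG'; exists 1, 0, 0; split; rewrite ?scale1r ?add0r //.
exact: pinv0 hG.
Qed.

(* By maximality, a maximal partial inverse of f is defined everywhere. *)
Lemma gen_inv : exists2 g : W' -> W, lin g & forall x, f (g (f x)) = f x.
Proof.
have [G Gmax] := pinv_max; have hG := svalP G.
(* The image of f is covered first, with the value x at f x. Afterwards any vector outside the
   domain may be sent to 0: no nonzero multiple of it is congruent to an element of the image modulo
   the domain, which contains the image. *)
have fdom x : exists w, sval G (f x) w.
  apply: (@pinv_extend G _ x) => // x' y0 w c h e.
  have ey : y0 = f (x' - c *: x) by rewrite (linD fL) (linN _ fL) (linZ _ _ fL) e addrK.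
  rewrite (linD fL) (linZ _ _ fL) (@pinv_f _ hG (x' - c *: x)) -?ey //.
have dom y : exists w, sval G y w.
  have [//|ndom] := pselect (exists w, sval G y w).
  apply: (@pinv_extend G _ 0) => // x' y0 w c h e; rewrite scaler0 addr0.
  have [c0|c0] := eqVneq c 0.
    by move: e; rewrite c0 scale0r addr0 => e; apply: (pinv_f hG); rewrite e.
  case: ndom; have [w' h'] := fdom x'; exists (c^-1 *: (-1 *: w + w')).
  have -> : y = c^-1 *: (-1 *: y0 + f x').
    by rewrite e scaleN1r addKr scalerA mulVf // scale1r.
  by apply: pinvZ => //; exact: pinvP.
have [g hg] := choice dom.
have uniqG y w w' : sval G y w -> sval G y w' -> w = w'.
  move=> h h'; apply/eqP; rewrite eq_sym -subr_eq0; apply/eqP; apply: (pinv_fun hG).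
  by have := pinvP hG (-1) h h'; rewrite !scaleN1r addNr addrC.
exists g => [c x y|x]; last exact: pinv_f (hg _).
by apply: uniqG (hg _) _; exact: pinvP.
Qed.

End GeneralizedInverse.

(** p = 1 - g F for a generalized inverse g of F. The last two clauses identify the kernels of F ⊗
    id and id ⊗ F with ker F ⊗ U and U ⊗ ker F, that is, the exactness of the tensor product. *)
Lemma ker_proj (k : fieldType) (W W' : lmodType k) (F : W -> W') : lin F ->
  exists p : W -> W, [/\ lin p, forall x, F (p x) = 0, forall x, F x = 0 -> p x = x,
    forall (U : lmodType k) (X : (W ⊗ U)%type), tmap F id X = 0 -> tmap p id X = X
    & forall (U : lmodType k) (X : (U ⊗ W)%type), tmap id F X = 0 -> tmap id p X = X].
Proof.
move=> FL; have [g gL gE] := gen_inv FL.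
exists (fun x => x - g (F x)); split.
- by [].
- by move=> x; rewrite (linD FL) (linN _ FL) gE subrr.
- by move=> x ->; rewrite (lin0 gL) subr0.
- move=> U X e; rewrite /tmap; swn_l; rewrite sw_id.
  have -> : \sw_(x, y <- X) (g (F x) ⊗ y) = tmap g id (tmap F id X) by rewrite /tmap; swn.
  by rewrite e (lin0 (lin_tmap gL _)) // subr0.
- move=> U X e; rewrite /tmap; swn_l; rewrite sw_id.
  have -> : \sw_(x, y <- X) (x ⊗ g (F y)) = tmap id g (tmap id F X) by rewrite /tmap; swn.
  by rewrite e (lin0 (lin_tmap _ gL)) // subr0.
Qed.

Lemma lin_retract (k : fieldType) (U W : lmodType k) (f : U -> W) : lin f -> injective f ->
  exists2 r : W -> U, lin r & cancel f r.
Proof.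
move=> fL fi; have [g gL gE] := gen_inv fL; exists g => // x.
exact/fi/gE.
Qed.

(** * Antipodes of graded bialgebras *)

Section Antipode.

Variables (k : fieldType) (W : lmodType k).
Variables (mul : W -> W -> W) (one : W) (D : W -> (W ⊗ W)%type) (eps : W -> k).
Variables (P : nat -> W -> W) (S0 : W -> W).
Hypotheses (mulLl : forall y, lin (fun x => mul x y)) (mulLr : forall x, lin (fun y => mul x y)).
Hypotheses (mulA : associative mul) (mul1x : left_id one mul) (mulx1 : right_id one mul).
Hypotheses (DL : lin D) (epsL : scal eps) (PL : forall n, lin (P n)) (S0L : lin S0).
Hypothesis DA : forall x, \sw_(x1, x2 <- D x) \sw_(x11, x12 <- D x1) (x11 ⊗ x12 ⊗ x2)
  = \sw_(x1, x2 <- D x) \sw_(x21, x22 <- D x2) (x1 ⊗ x21 ⊗ x22).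
Hypothesis cuL : forall x, \sw_(x1, x2 <- D x) (eps x1 *: x2) = x.
Hypothesis cuR : forall x, \sw_(x1, x2 <- D x) (eps x2 *: x1) = x.
Hypothesis P_P : forall m n x, P m (P n x) = if m == n then P n x else 0.
Hypothesis Psum : forall x, exists N, x = \sum_(n < N) P n x.
Hypothesis mulP : forall m n x y, P m x = x -> P n y = y -> P (m + n) (mul x y) = mul x y.
Hypothesis oneP : P 0 one = one.
Hypothesis epsP : forall n x, eps (P n.+1 x) = 0.
Hypothesis DP : forall n x,
  D (P n x) = \sum_(p < n.+1) tmap (P p) (P (n - p)) (D (P n x)).
Hypothesis S0P : forall x, P 0 x = x -> P 0 (S0 x) = S0 x.
Hypothesis S0l : forall x, P 0 x = x -> \sw_(x1, x2 <- D x) mul (S0 x1) x2 = eps x *: one.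
Hypothesis S0r : forall x, P 0 x = x -> \sw_(x1, x2 <- D x) mul x1 (S0 x2) = eps x *: one.

Let conv (f g : W -> W) x := \sw_(x1, x2 <- D x) mul (f x1) (g x2).
Let ue x := eps x *: one.
Let T x := S0 (P 0 x).

Let convL f g : lin f -> lin g -> lin (conv f g).
Proof. by move=> fL gL; rewrite /conv. Qed.
Let ueL : lin ue. Proof. by rewrite /ue. Qed.
Let TL : lin T. Proof. by rewrite /T. Qed.

Let convA f g h x : lin f -> lin g -> lin h ->
  conv f (conv g h) x = conv (conv f g) h x.
Proof.
move=> fL gL hL; rewrite /conv; symmetry.
sw_by (congr1 (fun t => tlift t (fun x yz => \sw_(y, z <- yz) mul (f x) (mul (g y) (h z)))) (DA x)).
by swx; swx; rewrite mulA.
Qed.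

Let conv_uel f x : lin f -> conv ue f x = f x.
Proof.
move=> fL; rewrite /conv /ue -[in RHS](cuL x); swn; swx.
by rewrite mul1x.
Qed.

Let conv_uer f x : lin f -> conv f ue x = f x.
Proof.
move=> fL; rewrite /conv /ue -[in RHS](cuR x); swn; swx.
by rewrite mulx1.
Qed.

Let eqd m (f g : W -> W) := forall n x, (n < m)%N -> f (P n x) = g (P n x).

Let conv_P f g n x : lin f -> lin g -> conv f g (P n x)
  = \sum_(p < n.+1) \sw_(x1, x2 <- D (P n x)) mul (f (P p x1)) (g (P (n - p) x2)).
Proof.
move=> fL gL; rewrite /conv {1}DP sw_big //; apply: eq_bigr => p _.
by swn_l.
Qed.

Let eqd_conv m f f' g g' : lin f -> lin f' -> lin g -> lin g' ->
  eqd m f f' -> eqd m g g' -> eqd m (conv f g) (conv f' g').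
Proof.
move=> fL fL' gL gL' ff gg n x nm; rewrite !conv_P //; apply: eq_bigr => p _; swx.
rewrite ff ?gg //; first by rewrite (leq_ltn_trans (leq_subr _ _)).
by rewrite (leq_ltn_trans _ nm) // -ltnS.
Qed.

Let eqd_eq f g : lin f -> lin g -> (forall m, eqd m f g) -> forall x, f x = g x.
Proof.
move=> fL gL fg x; have [N ->] := Psum x; rewrite !lin_sum //.
by apply: eq_bigr => n _; apply: (fg n.+1).
Qed.

(** T inverts the identity under convolution in degree 0 only. Its defect [Nl] vanishes in degree 0,
    so the powers of [Nl] vanish in low degrees and the geometric series that inverts T * id = ue -
    Nl is finite on each component. *)
Let Nl x := ue x - conv T id x.
Let Nr x := ue x - conv id T x.
Let NlL : lin Nl. Proof. by rewrite /Nl /conv. Qed.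
Let NrL : lin Nr. Proof. by rewrite /Nr /conv. Qed.

Let D0 x : D (P 0 x) = tmap (P 0) (P 0) (D (P 0 x)).
Proof. by rewrite {1}DP big_ord_recl big_ord0 addr0. Qed.

Let PP0 x : P 0 (P 0 x) = P 0 x. Proof. by rewrite P_P eqxx. Qed.

Let Nl0 x : Nl (P 0 x) = 0.
Proof.
rewrite /Nl /ue -S0l // /conv D0; swn.
by rewrite -sw_sub -[RHS](sw_zero _ (D (P 0 x))); swx; rewrite /T PP0 subrr.
Qed.

Let Nr0 x : Nr (P 0 x) = 0.
Proof.
rewrite /Nr /ue -S0r // /conv D0; swn.
by rewrite -sw_sub -[RHS](sw_zero _ (D (P 0 x))); swx; rewrite /T PP0 subrr.
Qed.

(* Truncations of Takeuchi's formula: Sl m and Sr m are one-sided inverses of the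
   identity for the convolution in degrees less than m. *)
Let Sl := fix Sl m := if m is m'.+1 then fun x => T x + conv Nl (Sl m') x else fun _ => 0.
Let Sr := fix Sr m := if m is m'.+1 then fun x => T x + conv (Sr m') Nr x else fun _ => 0.
Let SlL m : lin (Sl m).
Proof. by elim: m => [|m IH] //=; apply: lin_add => //; exact: convL. Qed.
Let SrL m : lin (Sr m).
Proof. by elim: m => [|m IH] //=; apply: lin_add => //; exact: convL. Qed.

Let convDl f f' g x : lin f -> lin f' -> lin g ->
  conv (fun x => f x + f' x) g x = conv f g x + conv f' g x.
Proof. by move=> fL fL' gL; rewrite /conv -sw_add; swx; rewrite (linD (mulLl _)). Qed.
Let convDr f f' g x : lin f -> lin f' -> lin g ->
  conv g (fun x => f x + f' x) x = conv g f x + conv g f' x.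
Proof. by move=> fL fL' gL; rewrite /conv -sw_add; swx; rewrite (linD (mulLr _)). Qed.

Let Sl_inv m : eqd m (conv (Sl m) id) ue.
Proof.
elim: m => [|m IH] n x //; rewrite ltnS => nm.
rewrite /= convDl //.
rewrite -convA // [X in _ + X = _]conv_P //.
(* [Nl] kills degree 0, so its partner has degree below n and the induction hypothesis applies to
   it. *)
have -> : \sum_(p < n.+1) \sw_(x1, x2 <- D (P n x))
    mul (Nl (P p x1)) (conv (Sl m) id (P (n - p) x2)) = conv Nl ue (P n x).
  rewrite conv_P //; apply: eq_bigr => -[[|p] pn] _ /=; swx.
    by rewrite Nl0 !(lin0 (mulLl _)).
  rewrite IH // (leq_trans _ nm) // ltn_subrL /=.
  by case: n pn {x nm}.
by rewrite conv_uer // /Nl addrC subrK.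
Qed.

Let Sr_inv m : eqd m (conv id (Sr m)) ue.
Proof.
elim: m => [|m IH] n x //; rewrite ltnS => nm.
rewrite /= convDr //.
rewrite convA // [X in _ + X = _]conv_P //.
have -> : \sum_(p < n.+1) \sw_(x1, x2 <- D (P n x))
    mul (conv id (Sr m) (P p x1)) (Nr (P (n - p) x2)) = conv ue Nr (P n x).
  rewrite conv_P //; apply: eq_bigr => -[p /= pn] _; swx.
  move: (pn); rewrite ltnS leq_eqVlt => /orP[/eqP ->|pn'].
    by rewrite subnn Nr0 !(lin0 (mulLr _)).
  by rewrite IH // (leq_trans pn' nm).
by rewrite conv_uel // /Nr addrC subrK.
Qed.

(** A left inverse S equals a right inverse S' since S = S * (id * S') = (S * id) * S', here up to a
    bounded degree. *)
Let Slr m m' : (m <= m')%N -> eqd m (Sl m') (Sr m).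
Proof.
move=> mm n x nm; rewrite -(conv_uer (P n x)) // -[RHS]conv_uel //.
transitivity (conv (Sl m') (conv id (Sr m)) (P n x)).
  by apply: (eqd_conv (m := m)) => // l y lm; rewrite Sr_inv.
rewrite convA //; apply: (eqd_conv (m := m)) => //.
by move=> l y lm; rewrite Sl_inv // (leq_trans lm mm).
Qed.

Let bd x := projT1 (cid (Psum x)).
(** The limit of the series: x has finitely many components, and all truncations beyond the last one
    agree on x by [S_stable]. *)
Let S x := Sl (bd x) x.

Let S_stable x m : (bd x <= m)%N -> S x = Sl m x.
Proof.
move=> le; rewrite /S {2 3}(projT2 (cid (Psum x))) -/(bd x) !lin_sum //.
by apply: eq_bigr => n _; rewrite (Slr (leqnn _)) // (Slr le).
Qed.

Let SL : lin S.
Proof.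
move=> c x y; pose m := maxn (bd (c *: x + y)) (maxn (bd x) (bd y)).
by rewrite !(@S_stable _ m) ?SlL // !leq_max leqnn ?orbT.
Qed.

Let S_eqd m : eqd m S (Sl m).
Proof.
move=> n x nm; rewrite (@S_stable _ (maxn m (bd (P n x)))) ?leq_maxr //.
by rewrite (Slr (leq_maxl _ _)) // (Slr (leqnn _)).
Qed.

Let hom (f : W -> W) := forall n x, P n (f (P n x)) = f (P n x).

Let hom_add f g : hom f -> hom g -> hom (fun x => f x + g x).
Proof. by move=> hf hg n x; rewrite (linD (PL _)) hf hg. Qed.

Let hom_conv f g : lin f -> lin g -> hom f -> hom g -> hom (conv f g).
Proof.
move=> fL gL hf hg n x; rewrite conv_P // (lin_sum _ _ _ (PL n)); apply: eq_bigr => p _.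
rewrite (sw_lin _ _ (PL n)); swx.
rewrite -{1}(@subnKC p n); last by rewrite -ltnS.
by rewrite mulP // ?hf ?hg.
Qed.

Let hom_ue : hom ue.
Proof.
by case=> [|n] x; rewrite /ue (linZ _ _ (PL _)) ?oneP // epsP !scale0r.
Qed.

Let hom_T : hom T.
Proof.
case=> [|n] x; rewrite /T; first by rewrite S0P.
by rewrite P_P /= (lin0 S0L) (lin0 (PL _)).
Qed.

Let hom_S : hom S.
Proof.
move=> n x; rewrite (@S_eqd n.+1) //; have : hom (Sl n.+1); last exact.
have hNl : hom Nl.
  move=> l y; rewrite /Nl (linD (PL _)) (linN _ (PL _)) hom_ue hom_conv // => ? ?.
  by rewrite P_P eqxx.
elim: n.+1 => [l y|m IH]; first by rewrite (lin0 (PL _)).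
by apply: hom_add; [exact: hom_T | exact: hom_conv].
Qed.

Lemma graded_antipode : exists S : W -> W, [/\ lin S,
  forall n x, P n x = x -> P n (S x) = S x,
  forall x, P 0 x = x -> S x = S0 x,
  forall x, \sw_(x1, x2 <- D x) mul (S x1) x2 = eps x *: one
  & forall x, \sw_(x1, x2 <- D x) mul x1 (S x2) = eps x *: one].
Proof.
exists S; split=> //.
- by move=> n x <-; exact: hom_S.
- move=> x <-; rewrite (@S_eqd 1%N) //= /conv /T PP0 D0; swn_l.
  rewrite -[RHS]addr0; congr (_ + _); rewrite -[RHS](sw_zero _ (D (P 0 x))); swx.
  by rewrite Nl0 (lin0 (mulLl _)).
- move=> x; change (conv S id x = ue x); apply: eqd_eq => // m n y nm.
  by rewrite -(Sl_inv _ nm); apply: (eqd_conv (m := m)).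
- move=> x; change (conv id S x = ue x); apply: eqd_eq => // m n y nm.
  rewrite -(Sr_inv _ nm); apply: (eqd_conv (m := m)) => // l z lm.
  by rewrite (@S_eqd m) // (Slr (leqnn _)).
Qed.

End Antipode.

Definition lin_pack (k : fieldType) (U V : lmodType k) (f : U -> V) (fL : lin f) :
  {linear U -> V} := HB.pack f (GRing.isLinear.Build k U V *:%R f fL).

Definition scal_pack (k : fieldType) (U : lmodType k) (f : U -> k) (fL : scal f) :
  {scalar U} := HB.pack f (GRing.isLinear.Build k U k *%R f fL).

Ltac sw_hopf := first [ apply sw_copM | apply sw_cop1 | apply sw_coact_act ]; lin_tac.

(** * Bosonized shuffle algebras through last letters *)

(* A # Sh_-(V) seen through last letters: pi0 is the component in degree 0 and
   lam x = x' ⊗ v sums over the words x'v of positive degree, app x v appends v to x,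
   rho x = x_1 ⊗ pi0 x_2 is the right coaction of A, sg is (-1)^degree and par b keeps
   the degrees of parity b. Elements with the same components P n are equal, and those
   of x are computed recursively from pi0 x and lam x; this is how identities are proved
   below, without referring to words. *)
Record shuffle_ops (k : fieldType) (A : hopf_algebra k) (V : crossed_module A)
  (W : lmodType k) := ShuffleOps {
  so_iota : A -> W;
  so_pi0 : W -> A;
  so_app : W -> V -> W;
  so_lam : W -> (W ⊗ V)%type;
  so_P : nat -> W -> W;
  so_rho : W -> (W ⊗ A)%type;
  so_Delta : W -> (W ⊗ W)%type;
  so_mul : W -> W -> W;
  so_sg : W -> W;
  so_par : bool -> W -> W
}.

(** Each operation is determined by its part in degree 0 and its last letters. [sx_lam_mul] is the
    shuffle recursion: a last letter of x y comes from y, or from x after being braided past y,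
    which costs the sign [sg] and the action of the coaction of y. *)
Record shuffle_axioms (k : fieldType) (A : hopf_algebra k) (V : crossed_module A)
  (W : lmodType k) (o : shuffle_ops V W) : Prop := ShuffleAxioms {
  sx_iota : lin (so_iota o);
  sx_pi0 : lin (so_pi0 o);
  sx_appl : forall v, lin (fun x => so_app o x v);
  sx_appr : forall x, lin (fun v => so_app o x v);
  sx_lam : lin (so_lam o);
  sx_P : forall n, lin (so_P o n);
  sx_rho : lin (so_rho o);
  sx_Delta : lin (so_Delta o);
  sx_mull : forall y, lin (fun x => so_mul o x y);
  sx_mulr : forall x, lin (fun y => so_mul o x y);
  sx_sg : lin (so_sg o);
  sx_par : forall b, lin (so_par o b);
  sx_P0 : forall x, so_P o 0 x = so_iota o (so_pi0 o x);
  sx_PS : forall n x, so_P o n.+1 x = \sw_(x', v <- so_lam o x) so_app o (so_P o n x') v;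
  sx_Psum : forall x, exists N, forall M, (N <= M)%N -> x = \sum_(n < M) so_P o n x;
  sx_pi0_iota : forall a, so_pi0 o (so_iota o a) = a;
  sx_lam_iota : forall a, so_lam o (so_iota o a) = 0;
  sx_pi0_app : forall x v, so_pi0 o (so_app o x v) = 0;
  sx_lam_app : forall x v, so_lam o (so_app o x v) = x ⊗ v;
  sx_pi0_sg : forall x, so_pi0 o (so_sg o x) = so_pi0 o x;
  sx_lam_sg : forall x, so_lam o (so_sg o x) = - \sw_(x', v <- so_lam o x) (so_sg o x' ⊗ v);
  sx_pi0_par : forall b x, so_pi0 o (so_par o b x) = if b then 0 else so_pi0 o x;
  sx_lam_par : forall b x,
    so_lam o (so_par o b x) = \sw_(x', v <- so_lam o x) (so_par o (~~ b) x' ⊗ v);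
  sx_rho_pi0 : forall x, \sw_(x0, x1 <- so_rho o x) (so_pi0 o x0 ⊗ x1) = cop (so_pi0 o x);
  sx_rho_lam : forall x,
    \sw_(x0, x1 <- so_rho o x) \sw_(x', v <- so_lam o x0) (x' ⊗ v ⊗ x1)
    = \sw_(x', v <- so_lam o x) \sw_(x0, x1 <- so_rho o x') \sw_(v0, v1 <- coact v)
        (x0 ⊗ v0 ⊗ x1 * v1);
  sx_Delta_pi0 : forall x, \sw_(x1, x2 <- so_Delta o x) (x1 ⊗ so_pi0 o x2) = so_rho o x;
  sx_Delta_lam : forall x,
    \sw_(x1, x2 <- so_Delta o x) \sw_(x', v <- so_lam o x2) (x1 ⊗ x' ⊗ v)
    = \sw_(x', v <- so_lam o x) \sw_(x1, x2 <- so_Delta o x') (x1 ⊗ x2 ⊗ v);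
  sx_pi0_mul : forall x y, so_pi0 o (so_mul o x y) = so_pi0 o x * so_pi0 o y;
  sx_lam_mul : forall x y, so_lam o (so_mul o x y)
    = \sw_(y', w <- so_lam o y) (so_mul o x y' ⊗ w)
      + \sw_(x', v <- so_lam o x) \sw_(y0, y1 <- so_rho o y)
          (so_mul o x' (so_sg o y0) ⊗ v ◁ y1)
}.

(** [omt] stands for omega~. In [dx_lam] the appended letter [omt x1] covers both sources of new
    letters, the product with omega~(a_(2)) and the map delta. *)
Record diff_axioms (k : fieldType) (A : hopf_algebra k) (V : crossed_module A)
  (W : lmodType k) (o : shuffle_ops V W) (omt : A -> V) (dd : W -> W) : Prop := DiffAxioms {
  dx_omt : lin omt;
  dx_dd : lin dd;
  dx_omt1 : omt 1 = 0;
  dx_omtM : forall a b, omt (a * b) = omt a ◁ b + cou a *: omt b;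
  dx_omt_coact : forall a, coact (omt a)
    = \sw_(a1, b <- cop a) \sw_(a2, a3 <- cop b) (omt a2 ⊗ ant a1 * a3);
  dx_pi0 : forall x, so_pi0 o (dd x) = 0;
  dx_lam : forall x, so_lam o (dd x)
    = \sw_(x', v <- so_lam o x) (dd x' ⊗ v)
      + \sw_(x0, x1 <- so_rho o x) (so_sg o x0 ⊗ omt x1)
}.

Ltac lin_ops H :=
  lazymatch goal with
  | |- lin (fun x => so_iota _ x) => apply (sx_iota H)
  | |- lin (fun x => so_pi0 _ x) => apply (sx_pi0 H)
  | |- lin (fun x => so_app _ x _) => apply (sx_appl H)
  | |- lin (fun x => so_app _ _ x) => apply (sx_appr H)
  | |- lin (fun x => so_lam _ x) => apply (sx_lam H)
  | |- lin (fun x => so_P _ _ x) => apply (sx_P H)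
  | |- lin (fun x => so_rho _ x) => apply (sx_rho H)
  | |- lin (fun x => so_Delta _ x) => apply (sx_Delta H)
  | |- lin (fun x => so_mul _ x _) => apply (sx_mull H)
  | |- lin (fun x => so_mul _ _ x) => apply (sx_mulr H)
  | |- lin (fun x => so_sg _ x) => apply (sx_sg H)
  | |- lin (fun x => so_par _ _ x) => apply (sx_par H)
  end.

Ltac lin_atom ::= match goal with H : shuffle_axioms _ |- _ => lin_ops H end.

Section CoinnerDef.

Variables (k : fieldType) (A : hopf_algebra k) (V : crossed_module A) (W : lmodType k).
Variables (o : shuffle_ops V W) (psi : V -> k).

(* The convolutions with psi, viewed as a linear form in degree 1; the codifferential is
   their super-commutator. *)
Definition lconv x : W := \sw_(x1, x2 <- so_Delta o x) \sw_(x', v <- so_lam o x1)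
  ((cou (so_pi0 o x') * psi v) *: x2).
Definition rconv x : W := \sw_(x', v <- so_lam o x) (psi v *: x').
Definition coinner x : W := lconv x + rconv (so_sg o x).

Definition coinner_sq x : W := coinner (coinner x).

(* The kernel of this map is the largest subcoalgebra on which the square of the
   codifferential vanishes. *)
Definition cosq_test x : (W ⊗ W ⊗ W)%type :=
  \sw_(x1, u <- so_Delta o x) \sw_(x2, x3 <- so_Delta o u) (x1 ⊗ coinner_sq x2 ⊗ x3).

Hypotheses (H : shuffle_axioms o) (psiL : scal psi).

Lemma lin_lconv : lin lconv. Proof. by rewrite /lconv. Qed.
Lemma lin_rconv : lin rconv. Proof. by rewrite /rconv. Qed.

Lemma lin_coinner : lin coinner.
Proof. exact: (lin_add lin_lconv (lin_comp lin_rconv (sx_sg H))). Qed.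
Lemma lin_coinner_sq : lin coinner_sq. Proof. exact: lin_comp lin_coinner lin_coinner. Qed.

End CoinnerDef.

Ltac lin_atom ::=
  match goal with
  | H : shuffle_axioms _ |- _ => first
    [ lin_ops H | apply (lin_lconv H); lin_tac | apply (lin_rconv H); lin_tac
    | apply (lin_coinner H); lin_tac | apply (lin_coinner_sq H); lin_tac ]
  | HD : diff_axioms _ _ _ |- _ => first [ apply (dx_omt HD) | apply (dx_dd HD) ]
  end.

Section ShuffleTheory.

Variables (k : fieldType) (A : hopf_algebra k) (V : crossed_module A) (W : lmodType k).
Variable o : shuffle_ops V W.
Implicit Types (U : lmodType k).

Local Notation iota := (so_iota o).
Local Notation pi0 := (so_pi0 o).
Local Notation app := (so_app o).
Local Notation lam := (so_lam o).
Local Notation P := (so_P o).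
Local Notation rho := (so_rho o).
Local Notation Delta := (so_Delta o).
Local Notation mul := (so_mul o).
Local Notation sg := (so_sg o).
Local Notation par := (so_par o).
Local Notation lcv := (lconv o).
Local Notation rcv := (rconv o).

Section LastLetter.

Hypothesis H : shuffle_axioms o.
Implicit Types (x y z : W) (a b : A) (v w : V).

Lemma coind x y : (forall n, P n x = P n y) -> x = y.
Proof.
move=> e; have [N hN] := sx_Psum H x; have [M hM] := sx_Psum H y.
rewrite (hN (maxn N M)) ?leq_maxl // (hM (maxn N M)) ?leq_maxr //.
by apply: eq_bigr => n _; exact: e.
Qed.

Lemma Psum_tens U (t : (W ⊗ U)%type) :
  exists N, forall M, (N <= M)%N -> t = \sum_(n < M) tmap (P n) id t.
Proof.
have [s ->] := tens_span t; elim: s => [|[c [x u]] s [N IH]].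
  by exists 0%N => M _; rewrite big_nil big1 // => n _; rewrite (lin0 (lin_tmap _ _)).
have [N' hN'] := sx_Psum H x; exists (maxn N N') => M; rewrite geq_max => /andP[h h'].
have lt : lin (fun x : W => x ⊗ u) by [].
rewrite big_cons [in LHS](IH _ h) /= {1}(hN' _ h') (lin_sum _ _ _ lt).
rewrite scaler_sumr -big_split; apply: eq_bigr => n _ /=.
have lP : lin (tmap (P n) (@id U)) by exact: lin_tmap.
by rewrite (linD lP) (linZ _ _ lP) tmapE.
Qed.

Lemma coindl U (X Y : (W ⊗ U)%type) :
  (forall n, \sw_(x, u <- X) (P n x ⊗ u) = \sw_(x, u <- Y) (P n x ⊗ u)) -> X = Y.
Proof.
move=> e; have [N hN] := Psum_tens X; have [M hM] := Psum_tens Y.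
rewrite (hN (maxn N M)) ?leq_maxl // (hM (maxn N M)) ?leq_maxr //.
by apply: eq_bigr => n _; exact: e.
Qed.

Lemma coindr U (X Y : (U ⊗ W)%type) :
  (forall n, \sw_(u, x <- X) (u ⊗ P n x) = \sw_(u, x <- Y) (u ⊗ P n x)) -> X = Y.
Proof.
move=> e; pose tw (t : (U ⊗ W)%type) := \sw_(u, x <- t) (x ⊗ u).
have twL : lin tw by rewrite /tw.
have twK t : \sw_(x, u <- tw t) (u ⊗ x) = t by rewrite /tw -[RHS]sw_id; swn.
rewrite -(twK X) -(twK Y); suff -> : tw X = tw Y by [].
apply: coindl => n; rewrite /tw.
sw_by (congr1 (fun t => \sw_(u, x <- t) (x ⊗ u)) (e n)).
Qed.

Section Tests.
Variable U : lmodType k.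

Lemma s_pi0_sg x : pi0 (sg x) = pi0 x. Proof. exact: sx_pi0_sg. Qed.
Lemma s_pi0_mul x y : pi0 (mul x y) = pi0 x * pi0 y. Proof. exact: sx_pi0_mul. Qed.

Lemma s_lam_iota a (F : W -> V -> U) :
  linl F -> linr F -> tlift (lam (iota a)) F = 0.
Proof. by move=> F1 F2; rewrite sx_lam_iota // sw0. Qed.

Lemma s_lam_app x v (F : W -> V -> U) :
  linl F -> linr F -> tlift (lam (app x v)) F = F x v.
Proof. by move=> F1 F2; rewrite sx_lam_app // swE. Qed.

Lemma s_lam_sg x (F : W -> V -> U) :
  linl F -> linr F -> tlift (lam (sg x)) F = \sw_(x', v <- lam x) (- F (sg x') v).
Proof. by move=> F1 F2; rewrite sx_lam_sg // swN // sw_opp; swn. Qed.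

Lemma s_lam_par (b : bool) x (F : W -> V -> U) :
  linl F -> linr F -> tlift (lam (par b x)) F = \sw_(x', v <- lam x) F (par (~~ b) x') v.
Proof. by move=> F1 F2; rewrite sx_lam_par //; swn. Qed.

Lemma s_rho_pi0 x (F : A -> A -> U) :
  linl F -> linr F -> \sw_(x0, x1 <- rho x) F (pi0 x0) x1 = tlift (cop (pi0 x)) F.
Proof. by move=> F1 F2; rewrite -sx_rho_pi0 //; swn. Qed.

Lemma s_rho_lam x (F : W -> V -> A -> U) :
  lin3l F -> lin3m F -> lin3r F ->
  \sw_(x0, x1 <- rho x) \sw_(x', v <- lam x0) F x' v x1
  = \sw_(x', v <- lam x) \sw_(x0, x1 <- rho x') \sw_(v0, v1 <- coact v) F x0 v0 (x1 * v1).
Proof.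
move=> F1 F2 F3.
sw_by (congr1 (fun t => tlift t (fun x va => \sw_(v, a <- va) F x v a)) (sx_rho_lam H x)).
Qed.

Lemma s_Delta_pi0 x (F : W -> A -> U) :
  linl F -> linr F -> \sw_(x1, x2 <- Delta x) F x1 (pi0 x2) = tlift (rho x) F.
Proof. by move=> F1 F2; rewrite -sx_Delta_pi0 //; swn. Qed.

Lemma s_Delta_lam x (F : W -> W -> V -> U) :
  lin3l F -> lin3m F -> lin3r F ->
  \sw_(x1, x2 <- Delta x) \sw_(x', v <- lam x2) F x1 x' v
  = \sw_(x', v <- lam x) \sw_(x1, x2 <- Delta x') F x1 x2 v.
Proof.
move=> F1 F2 F3.
sw_by (congr1 (fun t => tlift t (fun x va => \sw_(v, a <- va) F x v a)) (sx_Delta_lam H x)).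
Qed.

Lemma s_lam_mul x y (F : W -> V -> U) :
  linl F -> linr F -> tlift (lam (mul x y)) F
  = \sw_(y', w <- lam y) F (mul x y') w
    + \sw_(x', v <- lam x) \sw_(y0, y1 <- rho y) F (mul x' (sg y0)) (v ◁ y1).
Proof. by move=> F1 F2; rewrite sx_lam_mul //; swn. Qed.

End Tests.

End LastLetter.

Arguments s_rho_pi0 H {U} x F _ _.
Arguments s_Delta_pi0 H {U} x F _ _.

Ltac sw_lam H :=
  first [ apply (s_lam_mul H) | apply (s_lam_sg H) | apply (s_lam_par H)
        | apply (s_lam_app H) | apply (s_lam_iota H) ].
Ltac sw_ops H := sw_lam H.
Ltac sw_ops_d H HD := fail.
Ltac sw_rule ::= first
  [ sw_hopf
  | match goal with H : shuffle_axioms _ |- _ => sw_ops H; lin_tac end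
  | match goal with H : shuffle_axioms ?o, HD : diff_axioms ?o _ _ |- _ =>
      sw_ops_d H HD; lin_tac end ].

(** * The right coaction of A *)

Section RightCoaction.

Hypothesis H : shuffle_axioms o.

Let P0 x : P 0 x = iota (pi0 x). Proof. exact: sx_P0 H x. Qed.
Let PS n x : P n.+1 x = \sw_(x', v <- lam x) app (P n x') v. Proof. exact: sx_PS H n x. Qed.

Lemma sg_iota a : sg (iota a) = iota a.
Proof.
apply: (coind H) => -[|n]; first by rewrite !P0 (s_pi0_sg H).
by rewrite !PS; swn_l; rewrite (s_lam_iota H) // oppr0; swn_r.
Qed.

Lemma sg_sg x : sg (sg x) = x.
Proof.
apply: (coind H) => n; elim: n x => [|n IH] x; first by rewrite !P0 !(s_pi0_sg H).
by rewrite !PS; swn_l; rewrite opprK; swx; rewrite IH.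
Qed.

(** The pattern of most inductions below: compare the components of one tensor factor, peel off the
    last letter by [PS], exchange it with the coaction or coproduct, and use the induction
    hypothesis for the map that puts the letter back. F must therefore stay general. *)
Lemma s_rho_sg x U (F : W -> A -> U) :
  linl F -> linr F -> tlift (rho (sg x)) F = \sw_(x0, x1 <- rho x) F (sg x0) x1.
Proof.
move=> F1 F2; suff -> : rho (sg x) = \sw_(x0, x1 <- rho x) (sg x0 ⊗ x1) by swn.
apply: (coindl H) => n; swn_r.
suff: forall U (F : W -> A -> U), linl F ->
    linr F ->
  \sw_(x0, x1 <- rho (sg x)) F (P n x0) x1 = \sw_(x0, x1 <- rho x) F (P n (sg x0)) x1.
  by move=> -> //.
elim: n x => [|n IH] x {F1 F2 F}U F F1 F2.
  under eq_sw do rewrite P0; under [RHS]eq_sw do rewrite P0 (s_pi0_sg H).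
  by rewrite !(s_rho_pi0 H _ (fun a b => F (iota a) b)) ?(s_pi0_sg H).
under eq_sw do rewrite PS; under [RHS]eq_sw do rewrite PS.
swn; rewrite !(s_rho_lam H) //; swn_l; congr (- _); apply: eq_sw => x' v.
by rewrite (IH _ _ (fun z a => \sw_(v0, v1 <- coact v) F (app z v0) (a * v1))).
Qed.

Lemma s_rhoA x U (F : W -> A -> A -> U) :
  lin3l F -> lin3m F -> lin3r F ->
  \sw_(x0, x1 <- rho x) \sw_(y0, y1 <- rho x0) F y0 y1 x1
  = \sw_(x0, x1 <- rho x) \sw_(a, b <- cop x1) F x0 a b.
Proof.
move=> F1 F2 F3.
suff E: \sw_(x0, x1 <- rho x) \sw_(y0, y1 <- rho x0) (y0 ⊗ y1 ⊗ x1)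
    = \sw_(x0, x1 <- rho x) \sw_(a, b <- cop x1) (x0 ⊗ a ⊗ b).
  by sw_by (congr1 (fun t => tlift t (fun x ab => \sw_(a, b <- ab) F x a b)) E).
apply: (coindl H) => n; swn; move: n.
suff h: forall n U (F : W -> A -> A -> U), lin3l F ->
    lin3m F -> lin3r F ->
  \sw_(x0, x1 <- rho x) \sw_(y0, y1 <- rho x0) F (P n y0) y1 x1
  = \sw_(x0, x1 <- rho x) \sw_(a, b <- cop x1) F (P n x0) a b.
  by move=> n; rewrite (h n _ (fun x a b => x ⊗ a ⊗ b)).
move=> {F1 F2 F3 F}n; elim: n x => [|n IH] x {}U F F1 F2 F3.
  under eq_sw => x0 x1.
    under eq_sw do rewrite P0.
    rewrite (s_rho_pi0 H _ (fun a b => F (iota a) b x1)) //.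
    over.
  rewrite (s_rho_pi0 H _ (fun p q => \sw_(a, b <- cop p) F (iota a) b q)) //.
  rewrite (sw_copA _ (F := fun a b c => F (iota a) b c)) //.
  under [RHS]eq_sw do rewrite P0.
  by rewrite (s_rho_pi0 H _ (fun p q => \sw_(a, b <- cop q) F (iota p) a b)).
under eq_sw do under eq_sw do rewrite PS.
under [RHS]eq_sw do rewrite PS.
swn; under eq_sw do rewrite (s_rho_lam H) //.
under [RHS]eq_sw do rewrite sw_exch.
rewrite !(s_rho_lam H) //; apply: eq_sw => x' v; swn_r.
under eq_sw do rewrite sw_exch.
rewrite (IH _ _ (fun z a b => \sw_(v0, v1 <- coact v) \sw_(w0, w1 <- coact v0)
  F (app z w0) (a * w1) (b * v1))) //.
apply: eq_sw => x0 x1; rewrite [RHS]sw_exch; apply: eq_sw => a b.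
by rewrite sw_coactA.
Qed.

(** The delicate case is a last letter v of x, which becomes v ◁ y1. Its coaction contains (S a_(1))
    v_1 a_(3), and the coaction of the rest of y supplies on its left the element that cancels S
    a_(1). *)
Lemma s_rho_mul x y U (F : W -> A -> U) :
  linl F -> linr F -> tlift (rho (mul x y)) F
  = \sw_(x0, x1 <- rho x) \sw_(y0, y1 <- rho y) F (mul x0 y0) (x1 * y1).
Proof.
move=> F1 F2; suff -> : rho (mul x y)
  = \sw_(x0, x1 <- rho x) \sw_(y0, y1 <- rho y) (mul x0 y0 ⊗ x1 * y1) by swn.
apply: (coindl H) => n; swn_r.
suff: forall U (F : W -> A -> U), linl F ->
    linr F ->
  \sw_(z0, z1 <- rho (mul x y)) F (P n z0) z1
  = \sw_(x0, x1 <- rho x) \sw_(y0, y1 <- rho y) F (P n (mul x0 y0)) (x1 * y1).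
  by move=> -> //.
elim: n x y => [|n IH] x y {F1 F2 F}U F F1 F2.
  under eq_sw do rewrite P0.
  rewrite (s_rho_pi0 H _ (fun a b => F (iota a) b)) // (s_pi0_mul H); swn_l.
  under [RHS]eq_sw => x0 x1.
    under eq_sw do rewrite P0 (s_pi0_mul H).
    rewrite (s_rho_pi0 H _ (fun a b => F (iota (pi0 x0 * a)) (x1 * b))) //.
    over.
  by rewrite (s_rho_pi0 H _ (fun a b => \sw_(v, w <- cop (pi0 y)) F (iota (a * v)) (b * w))).
under eq_sw do rewrite PS; under [RHS]eq_sw do under eq_sw do rewrite PS.
swn; rewrite (s_rho_lam H) //; swn_l; congr (_ + _).
  under [RHS]eq_sw do rewrite (s_rho_lam H) //.
  rewrite sw_exch; apply: eq_sw => y' w.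
  rewrite (IH _ _ _ (fun z a => \sw_(v0, v1 <- coact w) F (app z v0) (a * v1))) //.
  by swx; swx; swx; rewrite mulrA.
under [RHS]eq_sw do rewrite sw_exch.
rewrite [RHS](s_rho_lam H) //; apply: eq_sw => x' v.
transitivity (\sw_(y0, y1 <- rho y) \sw_(x0, x1 <- rho x') \sw_(z0, z1 <- rho y0)
  \sw_(v0, v1 <- coact v) \sw_(a1, b <- cop y1) \sw_(a2, a3 <- cop b)
     F (app (P n (mul x0 (sg z0))) (v0 ◁ a2)) ((x1 * z1) * (ant a1 * v1 * a3))).
  apply: eq_sw => y0 y1.
  rewrite (IH _ _ _ (fun z c => \sw_(v0, v1 <- coact v) \sw_(a1, b <- cop y1)
    \sw_(a2, a3 <- cop b) F (app z (v0 ◁ a2)) (c * (ant a1 * v1 * a3)))) //.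
  by apply: eq_sw => x0 x1; rewrite s_rho_sg.
rewrite sw_exch; apply: eq_sw => x0 x1.
(* y is coacted on twice, once for the product and once for the action on v; [s_rhoA] turns this
   into one coaction followed by iterated coproducts. *)
rewrite (s_rhoA _ (F := fun z0 z1 y1 => \sw_(v0, v1 <- coact v) \sw_(a1, b <- cop y1)
  \sw_(a2, a3 <- cop b)
     F (app (P n (mul x0 (sg z0))) (v0 ◁ a2)) ((x1 * z1) * (ant a1 * v1 * a3)))) //.
under eq_sw do rewrite sw_exch.
rewrite sw_exch; apply: eq_sw => v0 v1.
rewrite (s_rhoA _ (F := fun z0 z1 y1 =>
  F (app (P n (mul x0 (sg z0))) (v0 ◁ z1)) (x1 * v1 * y1))) //.
apply: eq_sw => y0 y1.
transitivity (\sw_(c, b' <- cop y1) \sw_(a1, b <- cop b') \sw_(a2, a3 <- cop b)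
     F (app (P n (mul x0 (sg y0))) (v0 ◁ a2)) (x1 * (c * ant a1) * v1 * a3)).
  by do 3!swx; rewrite !mulrA.
rewrite (sw_cop_ant _ (F := fun c a2 a3 =>
  F (app (P n (mul x0 (sg y0))) (v0 ◁ a2)) (x1 * c * v1 * a3))) //.
by swx; rewrite mulr1.
Qed.

End RightCoaction.

Ltac sw_rho H := first [ sw_lam H | apply (s_rho_sg H) | apply (s_rho_mul H) ].
Ltac sw_ops H ::= sw_rho H.

(** * Associativity, coassociativity, units and counits *)

Section Coalgebra.

Hypothesis H : shuffle_axioms o.

Let P0 x : P 0 x = iota (pi0 x). Proof. exact: sx_P0 H x. Qed.
Let PS n x : P n.+1 x = \sw_(x', v <- lam x) app (P n x') v. Proof. exact: sx_PS H n x. Qed.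

Lemma s_rho_cou x U (F : W -> U) : lin F ->
  \sw_(x0, x1 <- rho x) (cou x1 *: F x0) = F x.
Proof.
move=> F1; suff E: \sw_(x0, x1 <- rho x) (cou x1 *: x0) = x.
  by rewrite -{2}E; swn_r.
apply: (coind H) => n; swn_l.
elim: n x => [|n IH] x.
  under eq_sw do rewrite P0.
  by rewrite (s_rho_pi0 H _ (fun a b => cou b *: iota a)) // P0 sw_couR.
under eq_sw do rewrite PS.
rewrite PS; swn; rewrite (s_rho_lam H) //; apply: eq_sw => x' v.
under eq_sw => x0 x1.
  under eq_sw do rewrite couM -scalerA.
  rewrite sw_scale sw_coact_cou //.
  over.
by rewrite -[in RHS]IH; swn_r.
Qed.

Lemma s_sg_mul x y : sg (mul x y) = mul (sg x) (sg y).
Proof.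
apply: (coind H) => n; elim: n x y => [|n IH] x y.
  by rewrite !P0 !((s_pi0_sg H), (s_pi0_mul H)).
rewrite !PS; swn; congr (- _ - _); first by swx; rewrite IH.
by swx; swx; rewrite IH.
Qed.

(** The last letter comes from z, y or x. In the third case it passes y and z together or one after
    the other, which agree by [s_rho_mul] and [actM]. *)
Lemma s_mulA x y z : mul (mul x y) z = mul x (mul y z).
Proof.
apply: (coind H) => n; elim: n x y z => [|n IH] x y z.
  by rewrite !P0 !(s_pi0_mul H) mulrA.
rewrite !PS; swn; rewrite addrA; congr (_ + _ + _).
- by swx; rewrite IH.
- by swx; swx; rewrite IH.
- by do 3!swx; rewrite IH s_sg_mul actM.
Qed.

Lemma s_mul1x x : mul (iota 1) x = x.
Proof.
apply: (coind H) => n; elim: n x => [|n IH] x.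
  by rewrite !P0 (s_pi0_mul H) (sx_pi0_iota H) mul1r.
by rewrite !PS; swn_l; rewrite addr0; swx; rewrite IH.
Qed.

Lemma P_iota n a : P n (iota a) = if n is 0 then iota a else 0.
Proof. by case: n => [|n]; rewrite ?P0 ?(sx_pi0_iota H) // PS (s_lam_iota H). Qed.

Lemma s_rho_iota a U (F : W -> A -> U) :
  linl F -> linr F -> tlift (rho (iota a)) F = \sw_(a1, a2 <- cop a) F (iota a1) a2.
Proof.
move=> F1 F2; suff -> : rho (iota a) = \sw_(a1, a2 <- cop a) (iota a1 ⊗ a2) by swn.
apply: (coindl H) => -[|n]; swn_r.
  under eq_sw do rewrite P0; under [RHS]eq_sw do rewrite P_iota.
  by rewrite (s_rho_pi0 H _ (fun a b => iota a ⊗ b)) // (sx_pi0_iota H).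
under eq_sw do rewrite PS; swn_l; rewrite (s_rho_lam H) // (s_lam_iota H) //.
under [RHS]eq_sw do rewrite P_iota (lin0 (lin_tpurel _)).
by rewrite sw_zero.
Qed.

Lemma s_mulx1 x : mul x (iota 1) = x.
Proof.
apply: (coind H) => n; elim: n x => [|n IH] x.
  by rewrite !P0 (s_pi0_mul H) (sx_pi0_iota H) mulr1.
rewrite !PS; swn_l; rewrite add0r; apply: eq_sw => x' v.
by rewrite s_rho_iota // sw_cop1 // (sg_iota H) act1 IH.
Qed.

Lemma s_mul_iota a b : mul (iota a) (iota b) = iota (a * b).
Proof.
apply: (coind H) => -[|n]; first by rewrite !P0 (s_pi0_mul H) !(sx_pi0_iota H).
by rewrite P_iota PS; swn_l; rewrite addr0.
Qed.

(** As rho = (id ⊗ pi0) Delta, this is coassociativity with the third factor in degree 0, the base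
    case of [s_DeltaA]. *)
Lemma s_Delta_rho x U (F : W -> W -> A -> U) :
  lin3l F -> lin3m F -> lin3r F ->
  \sw_(x1, x2 <- Delta x) \sw_(y0, y1 <- rho x2) F x1 y0 y1
  = \sw_(x0, x1 <- rho x) \sw_(y1, y2 <- Delta x0) F y1 y2 x1.
Proof.
move=> F1 F2 F3.
suff E: \sw_(x1, x2 <- Delta x) \sw_(y0, y1 <- rho x2) ((x1 ⊗ y1) ⊗ y0)
    = \sw_(x0, x1 <- rho x) \sw_(y1, y2 <- Delta x0) ((y1 ⊗ x1) ⊗ y2).
  by sw_by (congr1 (fun t => tlift t (fun xa y => \sw_(x, a <- xa) F x y a)) E).
apply: (coindr H) => n; swn; move: n.
suff h: forall n U (F : W -> W -> A -> U), lin3l F ->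
    lin3m F -> lin3r F ->
  \sw_(x1, x2 <- Delta x) \sw_(y0, y1 <- rho x2) F x1 (P n y0) y1
  = \sw_(x0, x1 <- rho x) \sw_(y1, y2 <- Delta x0) F y1 (P n y2) x1.
  by move=> n; rewrite (h n _ (fun x y a => (x ⊗ a) ⊗ y)).
move=> {F1 F2 F3 F}n; elim: n x => [|n IH] x {}U F F1 F2 F3.
  under eq_sw => x1 x2.
    under eq_sw do rewrite P0.
    rewrite (s_rho_pi0 H _ (fun a b => F x1 (iota a) b)) //.
    over.
  rewrite (s_Delta_pi0 H _ (fun x1 c => \sw_(a, b <- cop c) F x1 (iota a) b)) //.
  under [RHS]eq_sw => x0 x1.
    under eq_sw do rewrite P0.
    rewrite (s_Delta_pi0 H _ (fun y a => F y (iota a) x1)) //.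
    over.
  by rewrite (s_rhoA H _ (F := fun x a b => F x (iota a) b)).
under eq_sw do under eq_sw do rewrite PS.
under [RHS]eq_sw do under eq_sw do rewrite PS.
swn; under eq_sw do rewrite (s_rho_lam H) //.
rewrite (s_Delta_lam H) //.
under [RHS]eq_sw do rewrite (s_Delta_lam H) //.
rewrite (s_rho_lam H) //; apply: eq_sw => x' v.
rewrite (IH _ _ (fun x y a => \sw_(v0, v1 <- coact v) F x (app y v0) (a * v1))) //.
by apply: eq_sw => x0 x1; rewrite sw_exch.
Qed.

Lemma s_DeltaA x U (F : W -> W -> W -> U) :
  lin3l F -> lin3m F -> lin3r F ->
  \sw_(x1, x2 <- Delta x) \sw_(y1, y2 <- Delta x1) F y1 y2 x2
  = \sw_(x1, x2 <- Delta x) \sw_(y1, y2 <- Delta x2) F x1 y1 y2.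
Proof.
move=> F1 F2 F3.
suff E: \sw_(x1, x2 <- Delta x) \sw_(y1, y2 <- Delta x1) ((y1 ⊗ y2) ⊗ x2)
    = \sw_(x1, x2 <- Delta x) \sw_(y1, y2 <- Delta x2) ((x1 ⊗ y1) ⊗ y2).
  by sw_by (congr1 (fun t => tlift t (fun xy z => \sw_(x, y <- xy) F x y z)) E).
apply: (coindr H) => n; swn; move: n.
suff h: forall n U (F : W -> W -> W -> U), lin3l F ->
    lin3m F -> lin3r F ->
  \sw_(x1, x2 <- Delta x) \sw_(y1, y2 <- Delta x1) F y1 y2 (P n x2)
  = \sw_(x1, x2 <- Delta x) \sw_(y1, y2 <- Delta x2) F x1 y1 (P n y2).
  by move=> n; rewrite (h n _ (fun x y z => (x ⊗ y) ⊗ z)).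
move=> {F1 F2 F3 F}n; elim: n x => [|n IH] x {}U F F1 F2 F3.
  under eq_sw do under eq_sw do rewrite P0.
  rewrite (s_Delta_pi0 H _ (fun x a => \sw_(y1, y2 <- Delta x) F y1 y2 (iota a))) //.
  under [RHS]eq_sw => x1 x2.
    under eq_sw do rewrite P0.
    rewrite (s_Delta_pi0 H _ (fun y a => F x1 y (iota a))) //.
    over.
  by rewrite (s_Delta_rho _ (F := fun x y a => F x y (iota a))).
under eq_sw do under eq_sw do rewrite PS.
under [RHS]eq_sw do under eq_sw do rewrite PS.
swn; under eq_sw do rewrite sw_exch.
rewrite (s_Delta_lam H) //.
under [RHS]eq_sw do rewrite (s_Delta_lam H) //.
rewrite (s_Delta_lam H) //; apply: eq_sw => x' v.
by rewrite (IH _ _ (fun x y z => F x y (app z v))).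
Qed.

Lemma s_epsL x U (F : W -> U) : lin F ->
  \sw_(x1, x2 <- Delta x) (cou (pi0 x1) *: F x2) = F x.
Proof.
move=> F1; suff E: \sw_(x1, x2 <- Delta x) (cou (pi0 x1) *: x2) = x.
  by rewrite -{2}E; swn_r.
apply: (coind H) => n; swn_l.
elim: n x => [|n IH] x.
  under eq_sw do rewrite P0.
  rewrite (s_Delta_pi0 H _ (fun x a => cou (pi0 x) *: iota a)) //.
  by rewrite (s_rho_pi0 H _ (fun a b => cou a *: iota b)) // P0 sw_couL.
under eq_sw do rewrite PS.
rewrite PS; swn; rewrite (s_Delta_lam H) //; apply: eq_sw => x' v.
by rewrite -[in RHS]IH; swn_r.
Qed.

Lemma s_epsR x U (F : W -> U) : lin F ->
  \sw_(x1, x2 <- Delta x) (cou (pi0 x2) *: F x1) = F x.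
Proof.
move=> F1; rewrite (s_Delta_pi0 H _ (fun x a => cou a *: F x)) //.
exact: s_rho_cou.
Qed.

Lemma s_Delta_iota a U (F : W -> W -> U) :
  linl F -> linr F -> tlift (Delta (iota a)) F = \sw_(a1, a2 <- cop a) F (iota a1) (iota a2).
Proof.
move=> F1 F2; suff -> : Delta (iota a) = \sw_(a1, a2 <- cop a) (iota a1 ⊗ iota a2) by swn.
apply: (coindr H) => -[|n]; swn_r.
  under eq_sw do rewrite P0; under [RHS]eq_sw do rewrite P_iota.
  by rewrite (s_Delta_pi0 H _ (fun x a => x ⊗ iota a)) // s_rho_iota.
under eq_sw do rewrite PS; swn_l; rewrite (s_Delta_lam H) // (s_lam_iota H) //.
under [RHS]eq_sw do rewrite P_iota (lin0 (lin_tpurer _)).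
by rewrite sw_zero.
Qed.

Lemma s_Delta_sg x U (F : W -> W -> U) :
  linl F -> linr F -> tlift (Delta (sg x)) F = \sw_(x1, x2 <- Delta x) F (sg x1) (sg x2).
Proof.
move=> F1 F2; suff -> : Delta (sg x) = \sw_(x1, x2 <- Delta x) (sg x1 ⊗ sg x2) by swn.
apply: (coindr H) => n; swn_r.
suff h: forall U (F : W -> W -> U), linl F ->
    linr F ->
  \sw_(x1, x2 <- Delta (sg x)) F x1 (P n x2) = \sw_(x1, x2 <- Delta x) F (sg x1) (P n (sg x2)).
  by rewrite h.
elim: n x => [|n IH] x {F1 F2 F}U F F1 F2.
  under eq_sw do rewrite P0; under [RHS]eq_sw do rewrite P0 (s_pi0_sg H).
  rewrite (s_Delta_pi0 H _ (fun x a => F x (iota a))) //; swn_l.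
  by rewrite (s_Delta_pi0 H _ (fun x a => F (sg x) (iota a))).
under eq_sw do rewrite PS; under [RHS]eq_sw do rewrite PS.
swn; rewrite !(s_Delta_lam H) //; swn_l; congr (- _); apply: eq_sw => x' v.
by rewrite (IH _ _ (fun x y => F x (app y v))).
Qed.

Lemma par_sg b x : par b (sg x) = if b then - par b x else par b x.
Proof.
apply: (coind H) => n; elim: n b x => [|n IH] b x.
  case: b; rewrite ?(linN _ (sx_P H _)) !P0 !(sx_pi0_par H) ?(s_pi0_sg H) //.
  by rewrite (lin0 (sx_iota H)) oppr0.
case: b; rewrite ?(linN _ (sx_P H _)) !PS; swn.
  by congr (- _); swx; rewrite IH.
by rewrite -sw_opp; swx; rewrite IH (linN _ (sx_P H _)) (linN _ (sx_appl H _)) opprK.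
Qed.

Lemma par_sum x : par false x + par true x = x.
Proof.
apply: (coind H) => n; elim: n x => [|n IH] x; rewrite (linD (sx_P H _)).
  by rewrite !P0 !(sx_pi0_par H) (lin0 (sx_iota H)) addr0.
rewrite !PS; swn_l; rewrite addrC -sw_add; apply: eq_sw => x' v.
by rewrite -[in RHS]IH (linD (sx_P H _)) (linD (sx_appl H _)).
Qed.

End Coalgebra.

Ltac sw_core H := first [ sw_rho H | apply (s_Delta_sg H) ].
Ltac sw_ops H ::= sw_core H.

(** * Multiplicativity of the coproduct *)

Section Bialgebra.

Hypothesis H : shuffle_axioms o.

Let P0 x : P 0 x = iota (pi0 x). Proof. exact: sx_P0 H x. Qed.
Let PS n x : P n.+1 x = \sw_(x', v <- lam x) app (P n x') v. Proof. exact: sx_PS H n x. Qed.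

(** The Koszul sign (-1)^(|x2| |y1|) without degrees: it is trivial on the even part of y1 and
    replaces x2 by [sg x2] on the odd part. *)
Lemma s_Delta_mul x y U (F : W -> W -> U) :
  linl F -> linr F -> tlift (Delta (mul x y)) F
  = \sw_(x1, x2 <- Delta x) \sw_(y1, y2 <- Delta y)
      (F (mul x1 (par false y1)) (mul x2 y2) + F (mul x1 (par true y1)) (mul (sg x2) y2)).
Proof.
move=> F1 F2; suff -> : Delta (mul x y)
  = \sw_(x1, x2 <- Delta x) \sw_(y1, y2 <- Delta y)
      (mul x1 (par false y1) ⊗ mul x2 y2 + mul x1 (par true y1) ⊗ mul (sg x2) y2).
  by swn.
apply: (coindr H) => n; swn_r.
suff h: forall U (F : W -> W -> U), linl F ->
    linr F ->
  \sw_(z1, z2 <- Delta (mul x y)) F z1 (P n z2)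
  = \sw_(x1, x2 <- Delta x) \sw_(y1, y2 <- Delta y)
      F (mul x1 (par false y1)) (P n (mul x2 y2))
    + \sw_(x1, x2 <- Delta x) \sw_(y1, y2 <- Delta y)
        F (mul x1 (par true y1)) (P n (mul (sg x2) y2)).
  by rewrite h.
elim: n x y => [|n IH] x y {F1 F2 F}U F F1 F2.
  under eq_sw do rewrite P0.
  rewrite (s_Delta_pi0 H _ (fun x a => F x (iota a))) //; swn_l.
  rewrite -sw_add.
  transitivity (\sw_(x1, x2 <- Delta x) \sw_(y1, y2 <- Delta y)
      F (mul x1 y1) (iota (pi0 x2 * pi0 y2))); last first.
    apply: eq_sw => x1 x2; rewrite -sw_add; apply: eq_sw => y1 y2.
    rewrite !P0 !(s_pi0_mul H) (s_pi0_sg H) -{1}(par_sum H y1).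
    by rewrite (linD (sx_mulr H _)) (linD (F1 _)).
  under [RHS]eq_sw => x1 x2.
    rewrite (s_Delta_pi0 H _ (fun y a => F (mul x1 y) (iota (pi0 x2 * a)))) //.
    over.
  by rewrite (s_Delta_pi0 H _ (fun x a =>
    \sw_(x0, y0 <- rho y) F (mul x x0) (iota (a * y0)))).
under eq_sw do rewrite PS.
under [X in _ = X + _]eq_sw do under eq_sw do rewrite PS.
under [X in _ = _ + X]eq_sw do under eq_sw do rewrite PS.
swn; rewrite (s_Delta_lam H) //; swn_l.
under [X in X + _]eq_sw => y' w.
  rewrite (IH _ _ _ (fun z1 z2 => F z1 (app z2 w))) //.
  over.
under [X in _ + X]eq_sw => x' v.
  under eq_sw => y0 y1.
    rewrite (IH _ _ _ (fun z1 z2 => F z1 (app z2 (v ◁ y1)))) //.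
    over.
  over.
swn_l; rewrite [RHS]addrACA.
(* A last letter of x2 passes y2 on one side, and all of y before the coproduct is taken on the
   other; the two agree by [s_Delta_rho]. *)
have laml b (G : W -> W -> V -> W -> U) :
    (forall y v z, lin (fun x => G x y v z)) -> (forall x v z, lin (fun y => G x y v z)) ->
    (forall x y z, lin (fun v => G x y v z)) -> (forall x y v, lin (fun z => G x y v z)) ->
  \sw_(x1, x2 <- Delta x) \sw_(y1, y2 <- Delta y) \sw_(x', v <- lam x2)
    \sw_(y0, a <- rho y2) G (mul x1 (par b y1)) x' (v ◁ a) y0
  = \sw_(x', v <- lam x) \sw_(y0, a <- rho y) \sw_(x1, x2 <- Delta x')
      \sw_(y1, y2 <- Delta y0) G (mul x1 (par b y1)) x2 (v ◁ a) y2.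
  move=> G1 G2 G3 G4; under eq_sw do rewrite sw_exch.
  rewrite (s_Delta_lam H _ (F := fun x1 x' v => \sw_(y1, y2 <- Delta y)
    \sw_(y0, a <- rho y2) G (mul x1 (par b y1)) x' (v ◁ a) y0)) //.
  apply: eq_sw => x' v; rewrite [RHS]sw_exch; apply: eq_sw => x1 x2.
  by rewrite (s_Delta_rho H _ (F := fun y1 y0 a => G (mul x1 (par b y1)) x2 (v ◁ a) y0)).
congr (_ + _ + (_ + _)).
- under [RHS]eq_sw do rewrite (s_Delta_lam H) //.
  by rewrite [RHS]sw_exch.
- under [RHS]eq_sw do rewrite (s_Delta_lam H) //.
  by rewrite [RHS]sw_exch.
- rewrite (laml false (fun z x2 v y2 => F z (app (P n (mul x2 (sg y2))) v))) //.
  by do 4!swx; rewrite (par_sg H).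
(* Two signs cancel: one from [sg] on the odd part of y1, the other from the letter removed from
   [sg x2]. *)
- rewrite (laml true (fun z x2 v y2 => F z (app (P n (mul (sg x2) (sg y2))) v))) //.
  do 4!(rewrite -sw_opp; swx); rewrite (par_sg H).
  by rewrite (linN _ (sx_mulr H _)) (linN _ (F1 _)).
Qed.

End Bialgebra.

(** * The differential *)

Section Diff.

Hypothesis H : shuffle_axioms o.
Variables (omt : A -> V) (dd : W -> W) (HD : diff_axioms o omt dd).

Lemma s_lam_d x U (F : W -> V -> U) :
  linl F -> linr F -> tlift (lam (dd x)) F
  = \sw_(x', v <- lam x) F (dd x') v + \sw_(x0, x1 <- rho x) F (sg x0) (omt x1).
Proof. by move=> F1 F2; rewrite (dx_lam HD) //; swn. Qed.

Lemma s_omt_coact a U (F : V -> A -> U) :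
  linl F -> linr F -> tlift (coact (omt a)) F
  = \sw_(a1, b <- cop a) \sw_(a2, a3 <- cop b) F (omt a2) (ant a1 * a3).
Proof. by move=> F1 F2; rewrite (dx_omt_coact HD) //; swn. Qed.

End Diff.

Ltac sw_lam_d H HD := first [ apply (s_lam_d HD) | apply (s_omt_coact HD) ].
Ltac sw_ops_d H HD ::= sw_lam_d H HD.

Section DiffTheory.

Hypothesis H : shuffle_axioms o.
Variables (omt : A -> V) (dd : W -> W) (HD : diff_axioms o omt dd).

Let P0 x : P 0 x = iota (pi0 x). Proof. exact: sx_P0 H x. Qed.
Let PS n x : P n.+1 x = \sw_(x', v <- lam x) app (P n x') v. Proof. exact: sx_PS H n x. Qed.

Lemma P0_d x : P 0 (dd x) = 0.
Proof. by rewrite P0 (dx_pi0 HD) (lin0 (sx_iota H)). Qed.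

Lemma d_sg x : dd (sg x) = - sg (dd x).
Proof.
apply: (coind H) => n; rewrite (linN _ (sx_P H _)); elim: n x => [|n IH] x.
  by rewrite P0_d P0 (s_pi0_sg H) (dx_pi0 HD) (lin0 (sx_iota H)) oppr0.
rewrite !PS; swn; rewrite opprD !opprK; congr (_ + _).
by rewrite -sw_opp; swx; rewrite IH (linN _ (sx_appl H _)) opprK.
Qed.

(** The coaction of the appended letter contains (S a_(1)) a_(3), and the coaction of the remaining
    letters cancels S a_(1), as for products. *)
Lemma s_rho_d x U (F : W -> A -> U) :
  linl F -> linr F -> tlift (rho (dd x)) F = \sw_(x0, x1 <- rho x) F (dd x0) x1.
Proof.
move=> F1 F2; suff -> : rho (dd x) = \sw_(x0, x1 <- rho x) (dd x0 ⊗ x1) by swn.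
apply: (coindl H) => n; swn_r.
suff h: forall U (F : W -> A -> U), linl F ->
    linr F ->
  \sw_(x0, x1 <- rho (dd x)) F (P n x0) x1 = \sw_(x0, x1 <- rho x) F (P n (dd x0)) x1.
  by rewrite h.
elim: n x => [|n IH] x {F1 F2 F}U F F1 F2.
  under eq_sw do rewrite P0; under [RHS]eq_sw do rewrite P0_d (lin0 (F1 _)).
  rewrite (s_rho_pi0 H _ (fun a b => F (iota a) b)) // (dx_pi0 HD) sw_zero.
  by rewrite linear0 sw0.
under eq_sw do rewrite PS; under [RHS]eq_sw do rewrite PS.
swn; rewrite !(s_rho_lam H) //; swn_l; congr (_ + _).
  apply: eq_sw => x' v.
  by rewrite (IH _ _ (fun z a => \sw_(v0, v1 <- coact v) F (app z v0) (a * v1))).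
rewrite (s_rhoA H _ (F := fun y0 y1 x1 => \sw_(a1, b <- cop x1)
  \sw_(a2, a3 <- cop b) F (app (P n (sg y0)) (omt a2)) (y1 * (ant a1 * a3)))) //.
rewrite (s_rhoA H _ (F := fun y0 y1 x1 => F (app (P n (sg y0)) (omt y1)) x1)) //.
apply: eq_sw => x0 x1.
transitivity (\sw_(c, b' <- cop x1) \sw_(a1, b <- cop b') \sw_(a2, a3 <- cop b)
  F (app (P n (sg x0)) (omt a2)) (c * ant a1 * a3)).
  by do 3!swx; rewrite mulrA.
rewrite (sw_cop_ant _ (F := fun c a2 a3 => F (app (P n (sg x0)) (omt a2)) (c * a3))) //.
by swx; rewrite mul1r.
Qed.

End DiffTheory.

Ltac sw_rho_d H HD := first [ sw_lam_d H HD | apply (s_rho_d H HD) ].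
Ltac sw_ops_d H HD ::= sw_rho_d H HD.

Section DiffTheory2.

Hypothesis H : shuffle_axioms o.
Variables (omt : A -> V) (dd : W -> W) (HD : diff_axioms o omt dd).

Let P0 x : P 0 x = iota (pi0 x). Proof. exact: sx_P0 H x. Qed.
Let PS n x : P n.+1 x = \sw_(x', v <- lam x) app (P n x') v. Proof. exact: sx_PS H n x. Qed.

(** Up to the induction hypothesis, two terms end in [omt x1]; they are opposite because d
    anticommutes with [sg]. *)
Lemma s_d2 x : dd (dd x) = 0.
Proof.
apply: (coind H) => n; rewrite (lin0 (sx_P H _)); elim: n x => [|n IH] x; first by rewrite (P0_d H
  HD).
rewrite PS; swn_l.
under [X in X + _ + _]eq_sw do rewrite IH (lin0 (sx_appl H _)).
rewrite sw_zero add0r -sw_add -[RHS](sw_zero _ (rho x)); apply: eq_sw => x0 x1.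
by rewrite (d_sg H HD) (linN _ (sx_P H _)) (linN _ (sx_appl H _)) addNr.
Qed.

Lemma s_Delta_d x U (F : W -> W -> U) :
  linl F -> linr F -> tlift (Delta (dd x)) F = \sw_(x1, x2 <- Delta x) (F (dd x1) x2 + F (sg x1)
    (dd x2)).
Proof.
move=> F1 F2; suff -> : Delta (dd x)
  = \sw_(x1, x2 <- Delta x) (dd x1 ⊗ x2 + sg x1 ⊗ dd x2) by swn.
apply: (coindr H) => n; swn_r.
suff h: forall U (F : W -> W -> U), linl F ->
    linr F ->
  \sw_(z1, z2 <- Delta (dd x)) F z1 (P n z2)
  = \sw_(x1, x2 <- Delta x) F (dd x1) (P n x2)
    + \sw_(x1, x2 <- Delta x) F (sg x1) (P n (dd x2)).
  by rewrite h.
elim: n x => [|n IH] x {F1 F2 F}U F F1 F2.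
  under eq_sw do rewrite P0.
  under [X in _ = X + _]eq_sw do rewrite P0.
  under [X in _ = _ + X]eq_sw do rewrite (P0_d H HD) (lin0 (F2 _)).
  rewrite (s_Delta_pi0 H _ (fun x a => F x (iota a))) // sw_zero addr0; swn_l.
  by rewrite (s_Delta_pi0 H _ (fun x a => F (dd x) (iota a))).
under eq_sw do rewrite PS.
under [X in _ = X + _]eq_sw do rewrite PS.
under [X in _ = _ + X]eq_sw do rewrite PS.
swn; rewrite !(s_Delta_lam H) //; swn_l.
under [X in X + _]eq_sw => x' v.
  rewrite (IH _ _ (fun z1 z2 => F z1 (app z2 v))) //.
  over.
rewrite sw_add addrA; congr (_ + _).
by rewrite (s_Delta_rho H _ (F := fun x1 y0 y1 => F (sg x1) (app (P n (sg y0)) (omt y1)))).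
Qed.

Lemma s_d_mul x y : dd (mul x y) = mul (dd x) y + mul (sg x) (dd y).
Proof.
apply: (coind H) => n; rewrite (linD (sx_P H _)); elim: n x y => [|n IH] x y.
  by rewrite (P0_d H HD) !P0 !(s_pi0_mul H) !(dx_pi0 HD) mul0r mulr0 (lin0 (sx_iota H)) addr0.
rewrite !PS; swn.
have Ea : \sw_(y', w <- lam y) app (P n (dd (mul x y'))) w
    = \sw_(y', w <- lam y) app (P n (mul (dd x) y')) w
      + \sw_(y', w <- lam y) app (P n (mul (sg x) (dd y'))) w.
  by rewrite -sw_add; swx; rewrite IH (linD (sx_appl H _)).
have Eb : \sw_(x', v <- lam x) \sw_(y0, y1 <- rho y) app (P n (dd (mul x' (sg y0)))) (v ◁ y1)
    = \sw_(x', v <- lam x) \sw_(y0, y1 <- rho y) app (P n (mul (dd x') (sg y0))) (v ◁ y1)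
      - \sw_(x', v <- lam x) \sw_(y0, y1 <- rho y)
          app (P n (mul (sg x') (sg (dd y0)))) (v ◁ y1).
  rewrite -sw_sub; swx; rewrite -sw_sub; swx.
  rewrite IH (d_sg H HD) (linN _ (sx_mulr H _)) (linN _ (sx_P H _)).
  by rewrite (linD (sx_appl H _)) (linN _ (sx_appl H _)).
(* The appended letter: [dx_omtM] splits [omt (x1 * y1)] into the contributions of d x and d y. *)
have Ec : \sw_(x0, x1 <- rho x) \sw_(y0, y1 <- rho y)
      app (P n (sg (mul x0 y0))) (omt (x1 * y1))
    = \sw_(x0, x1 <- rho x) \sw_(y0, y1 <- rho y)
        app (P n (mul (sg x0) (sg y0))) (omt x1 ◁ y1)
      + \sw_(y0, y1 <- rho y) app (P n (mul (sg x) (sg y0))) (omt y1).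
  rewrite -[X in _ + X](s_rho_cou H x (F := fun x => \sw_(y0, y1 <- rho y)
    app (P n (mul (sg x) (sg y0))) (omt y1))) //.
  rewrite -sw_add; swx; rewrite -sw_scale -sw_add; swx.
  by rewrite (dx_omtM HD) (linD (sx_appr H _)) (linZ _ _ (sx_appr H _)) (s_sg_mul H).
by rewrite Ea Eb Ec [LHS](AC (2*2*2) (1*(3*5)*(2*6*4))).
Qed.

End DiffTheory2.

(** * The codifferential and its square *)

Section Coinner.

Hypothesis H : shuffle_axioms o.
Variables (psi : V -> k) (psiL : scal psi).

Lemma s_lam_lconv x U (F : W -> V -> U) :
  linl F -> linr F -> tlift (lam (lcv psi x)) F = \sw_(x', v <- lam x) F (lcv psi x') v.
Proof.
move=> F1 F2; rewrite /lconv; swn; under eq_sw do rewrite sw_exch.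
by rewrite (s_Delta_lam H).
Qed.

Lemma s_Delta_lconv x U (F : W -> W -> U) :
  linl F -> linr F -> tlift (Delta (lcv psi x)) F = \sw_(x1, x2 <- Delta x) F (lcv psi x1) x2.
Proof.
move=> F1 F2; rewrite /lconv; swn; under eq_sw do rewrite sw_exch.
by rewrite -(s_DeltaA H _ (F := fun y1 y2 x2 =>
  \sw_(x', v <- lam y1) ((cou (pi0 x') * psi v) *: F y2 x2))).
Qed.

Lemma s_Delta_rconv x U (F : W -> W -> U) :
  linl F -> linr F -> tlift (Delta (rcv psi x)) F = \sw_(x1, x2 <- Delta x) F x1 (rcv psi x2).
Proof.
move=> F1 F2; rewrite /rconv; swn.
by rewrite [RHS](s_Delta_lam H _ (F := fun x1 x' v => psi v *: F x1 x')).
Qed.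

Lemma s_rho_lconv x U (F : W -> A -> U) :
  linl F -> linr F -> tlift (rho (lcv psi x)) F = \sw_(x0, x1 <- rho x) F (lcv psi x0) x1.
Proof.
move=> F1 F2; rewrite /lconv; swn; under eq_sw do rewrite sw_exch.
by rewrite (s_Delta_rho H).
Qed.

Lemma lconv_sg x : lcv psi (sg x) = - sg (lcv psi x).
Proof.
rewrite /lconv; swn; congr (- _); swx; swx.
by rewrite (s_pi0_sg H).
Qed.

Lemma rconv_sg x : rcv psi (sg x) = - sg (rcv psi x).
Proof. by rewrite /rconv; swn. Qed.

Lemma s_rconv_conv x U (F : W -> U) : lin F ->
  F (rcv psi x)
  = \sw_(x1, x2 <- Delta x) \sw_(x', v <- lam x2) ((cou (pi0 x') * psi v) *: F x1).
Proof.
move=> F1; rewrite /rconv; swn_l; rewrite (s_Delta_lam H) //; apply: eq_sw => x' v.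
rewrite -(s_epsR H x' (F := fun x => psi v *: F x)) //.
by swx; rewrite scalerA.
Qed.

(** Both sides evaluate psi on the middle factor of the iterated coproduct. *)
Lemma s_rl_conv x U (F : W -> W -> U) :
  linl F -> linr F -> \sw_(x1, x2 <- Delta x) F (rcv psi x1) x2 = \sw_(x1, x2 <- Delta x) F x1
    (lcv psi x2).
Proof.
move=> F1 F2; rewrite /lconv; swn_r.
under eq_sw => x1 x2.
  rewrite (s_rconv_conv _ (F := fun x => F x x2)) //.
  over.
by rewrite (s_DeltaA H _ (F := fun y1 y2 x2 =>
  \sw_(x', v <- lam y2) ((cou (pi0 x') * psi v) *: F y1 x2))).
Qed.

Lemma pi0_lconv x : pi0 (lcv psi x)
  = \sw_(x', v <- lam x) \sw_(v0, v1 <- coact v) (psi v0 *: (pi0 x' * v1)).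
Proof.
rewrite /lconv; swn_l.
rewrite (s_Delta_pi0 H _ (fun x a => \sw_(x', v <- lam x) ((cou (pi0 x') * psi v) *: a))) //.
rewrite (s_rho_lam H _ (F := fun x' v a => (cou (pi0 x') * psi v) *: a)) //.
apply: eq_sw => x' v; rewrite sw_exch; apply: eq_sw => v0 v1.
rewrite (s_rho_pi0 H _ (fun a b => (cou a * psi v0) *: (b * v1))) //.
rewrite -(sw_couL (pi0 x') (F := fun a => psi v0 *: (a * v1))) //.
by swx; rewrite scalerA.
Qed.

End Coinner.

Ltac sw_conv H := first
  [ sw_core H | apply (s_lam_lconv H) | apply (s_rho_lconv H)
  | apply (s_Delta_lconv H) | apply (s_Delta_rconv H) ].
Ltac sw_ops H ::= sw_conv H.

Section CoinnerTheory.

Hypothesis H : shuffle_axioms o.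
Variables (psi : V -> k) (psiL : scal psi).
Hypothesis psi_inv : forall v a, psi (v ◁ a) = cou a * psi v.

Let P0 x : P 0 x = iota (pi0 x). Proof. exact: sx_P0 H x. Qed.
Let PS n x : P n.+1 x = \sw_(x', v <- lam x) app (P n x') v. Proof. exact: sx_PS H n x. Qed.

(** [lcv] commutes with taking last letters, so the induction step is formal. The content is in
    degree 0, where psi is evaluated on v ◁ a: invariance removes the action, and then the antipode
    cancels. *)
Lemma lconv_mul x y : lcv psi (mul x y) = mul (lcv psi x) y + mul (sg x) (lcv psi y).
Proof.
apply: (coind H) => n; rewrite (linD (sx_P H _)); elim: n x y => [|n IH] x y.
  rewrite !P0 -(linD (sx_iota H)); congr iota.
  rewrite !(s_pi0_mul H) (s_pi0_sg H) !(pi0_lconv H psiL); swn.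
  rewrite addrC; congr (_ + _); last by swx; swx; rewrite (s_pi0_mul H) mulrA.
  apply: eq_sw => x' v.
  rewrite sw_exch; apply: eq_sw => v0 v1.
  under eq_sw do under eq_sw do under eq_sw do rewrite psi_inv (s_pi0_mul H) (s_pi0_sg H).
  rewrite (s_rho_pi0 H _ (fun a c => \sw_(a1, b <- cop c) \sw_(a2, a3 <- cop b)
    ((cou a2 * psi v0) *: (pi0 x' * a * (ant a1 * v1 * a3))))) //.
  transitivity (\sw_(c, b' <- cop (pi0 y)) \sw_(a1, b <- cop b') \sw_(a2, a3 <- cop b)
    ((cou a2 * psi v0) *: (pi0 x' * (c * ant a1) * v1 * a3))).
    by do 3!swx; rewrite !mulrA.
  rewrite (sw_cop_ant _ (F := fun c a2 a3 =>
    (cou a2 * psi v0) *: (pi0 x' * c * v1 * a3))) //.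
  rewrite -(sw_couL (pi0 y) (F := fun a => psi v0 *: (pi0 x' * v1 * a))) //.
  by swx; rewrite mulr1 scalerA.
rewrite !PS; swn.
have Ea : \sw_(y', w <- lam y) app (P n (lcv psi (mul x y'))) w
    = \sw_(y', w <- lam y) app (P n (mul (lcv psi x) y')) w
      + \sw_(y', w <- lam y) app (P n (mul (sg x) (lcv psi y'))) w.
  by rewrite -sw_add; swx; rewrite IH (linD (sx_appl H _)).
have Eb : \sw_(x', v <- lam x) \sw_(y0, y1 <- rho y) app (P n (lcv psi (mul x' (sg y0)))) (v ◁ y1)
    = \sw_(x', v <- lam x) \sw_(y0, y1 <- rho y) app (P n (mul (lcv psi x') (sg y0))) (v ◁ y1)
      - \sw_(x', v <- lam x) \sw_(y0, y1 <- rho y)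
          app (P n (mul (sg x') (sg (lcv psi y0)))) (v ◁ y1).
  rewrite -sw_sub; swx; rewrite -sw_sub; swx.
  rewrite IH (lconv_sg H psiL) (linN _ (sx_mulr H _)) (linN _ (sx_P H _)).
  by rewrite (linD (sx_appl H _)) (linN _ (sx_appl H _)).
by rewrite Ea Eb [LHS](AC (2*2) ((1*3)*(2*4))).
Qed.

Lemma rconv_mul x y : rcv psi (mul x y) = mul x (rcv psi y) + mul (rcv psi x) (sg y).
Proof.
rewrite /rconv; swn; congr (_ + _); apply: eq_sw => x' v.
under eq_sw do rewrite psi_inv -scalerA.
by rewrite (s_rho_cou H y (F := fun y => psi v *: mul x' (sg y))).
Qed.

Lemma coinner_mul x y :
  coinner o psi (mul x y) = mul (coinner o psi x) y + mul (sg x) (coinner o psi y).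
Proof.
rewrite /coinner lconv_mul (s_sg_mul H) rconv_mul (sg_sg H).
rewrite (linD (sx_mull H _)) (linD (sx_mulr H _)).
by rewrite [LHS](AC (2*2) ((1*4)*(2*3))).
Qed.

(** The coproduct shows [lcv] on the first leg and [rcv] on the second. The two other terms, [rcv]
    on the first leg and [lcv] on the second, cancel by [s_rl_conv]. *)
Lemma s_Delta_coinner x U (F : W -> W -> U) :
  linl F -> linr F -> tlift (Delta (coinner o psi x)) F
  = \sw_(x1, x2 <- Delta x) (F (coinner o psi x1) x2 + F (sg x1) (coinner o psi x2)).
Proof.
move=> F1 F2; rewrite /coinner; swn.
have -> : \sw_(x1, x2 <- Delta x) F (rcv psi (sg x1)) x2
    = - \sw_(x1, x2 <- Delta x) F (sg x1) (lcv psi x2).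
  rewrite -(s_rl_conv H psiL x (F := fun x y => F (sg x) y)) // -sw_opp.
  by swx; rewrite (rconv_sg H psiL) (linN _ (F1 _)).
by rewrite -addrA addKr.
Qed.

Lemma lconv_rconv psi' (psi'L : scal psi') x : lcv psi (rcv psi' x) = rcv psi' (lcv psi x).
Proof.
by rewrite /rconv; swn.
Qed.

(* lcv and rcv commute and both anticommute with sg, so the cross terms cancel. *)
Lemma coinner2 x :
  coinner o psi (coinner o psi x) = lcv psi (lcv psi x) - rcv psi (rcv psi x).
Proof.
have lL := lin_lconv H psiL; have rL := lin_rconv H psiL.
have e1 : rcv psi (sg (lcv psi x)) = - lcv psi (rcv psi (sg x)).
  by rewrite lconv_rconv // (lconv_sg H psiL) (linN _ rL) opprK.
have e2 : rcv psi (sg (rcv psi (sg x))) = - rcv psi (rcv psi x).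
  by rewrite (rconv_sg H psiL x) (linN _ (sx_sg H)) (sg_sg H) (linN _ rL).
by rewrite /coinner (linD lL) (linD (sx_sg H)) (linD rL) e1 e2 addrA addrK.
Qed.

End CoinnerTheory.

Ltac sw_Delta_d H HD := first [ sw_rho_d H HD | apply (s_Delta_d H HD) ].
Ltac sw_ops_d H HD ::= sw_Delta_d H HD.

(** * The commutator of d with the square of i *)

Section Commutator.

Hypothesis H : shuffle_axioms o.
Variables (omt : A -> V) (dd : W -> W) (HD : diff_axioms o omt dd).
Variables (psi : V -> k) (psiL : scal psi).
Hypothesis psi_inv : forall v a, psi (v ◁ a) = cou a * psi v.

(** For psi = theta and omt = omega~ this is [theta_omega], by conversion. *)
Definition psi_omt (v : V) : k :=
  tlift (U := k^o) (coact v) (fun v0 v1 => psi v0 * psi (omt v1)).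

Lemma scal_psi_omt : scal psi_omt.
Proof.
have bl : bilin (fun v0 (v1 : A) => psi v0 * psi (omt v1) : k^o).
  split=> [a|v] c x y; first by rewrite psiL mulrDl -mulrA.
  by rewrite (dx_omt HD) psiL mulrDr mulrCA.
by move=> c x y; rewrite /psi_omt linearP tlift_linear.
Qed.

Lemma psi_omtE v U (u : U) :
  psi_omt v *: u = \sw_(v0, v1 <- coact v) ((psi v0 * psi (omt v1)) *: u).
Proof. by rewrite (sw_lin (h := fun c : k^o => c *: u)) //; move=> c x y; rewrite scalerDl
  scalerA. Qed.

Let tw := psi_omt.
Let twL : scal tw. Proof. exact: scal_psi_omt. Qed.

(** The right and left convolutions with the degree 0 form psi o omt o pi0. They measure how far
    [rcv] and [lcv] are from commuting with d up to sign. *)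
Let rc x : W := \sw_(x0, x1 <- rho x) (psi (omt x1) *: x0).
Let lc x : W := \sw_(x1, x2 <- Delta x) (psi (omt (pi0 x1)) *: x2).
Let rcL : lin rc. Proof. by rewrite /rc. Qed.
Let lcL : lin lc. Proof. by rewrite /lc. Qed.

(** Invariance of psi removes the action from [dx_omtM] and leaves an ε-derivation of A. Hence the
    exchange relations below differ from commutation by a single term in [psi_omt]. *)
Lemma psi_omtM a b : psi (omt (a * b)) = cou b * psi (omt a) + cou a * psi (omt b).
Proof. by rewrite (dx_omtM HD) addrC psiL psi_inv addrC. Qed.

Lemma rconv_d x : rcv psi (dd x) = dd (rcv psi x) + rc (sg x).
Proof. by rewrite /rconv /rc; swn. Qed.

Lemma rc_sg x : rc (sg x) = sg (rc x).
Proof. by rewrite /rc; swn. Qed.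

(** Carrying the degree 0 form across the last letter v replaces its argument a by a v_1, and the
    derivation rule isolates psi(v_0) psi(omt v_1). *)
Lemma rconv_rc x : rcv psi (rc x) = rc (rcv psi x) + rcv tw x.
Proof.
rewrite /rconv /rc; swn_l.
under eq_sw do under eq_sw do rewrite mulrC.
rewrite (s_rho_lam H _ (F := fun x' v a => (psi v * psi (omt a)) *: x')) //.
swn_r; rewrite -sw_add; apply: eq_sw => x' v.
rewrite psi_omtE -(s_rho_cou H x' (F := fun x => \sw_(v0, v1 <- coact v)
  ((psi v0 * psi (omt v1)) *: x))) // -sw_add; apply: eq_sw => x0 x1.
rewrite -sw_scale.
rewrite -[X in X + _](sw_coact_cou v (F := fun v => (psi v * psi (omt x1)) *: x0)) //.
rewrite -sw_add; apply: eq_sw => v0 v1.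
rewrite psi_omtM !scalerA -scalerDl; congr (_ *: _).
by rewrite mulrDr !(mulrCA (psi v0)).
Qed.

Lemma psi_omt_rho z (u : W) :
  \sw_(z0, z1 <- rho z) ((cou (pi0 z0) * psi (omt z1)) *: u) = psi (omt (pi0 z)) *: u.
Proof.
rewrite (s_rho_pi0 H _ (fun a b => (cou a * psi (omt b)) *: u)) //.
rewrite -(sw_couL (pi0 z) (F := fun a => psi (omt a) *: u)) //.
by swx; rewrite scalerA.
Qed.

Lemma lconv_d x : lcv psi (dd x) = lc x - dd (lcv psi x).
Proof.
apply/eqP; rewrite -subr_eq opprK; apply/eqP.
rewrite /lc /lconv; swn_l.
(* With d on the first leg, psi sees only the appended letter, because [pi0] vanishes on d x'. With
   d on the second leg, one recovers d of the convolution with a sign. *)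
have -> : \sw_(x1, x2 <- Delta x) \sw_(x', v <- lam x1) ((cou (pi0 (dd x')) * psi v) *: x2) = 0.
  rewrite -[RHS](sw_zero _ (Delta x)); apply: eq_sw => x1 x2.
  rewrite -[RHS](sw_zero _ (lam x1)); swx.
  by rewrite (dx_pi0 HD) linear0 mul0r scale0r.
rewrite add0r.
set T := \sw_(x0, y <- Delta x) _; set T1 := \sw_(x0, y <- Delta x) _.
rewrite -[RHS]addr0 -addrA; congr (_ + _).
  by swx; rewrite -psi_omt_rho; swx; rewrite (s_pi0_sg H).
by rewrite addrC; apply/eqP; rewrite subr_eq0; apply/eqP; swx; swx; rewrite (s_pi0_sg H).
Qed.

(** The degree 0 form is evaluated before the letter seen by psi on the left, and after it on the
    right, where its argument a becomes a v_1. *)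
Lemma lconv_lc x : lcv psi (lc x) = lc (lcv psi x) - lcv tw x.
Proof.
transitivity (\sw_(x1, x2 <- Delta x) \sw_(y1, y2 <- Delta x1) \sw_(x', v <- lam y2)
    ((psi (omt (pi0 y1)) * (cou (pi0 x') * psi v)) *: x2)).
  rewrite /lc /lconv; swn_l.
  by rewrite (s_DeltaA H _ (F := fun x y z => \sw_(x', v <- lam y)
    ((psi (omt (pi0 x)) * (cou (pi0 x') * psi v)) *: z))).
have -> : lc (lcv psi x) = \sw_(x1, x2 <- Delta x) \sw_(y1, y2 <- Delta x1)
    \sw_(x', v <- lam y1) ((cou (pi0 x') * psi v * psi (omt (pi0 y2))) *: x2).
  rewrite (s_DeltaA H _ (F := fun x y z => \sw_(x', v <- lam x)
    ((cou (pi0 x') * psi v * psi (omt (pi0 y))) *: z))) //.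
  rewrite /lconv (sw_lin _ _ lcL); apply: eq_sw => x1 x2; rewrite (sw_lin _ _ lcL) sw_exch.
  by apply: eq_sw => x' v; rewrite (linZ _ _ lcL) /lc -sw_scale; swx; rewrite scalerA.
rewrite /lconv -sw_sub; apply: eq_sw => x1 x2.
rewrite (s_Delta_lam H _ (F := fun y1 x' v =>
  (psi (omt (pi0 y1)) * (cou (pi0 x') * psi v)) *: x2)) //.
rewrite (s_Delta_pi0 H _ (fun z a => \sw_(x', v <- lam z)
  ((cou (pi0 x') * psi v * psi (omt a)) *: x2))) //.
rewrite (s_rho_lam H _ (F := fun x' v a => (cou (pi0 x') * psi v * psi (omt a)) *: x2)) //.
rewrite -sw_sub; apply: eq_sw => x' v; apply/eqP; rewrite eq_sym subr_eq; apply/eqP.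
have -> : (cou (pi0 x') * tw v) *: x2 = \sw_(v0, v1 <- coact v)
    ((cou (pi0 x') * (psi v0 * psi (omt v1))) *: x2).
  rewrite -scalerA psi_omtE -sw_scale.
  by swx; rewrite scalerA.
have -> : \sw_(y1, y2 <- Delta x') ((psi (omt (pi0 y1)) * (cou (pi0 y2) * psi v)) *: x2)
    = \sw_(v0, v1 <- coact v) (cou v1 *: ((psi (omt (pi0 x')) * psi v0) *: x2)).
  rewrite (sw_coact_cou v (F := fun v => (psi (omt (pi0 x')) * psi v) *: x2)) //.
  rewrite -(s_epsR H x' (F := fun y => (psi (omt (pi0 y)) * psi v) *: x2)) //.
  by swx; rewrite scalerA mulrCA.
rewrite sw_exch -sw_add; apply: eq_sw => v0 v1.
rewrite (s_rho_pi0 H _ (fun a b => (cou a * psi v0 * psi (omt (b * v1))) *: x2)) //.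
rewrite -[LHS](eq_sw _ (f := fun a b => cou a *: ((psi v0 * psi (omt (b * v1))) *: x2))); last
  first.
  by move=> a b; rewrite scalerA mulrA.
rewrite (sw_couL _ (F := fun b => (psi v0 * psi (omt (b * v1))) *: x2)) //.
rewrite psi_omtM !scalerA -scalerDl; congr (_ *: _).
by rewrite mulrDr (mulrC (psi (omt _))) !(mulrCA (psi v0)).
Qed.

Lemma coinner2_d x :
  coinner o psi (coinner o psi (dd x)) = dd (coinner o psi (coinner o psi x)) - coinner o tw x.
Proof.
have dL := dx_dd HD; have lL := lin_lconv H psiL; have rL := lin_rconv H psiL.
rewrite !(coinner2 H psiL) lconv_d (linD lL) (linN _ lL) lconv_d lconv_lc.
have er : rcv psi (rcv psi (dd x)) = dd (rcv psi (rcv psi x)) - sg (rcv tw x).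
  (* [rc] commutes with [sg] while [rcv] anticommutes with it, so the two terms in [rc] cancel. *)
  rewrite rconv_d (linD rL) rconv_d !rc_sg (rconv_sg H psiL) rconv_rc (linD (sx_sg H)).
  by rewrite opprD addrA addrK.
rewrite er (linD dL) (linN _ dL) /coinner (rconv_sg H twL).
rewrite !opprD !opprK [X in X + _ = _](AC (2*2) ((1*3)*2*4)) /= subrr add0r.
by rewrite [LHS](AC (2*2) ((2*3)*(1*4))).
Qed.

End Commutator.

(** * Homogeneous components *)

Section Degree.

Hypothesis H : shuffle_axioms o.
Let P0 x : P 0 x = iota (pi0 x). Proof. exact: sx_P0 H x. Qed.
Let PS n x : P n.+1 x = \sw_(x', v <- lam x) app (P n x') v. Proof. exact: sx_PS H n x. Qed.

Lemma pi0_P n x : pi0 (P n x) = if n is 0 then pi0 x else 0.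
Proof.
case: n => [|n]; rewrite ?P0 ?(sx_pi0_iota H) // PS (sw_lin _ _ (sx_pi0 H)).
by rewrite -[RHS](sw_zero _ (lam x)); swx; rewrite (sx_pi0_app H).
Qed.

Lemma s_lam_P0 x U (F : W -> V -> U) :
  linl F -> linr F -> tlift (lam (P 0 x)) F = 0.
Proof. by move=> F1 F2; rewrite P0 (s_lam_iota H). Qed.

Lemma s_lam_P n x U (F : W -> V -> U) :
  linl F -> linr F -> tlift (lam (P n.+1 x)) F = \sw_(x', v <- lam x) F (P n x') v.
Proof. by move=> F1 F2; rewrite PS; swn. Qed.

Lemma P_P m n x : P m (P n x) = if m == n then P n x else 0.
Proof.
elim: m n x => [|m IH] [|n] x.
- by rewrite eqxx P0 pi0_P P0.
- by rewrite P0 pi0_P (lin0 (sx_iota H)).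
- by rewrite PS s_lam_P0.
rewrite PS s_lam_P // eqSS PS; case: ifP => mn.
  by swx; rewrite IH mn.
by rewrite -[RHS](sw_zero _ (lam x)); swx; rewrite IH mn (lin0 (sx_appl H _)).
Qed.

Lemma s_rho_P n x U (F : W -> A -> U) :
  linl F -> linr F -> tlift (rho (P n x)) F = \sw_(x0, x1 <- rho x) F (P n x0) x1.
Proof.
move=> F1 F2; suff -> : rho (P n x) = \sw_(x0, x1 <- rho x) (P n x0 ⊗ x1) by swn.
apply: (coindl H) => m; swn_r.
suff h: forall U (F : W -> A -> U), linl F ->
    linr F ->
  \sw_(x0, x1 <- rho (P n x)) F (P m x0) x1 = \sw_(x0, x1 <- rho x) F (P m (P n x0)) x1.
  by rewrite h.
elim: m n x => [|m IH] n x {F1 F2 F}U F F1 F2.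
  under eq_sw do rewrite P0; under [RHS]eq_sw do rewrite P0.
  rewrite (s_rho_pi0 H _ (fun a b => F (iota a) b)) // pi0_P.
  case: n => [|n].
    under [RHS]eq_sw do rewrite pi0_P.
    by rewrite (s_rho_pi0 H _ (fun a b => F (iota a) b)).
  under [RHS]eq_sw do rewrite pi0_P (lin0 (sx_iota H)) (lin0 (F1 _)).
  by rewrite linear0 sw0 // sw_zero.
under eq_sw do rewrite PS; swn_l; rewrite (s_rho_lam H) //.
case: n => [|n].
  rewrite s_lam_P0 //.
  under [RHS]eq_sw do rewrite P_P (lin0 (F1 _)).
  by rewrite sw_zero.
rewrite s_lam_P //; under [RHS]eq_sw do rewrite PS s_lam_P //.
swn; rewrite (s_rho_lam H) //; apply: eq_sw => x' v.
by rewrite (IH _ _ _ (fun z a => \sw_(v0, v1 <- coact v) F (app z v0) (a * v1))).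
Qed.

End Degree.

Ltac sw_degree H := first [ sw_conv H | apply (s_lam_P H) | apply (s_rho_P H) ].
Ltac sw_ops H ::= sw_degree H.

Section Degree2.

Hypothesis H : shuffle_axioms o.
Let P0 x : P 0 x = iota (pi0 x). Proof. exact: sx_P0 H x. Qed.
Let PS n x : P n.+1 x = \sw_(x', v <- lam x) app (P n x') v. Proof. exact: sx_PS H n x. Qed.

Lemma Delta_P_aux m n x U (F : W -> W -> U) :
  linl F -> linr F -> \sw_(z1, z2 <- Delta (P n x)) F z1 (P m z2)
  = if (m <= n)%N then \sw_(x1, x2 <- Delta x) F (P (n - m) x1) (P m x2) else 0.
Proof.
elim: m n x F => [|m IH] n x F F1 F2.
  rewrite subn0 /=; under eq_sw do rewrite P0; under [RHS]eq_sw do rewrite P0.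
  rewrite (s_Delta_pi0 H _ (fun x a => F x (iota a))) //; swn_l.
  by rewrite (s_Delta_pi0 H _ (fun x a => F (P n x) (iota a))).
under eq_sw do rewrite PS; swn_l; rewrite (s_Delta_lam H) //.
case: n => [|n]; first by rewrite (s_lam_P0 H).
rewrite (s_lam_P H) //; under eq_sw => x' v do rewrite (IH _ _ (fun x y => F x (app y v))) //.
rewrite ltnS subSS; case: leqP => _; last by rewrite sw_zero.
by under [RHS]eq_sw do rewrite PS; swn; rewrite (s_Delta_lam H).
Qed.

(** Projecting the second leg to degree m leaves only the summand with n - p = m. *)
Lemma Delta_P n x :
  Delta (P n x) = \sum_(p < n.+1) \sw_(x1, x2 <- Delta x) (P p x1 ⊗ P (n - p) x2).
Proof.
apply: (coindr H) => m; rewrite Delta_P_aux // sw_big //.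
under eq_bigr do rewrite sw_flat //.
under eq_bigr => p _.
  under eq_sw => x1 x2.
    rewrite swE // P_P //.
    over.
  over.
case: leqP => mn; last first.
  rewrite big1 // => p _; rewrite -[RHS](sw_zero _ (Delta x)); swx.
  by rewrite gtn_eqF ?(lin0 (lin_tpurer _)) // (leq_ltn_trans _ mn) ?leq_subr.
have np : (n - m < n.+1)%N by rewrite ltnS leq_subr.
rewrite (bigD1 (Ordinal np)) //= subKn // eqxx big1 ?addr0 // => p /eqP pn.
rewrite -[RHS](sw_zero _ (Delta x)); swx.
case: eqP => [e|_]; last by rewrite (lin0 (lin_tpurer _)).
by case: pn; apply: val_inj; rewrite /= e subKn // -ltnS.
Qed.

End Degree2.

Section Degree3.

Hypothesis H : shuffle_axioms o.
Variables (omt : A -> V) (dd : W -> W) (HD : diff_axioms o omt dd).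
Variables (psi : V -> k) (psiL : scal psi).
Let P0 x : P 0 x = iota (pi0 x). Proof. exact: sx_P0 H x. Qed.
Let PS n x : P n.+1 x = \sw_(x', v <- lam x) app (P n x') v. Proof. exact: sx_PS H n x. Qed.

Lemma P_sg n x : P n (sg x) = (-1) ^+ n *: P n x.
Proof.
elim: n x => [|n IH] x; first by rewrite !P0 (s_pi0_sg H) expr0 scale1r.
rewrite !PS; swn_l; rewrite exprS mulN1r scaleNr; congr (- _).
by rewrite -sw_scale; swx; rewrite IH (linZ _ _ (sx_appl H _)).
Qed.

Lemma sg_P n x : sg (P n x) = (-1) ^+ n *: P n x.
Proof.
apply: (coind H) => m; rewrite (linZ _ _ (sx_P H _)) P_sg !(P_P H).
by case: eqP => [->|_]; rewrite ?scaler0.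
Qed.

Lemma P_par b n x : P n (par b x) = if odd n == b then P n x else 0.
Proof.
elim: n b x => [|n IH] b x; first by rewrite !P0 (sx_pi0_par H); case: b; rewrite //= (lin0
  (sx_iota H)).
rewrite !PS; swn_l; have -> : (odd n.+1 == b) = (odd n == ~~ b) by case: b => /=; case: odd.
case: ifP => e; first by swx; rewrite IH e.
by rewrite -[RHS](sw_zero _ (lam x)); swx; rewrite IH e (lin0 (sx_appl H _)).
Qed.

Lemma par_P b n x : par b (P n x) = if odd n == b then P n x else 0.
Proof.
apply: (coind H) => m; rewrite P_par (P_P H); case: (m =P n) => [->|mn].
  by case: ifP => _; rewrite ?(P_P H) ?eqxx ?(lin0 (sx_P H _)).
case: ifP => _; case: ifP => _; rewrite ?(lin0 (sx_P H _)) // (P_P H).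
all: by move/eqP/negbTE: mn => ->.
Qed.

Lemma mul_P0 l m n x y : l != (m + n)%N -> P l (mul (P m x) (P n y)) = 0.
Proof.
elim: l m n x y => [|l IH] m n x y.
  rewrite P0 (s_pi0_mul H) !(pi0_P H).
  by case: m n => [|m] [|n] //; rewrite ?mulr0 ?mul0r (lin0 (sx_iota H)).
move=> e; rewrite PS; swn_l.
have -> : \sw_(y', w <- lam (P n y)) app (P l (mul (P m x) y')) w = 0.
  case: n e => [|n] e; first by rewrite (s_lam_P0 H).
  rewrite (s_lam_P H) // -[RHS](sw_zero _ (lam y)); swx.
  by rewrite IH ?(lin0 (sx_appl H _)) //; rewrite addnS eqSS in e.
rewrite add0r; case: m e => [|m] e; first by rewrite (s_lam_P0 H).
rewrite (s_lam_P H) // -[RHS](sw_zero _ (lam x)); swx.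
rewrite -[RHS](sw_zero _ (rho y)); swx.
by rewrite sg_P (linZ _ _ (sx_mulr H _)) (linZ _ _ (sx_P H _)) IH // scaler0 (lin0 (sx_appl H _)).
Qed.

Lemma mul_P m n x y : P (m + n) (mul (P m x) (P n y)) = mul (P m x) (P n y).
Proof.
apply: (coind H) => l; rewrite (P_P H); case: eqP => [->|/eqP e] //.
by rewrite mul_P0.
Qed.

Lemma P_d n x : P n.+1 (dd x) = dd (P n x).
Proof.
symmetry; apply: (coind H) => m; rewrite (P_P H); elim: m n x => [|m IH] n x.
  by rewrite (P0_d H HD).
rewrite eqSS [LHS]PS; swn_l.
have -> : \sw_(x0, x1 <- rho x) app (P m (sg (P n x0))) (omt x1)
    = if m == n then \sw_(x0, x1 <- rho x) app (P n (sg x0)) (omt x1) else 0.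
  case: ifP => e; last rewrite -[RHS](sw_zero _ (rho x)); swx;
    rewrite sg_P (linZ _ _ (sx_P H _)) (P_P H) e ?scaler0 ?(lin0 (sx_appl H _)) //.
  by rewrite -P_sg.
have -> : \sw_(x', v <- lam (P n x)) app (P m (dd x')) v
    = if m == n then \sw_(x', v <- lam x) app (P n (dd x')) v else 0.
  case: n => [|n].
    rewrite (s_lam_P0 H) //; case: eqP => // _; rewrite -[LHS](sw_zero _ (lam x)); swx.
    by rewrite (P0_d H HD) (lin0 (sx_appl H _)).
  rewrite (s_lam_P H) //; case: m IH => [|m] IH.
    rewrite -[RHS](sw_zero _ (lam x)); swx.
    by rewrite (P0_d H HD) (lin0 (sx_appl H _)).
  rewrite eqSS; case: ifP => e; last rewrite -[RHS](sw_zero _ (lam x)); swx;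
    by rewrite IH eqSS e ?(lin0 (sx_appl H _)).
case: ifP => e; last by rewrite addr0.
by rewrite PS; swn_r.
Qed.

Lemma P_rconv n x : P n (rconv o psi x) = rconv o psi (P n.+1 x).
Proof. by rewrite /rconv (s_lam_P H) //; swn. Qed.

Lemma rconv_P0 x : rconv o psi (P 0 x) = 0.
Proof. by rewrite /rconv (s_lam_P0 H). Qed.

Lemma lconv_P0 x : lconv o psi (P 0 x) = 0.
Proof.
apply: (coind H) => m; rewrite (lin0 (sx_P H _)); case: m => [|m].
  by rewrite P0 (pi0_lconv H psiL) (s_lam_P0 H) // (lin0 (sx_iota H)).
by rewrite PS (s_lam_lconv H psiL) // (s_lam_P0 H).
Qed.

Lemma P_lconv n x : P n (lconv o psi x) = lconv o psi (P n.+1 x).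
Proof.
symmetry; apply: (coind H) => m; elim: m n x => [|m IH] n x.
  rewrite (P_P H) !P0 !(pi0_lconv H psiL) (s_lam_P H) //.
  case: n => [|n] /=.
    rewrite P0 (pi0_lconv H psiL); congr iota; swx; swx.
    by rewrite (pi0_P H).
  transitivity (iota 0); last by rewrite (lin0 (sx_iota H)).
  congr iota; rewrite -[RHS](sw_zero _ (lam x)); apply: eq_sw => x' v.
  by rewrite -[RHS](sw_zero _ (coact v)); swx; rewrite (pi0_P H) mul0r scaler0.
rewrite PS (s_lam_lconv H psiL) // (s_lam_P H) //; case: n => [|n].
  rewrite (P_P H) /= -[RHS](sw_zero _ (lam x)); swx.
  by rewrite lconv_P0 (lin0 (sx_P H _)) (lin0 (sx_appl H _)).
rewrite PS (s_lam_P H) // (s_lam_lconv H psiL) //.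
by swx; rewrite IH.
Qed.

Lemma P_coinner n x : P n (coinner o psi x) = coinner o psi (P n.+1 x).
Proof. by rewrite /coinner (linD (sx_P H _)) P_lconv P_rconv P_sg sg_P. Qed.

Lemma coinner_P0 x : coinner o psi (P 0 x) = 0.
Proof. by rewrite /coinner lconv_P0 sg_P expr0 scale1r rconv_P0 addr0. Qed.

End Degree3.

Ltac sw_all H := first [ sw_degree H | apply (s_Delta_mul H) | apply (s_Delta_iota H) ].
Ltac sw_ops H ::= first
  [ sw_all H | match goal with pL : scal _ |- _ => apply (s_Delta_coinner H pL) end ].

(** * The subcoalgebra killed by the square of i *)

Section Square.

Hypothesis H : shuffle_axioms o.
Variables (psi : V -> k) (psiL : scal psi).
Hypothesis psi_inv : forall v a, psi (v ◁ a) = cou a * psi v.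

Local Notation ii := (coinner o psi).
Local Notation J := (coinner_sq o psi).
Local Notation K := (cosq_test o psi).

Let iiL : lin ii. Proof. exact: lin_coinner. Qed.
Let JL : lin J. Proof. exact: lin_coinner_sq. Qed.

Lemma coinner_sg x : ii (sg x) = - sg (ii x).
Proof.
by rewrite /coinner (lconv_sg H psiL) !(rconv_sg H psiL) (linD (sx_sg H)) (linN _ (sx_sg H)) opprD.
Qed.

Lemma cosq_sg x : J (sg x) = sg (J x).
Proof. by rewrite /coinner_sq coinner_sg (linN _ iiL) coinner_sg opprK. Qed.

(** The square of an odd super-derivation is a derivation: the two mixed terms have opposite
    signs. *)
Lemma cosq_mul x y : J (mul x y) = mul (J x) y + mul x (J y).
Proof.
rewrite /coinner_sq (coinner_mul H psiL psi_inv) (linD iiL) !(coinner_mul H psiL psi_inv).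
rewrite coinner_sg (linN _ (sx_mull H _)) (sg_sg H) addrA.
by congr (_ + _); rewrite addrK.
Qed.

Lemma P_cosq n x : P n (J x) = J (P n.+2 x).
Proof. by rewrite /coinner_sq !(P_coinner H psiL). Qed.

Lemma cosq_P n x : J (P n x) = if n is m.+2 then P m (J x) else 0.
Proof.
case: n => [|[|n]]; rewrite ?P_cosq // /coinner_sq.
  by rewrite (coinner_P0 H psiL) (lin0 iiL).
by rewrite -(P_coinner H psiL) (coinner_P0 H psiL).
Qed.

Lemma cosq_par b x : J (par b x) = par b (J x).
Proof.
apply: (coind H) => n; rewrite (P_par H) !P_cosq (P_par H) /= negbK.
by case: ifP => _; rewrite ?(lin0 JL).
Qed.

Lemma lin_cosq_test : lin K. Proof. by rewrite /cosq_test. Qed.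

Lemma cosq_testP x U (F : W -> W -> W -> U) : K x = 0 ->
  lin3l F -> lin3m F -> lin3r F ->
  \sw_(x1, u <- Delta x) \sw_(x2, x3 <- Delta u) F x1 (J x2) x3 = 0.
Proof.
move=> Kx F1 F2 F3.
have -> : \sw_(x1, u <- Delta x) \sw_(x2, x3 <- Delta u) F x1 (J x2) x3
    = tlift (K x) (fun x yz => \sw_(y, z <- yz) F x y z) by rewrite /cosq_test; swn.
by rewrite Kx sw0.
Qed.

Lemma cosq_test_iota a : K (iota a) = 0.
Proof.
rewrite /cosq_test; swn_l; rewrite -[RHS](sw_zero _ (cop a)); apply: eq_sw => a1 b.
rewrite -[RHS](sw_zero _ (cop b)); apply: eq_sw => a2 a3.
have -> : iota a2 = P 0 (iota a2) by rewrite (sx_P0 H) (sx_pi0_iota H).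
by rewrite cosq_P (lin0 (lin_tpurel _)) (lin0 (lin_tpurer _)).
Qed.

Lemma cosq_test_P n x : K x = 0 -> K (P n x) = 0.
Proof.
move=> Kx; rewrite /cosq_test (Delta_P H) sw_big // big1 // => p _; swn_l.
under eq_sw do rewrite (Delta_P H) sw_big //.
rewrite sw_sum big1 // => q _.
under eq_sw do rewrite sw_flat //.
under eq_sw do under eq_sw do rewrite swE // cosq_P.
case: (nat_of_ord q) => [|[|m]].
- rewrite -[RHS](sw_zero _ (Delta x)); apply: eq_sw => x1 x2.
  by rewrite -[RHS](sw_zero _ (Delta x2)); swx; rewrite (lin0 (lin_tpurel _)) (lin0 (lin_tpurer _)).
- rewrite -[RHS](sw_zero _ (Delta x)); apply: eq_sw => x1 x2.
  by rewrite -[RHS](sw_zero _ (Delta x2)); swx; rewrite (lin0 (lin_tpurel _)) (lin0 (lin_tpurer _)).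
by rewrite (cosq_testP (F := fun x y z => P p x ⊗ P m y ⊗ P (n - p - m.+2) z)).
Qed.

Lemma cosq_test_mul x y : K x = 0 -> K y = 0 -> K (mul x y) = 0.
Proof.
move=> Kx Ky.
(* The indices b and c are the parities of the first two legs of y; al and ga are the powers of
   [sg], with exponents b and b + c, that the Koszul signs put on the last two legs of x. *)
have key (al ga : W -> W) b c : lin al -> lin ga -> (forall z, J (al z) = al (J z)) ->
  \sw_(x1, x2 <- Delta x) \sw_(y1, y2 <- Delta y) \sw_(u1, u2 <- Delta x2)
    \sw_(z1, z2 <- Delta y2)
      (mul x1 (par b y1) ⊗ J (mul (al u1) (par c z1)) ⊗ mul (ga u2) z2) = 0.
  move=> alL gaL Jal.
  transitivity (\sw_(x1, x2 <- Delta x) \sw_(y1, y2 <- Delta y) \sw_(u1, u2 <- Delta x2)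
    \sw_(z1, z2 <- Delta y2)
      (mul x1 (par b y1) ⊗ mul (al (J u1)) (par c z1) ⊗ mul (ga u2) z2)
    + \sw_(x1, x2 <- Delta x) \sw_(y1, y2 <- Delta y) \sw_(u1, u2 <- Delta x2)
    \sw_(z1, z2 <- Delta y2)
      (mul x1 (par b y1) ⊗ mul (al u1) (par c (J z1)) ⊗ mul (ga u2) z2)).
    do 4!(rewrite -sw_add; swx).
    rewrite cosq_mul cosq_par Jal.
    by rewrite (linD (lin_tpurel _)) (linD (lin_tpurer _)).
  under [X in X + _]eq_sw do rewrite sw_exch.
  rewrite (cosq_testP (F := fun x1 u1 u2 => \sw_(y1, y2 <- Delta y) \sw_(z1, z2 <- Delta y2)
    (mul x1 (par b y1) ⊗ mul (al u1) (par c z1) ⊗ mul (ga u2) z2))) // add0r.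
  rewrite -[RHS](sw_zero _ (Delta x)); apply: eq_sw => x1 x2.
  rewrite sw_exch -[RHS](sw_zero _ (Delta x2)); apply: eq_sw => u1 u2.
  by rewrite (cosq_testP (F := fun y1 z1 z2 =>
    (mul x1 (par b y1) ⊗ mul (al u1) (par c z1) ⊗ mul (ga u2) z2))).
rewrite /cosq_test; swn_l.
have sgg : lin (fun z => sg (sg z)) by [].
rewrite (key id id false false) // (key id sg false true) // (key sg sg true false) //; last
  exact: cosq_sg.
rewrite (key sg (fun z => sg (sg z)) true true) //; last exact: cosq_sg.
by rewrite !addr0.
Qed.

(** i is a coderivation and commutes with its square, so [J] stays on the middle factor of all three
    terms. *)
Lemma cosq_test_coinner x : K x = 0 -> K (ii x) = 0.
Proof.
move=> Kx; rewrite /cosq_test; swn_l.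
have Jii z : J (ii z) = ii (J z) by [].
rewrite (cosq_testP (F := fun x y z => ii x ⊗ y ⊗ z)) // add0r.
under [X in _ + X]eq_sw do under eq_sw do rewrite cosq_sg.
rewrite (cosq_testP (F := fun x y z => sg x ⊗ sg y ⊗ ii z)) // addr0.
by rewrite (cosq_testP (F := fun x y z => sg x ⊗ ii y ⊗ z)).
Qed.

End Square.

Section SquareDiff.

Hypothesis H : shuffle_axioms o.
Variables (omt : A -> V) (dd : W -> W) (HD : diff_axioms o omt dd).
Variables (psi : V -> k) (psiL : scal psi).
Hypothesis psi_inv : forall v a, psi (v ◁ a) = cou a * psi v.

Local Notation J := (coinner_sq o psi).
Local Notation K := (cosq_test o psi).

Let JL : lin J. Proof. exact: lin_coinner_sq. Qed.
Let KL : lin K. Proof. exact: lin_cosq_test. Qed.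

(** With p a projection onto the kernel of [K], the tensor clauses of [ker_proj] ask that [K] vanish
    on either leg of Delta x. By coassociativity this [J] is an inner factor of a longer coproduct
    of x, where it vanishes. *)
Lemma cosq_test_sub : exists p : W -> W, [/\ lin p, forall x, K (p x) = 0,
  forall x, K x = 0 -> p x = x & forall x, K x = 0 -> tmap p p (Delta x) = Delta x].
Proof.
have [p [pL pK pid pl pr]] := ker_proj KL; exists p; split=> // x Kx.
have -> : tmap p p (Delta x) = tmap p id (tmap id p (Delta x)) by rewrite /tmap; swn.
rewrite pr; first rewrite pl //.
  rewrite /tmap /cosq_test; swn_l.
  rewrite (s_DeltaA H _ (F := fun a u z => \sw_(x2, x3 <- Delta u)
    ((a ⊗ J x2 ⊗ x3) ⊗ z))) //.
  under eq_sw => x1 x2.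
    rewrite (s_DeltaA H _ (F := fun u1 u2 z => (x1 ⊗ J u1 ⊗ u2) ⊗ z)) //.
    over.
  by rewrite (cosq_testP (F := fun x y z => \sw_(z1, z2 <- Delta z)
    ((x ⊗ y ⊗ z1) ⊗ z2))).
rewrite /tmap /cosq_test; swn_l.
rewrite -(s_DeltaA H _ (F := fun a b c => \sw_(x2, x3 <- Delta c) (a ⊗ (b ⊗ J x2 ⊗ x3)))) //.
under eq_sw do rewrite sw_exch.
by rewrite (cosq_testP (F := fun x y z => \sw_(x1, x2 <- Delta x)
  (x1 ⊗ (x2 ⊗ y ⊗ z)))).
Qed.

(** As the kernel of [K] is a subcoalgebra, the iterated coproduct of x lies in its third tensor
    power. *)
Lemma cosq_test_vanish x U (F : W -> W -> W -> U) (g : W -> W) :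
  K x = 0 -> lin g -> (forall z, K z = 0 -> g z = 0) ->
  lin3l F -> lin3m F -> lin3r F ->
  \sw_(x1, u <- Delta x) \sw_(x2, x3 <- Delta u) F x1 (g x2) x3 = 0.
Proof.
move=> Kx gL g0 F1 F2 F3; have [p [pL pK pid pD]] := cosq_test_sub.
rewrite -pD // /tmap; swn_l; rewrite -[RHS](sw_zero _ (Delta x)); apply: eq_sw => x1 u.
rewrite -pD // /tmap; swn_l; rewrite -[RHS](sw_zero _ (Delta (p u))); apply: eq_sw => x2 x3.
by rewrite g0 // (lin0 (F2 _ _)).
Qed.

Hypothesis tw0 : forall z, K z = 0 -> coinner o (psi_omt omt psi) z = 0.

(** d is a coderivation; where it meets [J] on the middle factor, [coinner2_d] leaves d J, killed by
    the test, and [coinner] for [psi_omt], killed by [cosq_test_vanish]. *)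
Lemma cosq_test_d x : K x = 0 -> K (dd x) = 0.
Proof.
move=> Kx; have twL := scal_psi_omt HD psiL; rewrite /cosq_test; swn_l.
rewrite (cosq_testP (F := fun x y z => dd x ⊗ y ⊗ z)) // add0r.
under [X in _ + X]eq_sw do under eq_sw do rewrite (cosq_sg H psiL).
rewrite (cosq_testP (F := fun x y z => sg x ⊗ sg y ⊗ dd z)) // addr0.
under eq_sw do under eq_sw do rewrite {1}/coinner_sq (coinner2_d H HD psiL psi_inv) -/(J _).
swn_l; rewrite (cosq_testP (F := fun x y z => sg x ⊗ dd y ⊗ z)) // add0r.
rewrite (cosq_test_vanish (F := fun x y z => sg x ⊗ y ⊗ z) (g := coinner o (psi_omt omt psi))) //.
by rewrite oppr0.
Qed.

End SquareDiff.

Section SquareRight.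

Hypothesis H : shuffle_axioms o.
Variables (psi : V -> k) (psiL : scal psi).
Hypothesis psi_inv : forall v a, psi (v ◁ a) = cou a * psi v.

Local Notation ii := (coinner o psi).
Local Notation J := (coinner_sq o psi).
Local Notation K := (cosq_test o psi).

Let iiL : lin ii. Proof. exact: lin_coinner. Qed.
Let JL : lin J. Proof. exact: lin_coinner_sq. Qed.

Let lL := lin_lconv H psiL.
Let rL := lin_rconv H psiL.
Let l x := lconv o psi (lconv o psi x).
Let r x := rconv o psi (rconv o psi x).

Lemma cosq_test_right x : K x = 0 -> \sw_(x1, x2 <- Delta x) (x1 ⊗ J x2) = 0.
Proof.
move=> Kx; rewrite -(cosq_testP Kx (F := fun x y z => cou (pi0 z) *: (x ⊗ y))) //.
by swx; rewrite (s_epsR H _ (F := fun y => _ ⊗ J y)).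
Qed.

Lemma cosq_test0 x : K x = 0 -> J x = 0.
Proof.
move=> /cosq_test_right e; rewrite -(s_epsL H x (F := J)) //.
by sw_by (congr1 (fun t => \sw_(x, y <- t) (cou (pi0 x) *: y)) e); rewrite sw0.
Qed.

(* Writing l and r for the left and right convolutions whose difference is J, the
   hypothesis moves r from one tensor factor to the next, as r x1 ⊗ x2 = x1 ⊗ l x2. *)
Lemma cosq_test_of_right x : \sw_(x1, x2 <- Delta x) (x1 ⊗ J x2) = 0 -> K x = 0.
Proof.
move=> Nx; have r2L : lin r := lin_comp rL rL; have l2L : lin l := lin_comp lL lL.
have JE y : J y = l y - r y by exact: (coinner2 H psiL).
have N0 U (F : W -> W -> U) : linl F ->
    linr F ->
    \sw_(x1, x2 <- Delta x) F x1 (l x2) = \sw_(x1, x2 <- Delta x) F x1 (r x2).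
  move=> F1 F2; apply/eqP; rewrite -subr_eq0 -sw_sub; apply/eqP.
  transitivity (tlift (\sw_(x1, x2 <- Delta x) (x1 ⊗ J x2)) F); last by rewrite Nx sw0.
  by swn_r; swx; rewrite JE (linD (F2 _)) (linN _ (F2 _)).
rewrite /cosq_test; under eq_sw do under eq_sw do rewrite JE.
transitivity (\sw_(x1, u <- Delta x) \sw_(x2, x3 <- Delta u) (x1 ⊗ l x2 ⊗ x3)
  - \sw_(x1, u <- Delta x) \sw_(x2, x3 <- Delta u) (x1 ⊗ r x2 ⊗ x3)).
  by rewrite -sw_sub; swx; rewrite -sw_sub; swx;
    rewrite (linD (lin_tpurel _)) (linN _ (lin_tpurel _)) (linD (lin_tpurer _)) (linN _
      (lin_tpurer _)).
apply/eqP; rewrite subr_eq0; apply/eqP.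
transitivity (\sw_(x1, u <- Delta x) \sw_(x2, x3 <- Delta u) (x1 ⊗ x2 ⊗ r x3)).
  transitivity (\sw_(x1, u <- Delta x) \sw_(x2, x3 <- Delta (l u)) (x1 ⊗ x2 ⊗ x3)).
    by swx; rewrite /l (s_Delta_lconv H psiL _ (F := fun x2 x3 => _ ⊗ x2 ⊗ x3)) // (s_Delta_lconv
      H psiL _ (F := fun x2 x3 => _ ⊗ lconv o psi x2 ⊗ x3)).
  rewrite (N0 _ (fun x1 u => \sw_(x2, x3 <- Delta u) (x1 ⊗ x2 ⊗ x3))) //.
  by swx; rewrite /r (s_Delta_rconv H psiL _ (F := fun x2 x3 => _ ⊗ x2 ⊗ x3)) // (s_Delta_rconv H
    psiL _ (F := fun x2 x3 => _ ⊗ x2 ⊗ rconv o psi x3)).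
rewrite -[RHS](s_DeltaA H x (F := fun x1 x2 x3 => x1 ⊗ r x2 ⊗ x3)) //.
rewrite -(s_DeltaA H x (F := fun x1 x2 x3 => x1 ⊗ x2 ⊗ r x3)) //.
rewrite -(N0 _ (fun x1 u => \sw_(x2, x3 <- Delta x1) (x2 ⊗ x3 ⊗ u))) //.
transitivity (\sw_(x1, x2 <- Delta x) \sw_(y1, y2 <- Delta (r x1)) (y1 ⊗ y2 ⊗ x2)).
  rewrite /r [RHS](s_rl_conv H psiL x (F := fun x1 x2 => \sw_(y1, y2 <- Delta (rconv o psi x1))
    (y1 ⊗ y2 ⊗ x2))) //.
  by rewrite (s_rl_conv H psiL x (F := fun x1 x2 => \sw_(y1, y2 <- Delta x1) (y1 ⊗ y2 ⊗ lconv o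
    psi x2))).
by swx; rewrite /r (s_Delta_rconv H psiL _ (F := fun x2 x3 => x2 ⊗ x3 ⊗ _)) // (s_Delta_rconv H
  psiL _ (F := fun x2 x3 => x2 ⊗ rconv o psi x3 ⊗ _)).
Qed.

End SquareRight.

(** * Restriction to a subspace *)

Section HomogeneousForms.

Hypothesis H : shuffle_axioms o.

Lemma sw_Delta_homog n x U (F : W -> W -> U) : P n x = x ->
  linl F -> linr F -> tlift (Delta x) F = \sum_(p < n.+1) \sw_(x1, x2 <- Delta x) F (P p x1) (P (n
    - p) x2).
Proof.
move=> nx F1 F2; rewrite -{1}nx (Delta_P H) sw_big //.
by apply: eq_bigr => p _; swn_l.
Qed.

Lemma sw_Delta_sg_homog n x U (F : W -> W -> U) : P n x = x ->
  linl F -> linr F -> \sw_(x1, x2 <- Delta x) F (sg x1) x2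
  = \sum_(p < n.+1) (-1) ^+ p *: \sw_(x1, x2 <- Delta x) F (P p x1) x2.
Proof.
move=> nx F1 F2; rewrite (sw_Delta_homog nx (F := fun x1 x2 => F (sg x1) x2)) //.
apply: eq_bigr => p _; rewrite [in RHS](sw_Delta_homog nx (F := fun x1 x2 => F (P p x1) x2)) //.
rewrite (bigD1 p) //= big1 ?addr0 => [|q /eqP qp].
  rewrite -sw_scale; swx.
  by rewrite (sg_P H) (P_P H) eqxx (linZ _ _ (F1 _)).
rewrite -[RHS](sw_zero _ (Delta x)); swx; rewrite (P_P H).
case: eqP => [pq|_]; last by rewrite (lin0 (F1 _)).
by case: qp; apply: val_inj.
Qed.

(** On homogeneous elements [par] and [sg] become the explicit Koszul sign that [super_hopf] asks
    for. *)
Lemma Delta_mul_homog m n x y : P m x = x -> P n y = y ->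
  Delta (mul x y) = \sum_(p < m.+1) \sum_(q < n.+1) (-1) ^+ ((m - p) * q) *:
    \sw_(x1, x2 <- Delta x) \sw_(y1, y2 <- Delta y)
      (mul (P p x1) (P q y1) ⊗ mul (P (m - p) x2) (P (n - q) y2)).
Proof.
move=> mx ny; rewrite -[LHS]sw_id (s_Delta_mul H) //.
rewrite (sw_Delta_homog mx (F := fun x1 x2 => \sw_(y1, y2 <- Delta y)
  (mul x1 (par false y1) ⊗ mul x2 y2 + mul x1 (par true y1) ⊗ mul (sg x2) y2))) //.
apply: eq_bigr => p _.
under eq_sw => x1 x2.
  rewrite (sw_Delta_homog ny (F := fun y1 y2 => mul (P p x1) (par false y1)
    ⊗ mul (P (m - p) x2) y2 + mul (P p x1) (par true y1) ⊗ mul (sg (P (m - p) x2)) y2)) //.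
  over.
rewrite sw_sum; apply: eq_bigr => q _; rewrite -sw_scale; swx; rewrite -sw_scale; swx.
rewrite !(par_P H) (sg_P H) (linZ _ _ (sx_mull H _)) (linZ _ _ (lin_tpurer _)).
rewrite mulnC exprM -(signr_odd _ q); case: (odd q) => /=.
  by rewrite expr1 (lin0 (sx_mulr H _)) (lin0 (lin_tpurel _)) add0r.
by rewrite expr0 expr1n scale1r (lin0 (sx_mulr H _)) (lin0 (lin_tpurel _)) scaler0 addr0.
Qed.

End HomogeneousForms.

Section SubExteriorAlgebra.

Hypothesis H : shuffle_axioms o.
Variables (omt : A -> V) (dd : W -> W) (HD : diff_axioms o omt dd).
Variables (psi : V -> k) (psiL : scal psi).
Hypothesis psi_inv : forall v a, psi (v ◁ a) = cou a * psi v.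
Variables (U : lmodType k) (inc : U -> W) (r : W -> U).
Hypotheses (incL : lin inc) (rL : lin r) (incK : cancel inc r).

Local Notation ii := (coinner o psi).
(** Membership in the image of [inc]. An operation f preserving it is transported to r o f o inc,
    and its identities follow from those in W by injectivity of [inc]. *)
Local Notation inU := (fun x => inc (r x) = x).

Hypothesis cl_iota : forall a, inU (iota a).
Hypothesis cl_P : forall n x, inU x -> inU (P n x).
Hypothesis cl_mul : forall x y, inU x -> inU y -> inU (mul x y).
Hypothesis cl_d : forall x, inU x -> inU (dd x).
Hypothesis cl_i : forall x, inU x -> inU (ii x).
Hypothesis cl_Delta : forall x, inU x ->
  tmap (fun x => inc (r x)) (fun x => inc (r x)) (Delta x) = Delta x.
Hypothesis i2 : forall x, inU x -> ii (ii x) = 0.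

Let iiL : lin ii. Proof. exact: lin_coinner. Qed.
Let inP x : inU (inc x). Proof. exact: (congr1 inc (incK x)). Qed.
Let inj : injective inc := can_inj incK.

Let Pu n x := r (P n (inc x)).
Let muu x y := r (mul (inc x) (inc y)).
Let Du x := tmap r r (Delta (inc x)).
Let epu x := cou (pi0 (inc x)).
Let du x := r (dd (inc x)).
Let iu x := r (ii (inc x)).
Let io a := r (iota a).

Let PuE n x : inc (Pu n x) = P n (inc x). Proof. exact/cl_P/inP. Qed.
Let muE x y : inc (muu x y) = mul (inc x) (inc y). Proof. by apply: cl_mul; exact: inP. Qed.
Let duE x : inc (du x) = dd (inc x). Proof. exact/cl_d/inP. Qed.
Let iuE x : inc (iu x) = ii (inc x). Proof. exact/cl_i/inP. Qed.
Let ioE a : inc (io a) = iota a. Proof. exact: cl_iota. Qed.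
Let DuE x : tmap inc inc (Du x) = Delta (inc x).
Proof. by rewrite /Du -[RHS](cl_Delta (inP x)) /tmap; swn. Qed.

Let PuL n : lin (Pu n). Proof. by rewrite /Pu. Qed.
Let muLl y : lin (fun x => muu x y). Proof. by rewrite /muu. Qed.
Let muLr x : lin (fun y => muu x y). Proof. by rewrite /muu. Qed.
Let DuL : lin Du. Proof. by rewrite /Du /tmap. Qed.
Let epL : scal epu. Proof. by rewrite /epu. Qed.
Let duL : lin du. Proof. by rewrite /du. Qed.
Let iuL : lin iu. Proof. by rewrite /iu. Qed.
Let ioL : lin io. Proof. by rewrite /io. Qed.

Let sw_Du x (Z : lmodType k) (F : W -> W -> Z) :
  linl F -> linr F -> \sw_(x1, x2 <- Du x) F (inc x1) (inc x2) = tlift (Delta (inc x)) F.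
Proof. by move=> F1 F2; rewrite -DuE; swn_r. Qed.

(** The retraction passes to tensor powers, so [inc] remains injective there. *)
Let inj2 (X Y : (U ⊗ U)%type) : tmap inc inc X = tmap inc inc Y -> X = Y.
Proof.
have can2 t : tmap r r (tmap inc inc t) = t.
  by rewrite -[RHS]sw_id /tmap; swn; swx; rewrite !incK.
by move=> e; rewrite -(can2 X) e can2.
Qed.

Let inj3 (X Y : (U ⊗ U ⊗ U)%type) :
  tmap inc (tmap inc inc) X = tmap inc (tmap inc inc) Y -> X = Y.
Proof.
have can3 t : tmap r (tmap r r) (tmap inc (tmap inc inc) t) = t.
  rewrite -[RHS]sw_id /tmap; swn_l; apply: eq_sw => x y.
  rewrite -[in RHS](sw_id y); swn_r; swx.
  by rewrite !incK.
by move=> e; rewrite -(can3 X) e can3.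
Qed.

Let DuA x : \sw_(x1, x2 <- Du x) \sw_(x11, x12 <- Du x1) (x11 ⊗ x12 ⊗ x2)
  = \sw_(x1, x2 <- Du x) \sw_(x21, x22 <- Du x2) (x1 ⊗ x21 ⊗ x22).
Proof.
apply: inj3; rewrite /tmap; swn.
under eq_sw => x1 x2.
  rewrite (sw_Du _ (F := fun a b => a ⊗ b ⊗ inc x2)) //.
  over.
rewrite (sw_Du _ (F := fun c d => \sw_(a, b <- Delta c) (a ⊗ b ⊗ d))) //.
under [RHS]eq_sw => x1 x2.
  rewrite (sw_Du _ (F := fun a b => inc x1 ⊗ a ⊗ b)) //.
  over.
rewrite (sw_Du _ (F := fun c d => \sw_(a, b <- Delta d) (c ⊗ a ⊗ b))) //.
by rewrite (s_DeltaA H _ (F := fun a b c => a ⊗ b ⊗ c)).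
Qed.

Let cuL x : \sw_(x1, x2 <- Du x) (epu x1 *: x2) = x.
Proof.
apply: inj; swn_l; rewrite (sw_Du _ (F := fun a b => cou (pi0 a) *: b)) //.
exact: (s_epsL H _ (F := fun x => x)).
Qed.

Let cuR x : \sw_(x1, x2 <- Du x) (epu x2 *: x1) = x.
Proof.
apply: inj; swn_l; rewrite (sw_Du _ (F := fun a b => cou (pi0 b) *: a)) //.
exact: (s_epsR H _ (F := fun x => x)).
Qed.

Let PuK m n x : Pu m (Pu n x) = if m == n then Pu n x else 0.
Proof.
apply: inj; rewrite !PuE (P_P H); case: ifP => _; first by rewrite PuE.
by rewrite (lin0 incL).
Qed.

Let Pu_sum x : exists N, x = \sum_(n < N) Pu n x.
Proof.
have [N hN] := sx_Psum H (inc x); exists N; apply: inj.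
by rewrite {1}(hN _ (leqnn N)) lin_sum //; apply: eq_bigr => n _; rewrite PuE.
Qed.

Let homogE n x : Pu n x = x <-> P n (inc x) = inc x.
Proof. by split=> [e|e]; [rewrite -PuE e | apply: inj; rewrite PuE]. Qed.

Let muP m n x y : Pu m x = x -> Pu n y = y -> Pu (m + n) (muu x y) = muu x y.
Proof.
move=> /homogE mx /homogE ny; apply/homogE; rewrite muE -mx -ny.
exact: mul_P.
Qed.

Let muA : associative muu.
Proof. by move=> x y z; apply: inj; rewrite !muE (s_mulA H). Qed.
Let mu1x : left_id (io 1) muu.
Proof. by move=> x; apply: inj; rewrite !muE ioE (s_mul1x H). Qed.
Let mux1 : right_id (io 1) muu.
Proof. by move=> x; apply: inj; rewrite !muE ioE (s_mulx1 H). Qed.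

Let iotaP a : P 0 (iota a) = iota a.
Proof. by rewrite (sx_P0 H) (sx_pi0_iota H). Qed.

Let ioP a : Pu 0 (io a) = io a.
Proof. by apply: inj; rewrite PuE ioE iotaP. Qed.

Let epP n x : epu (Pu n.+1 x) = 0.
Proof. by rewrite /epu PuE (pi0_P H) linear0. Qed.

Let DuP n x : Pu n x = x -> Du x = \sum_(p < n.+1) tmap (Pu p) (Pu (n - p)) (Du x).
Proof.
move=> /homogE nx; apply: inj2; rewrite DuE -[LHS]sw_id (sw_Delta_homog H nx) //.
rewrite lin_sum; last by rewrite /tmap.
apply: eq_bigr => p _; rewrite /tmap; swn_r.
under [RHS]eq_sw do rewrite !PuE.
by rewrite (sw_Du _ (F := fun a b => P p a ⊗ P (n - p) b)).
Qed.

(** In degree 0 the antipode is that of A, and [graded_antipode] extends it to all degrees. *)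
Let S0 x := io (ant (pi0 (inc x))).
Let S0L : lin S0. Proof. by rewrite /S0. Qed.

Let homog0E x : Pu 0 x = x -> inc x = iota (pi0 (inc x)).
Proof. by move=> /homogE; rewrite (sx_P0 H). Qed.

Let S0l x : Pu 0 x = x -> \sw_(x1, x2 <- Du x) muu (S0 x1) x2 = epu x *: io 1.
Proof.
move=> /homog0E ex; apply: inj; rewrite (linZ _ _ incL) ioE /epu; swn_l.
under eq_sw do rewrite muE ioE.
rewrite (sw_Du _ (F := fun a b => mul (iota (ant (pi0 a))) b)) //.
rewrite ex (s_Delta_iota H) // !(sx_pi0_iota H).
under eq_sw do rewrite (sx_pi0_iota H) (s_mul_iota H).
by rewrite (sw_antL _ iota).
Qed.

Let S0r x : Pu 0 x = x -> \sw_(x1, x2 <- Du x) muu x1 (S0 x2) = epu x *: io 1.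
Proof.
move=> /homog0E ex; apply: inj; rewrite (linZ _ _ incL) ioE /epu; swn_l.
under eq_sw do rewrite muE ioE.
rewrite (sw_Du _ (F := fun a b => mul a (iota (ant (pi0 b))))) //.
rewrite ex (s_Delta_iota H) // !(sx_pi0_iota H).
under eq_sw do rewrite (sx_pi0_iota H) (s_mul_iota H).
by rewrite (sw_antR _ iota).
Qed.

Let sub_antipode : exists S : U -> U, [/\ lin S,
  forall n x, Pu n x = x -> Pu n (S x) = S x,
  forall x, Pu 0 x = x -> S x = S0 x,
  forall x, \sw_(x1, x2 <- Du x) muu (S x1) x2 = epu x *: io 1
  & forall x, \sw_(x1, x2 <- Du x) muu x1 (S x2) = epu x *: io 1].
Proof.
apply: (graded_antipode (P := Pu)) => // [n x|x].
  by apply: DuP; rewrite PuK eqxx.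
by move=> _; exact: ioP.
Qed.

Let grU : grading U.
Proof.
exact: (@Grading k U (fun n => lin_pack (PuL n)) PuK Pu_sum).
Defined.

(** The structure is opaque, since its antipode is only known to exist; the recorded equations let
    the remaining fields be proved for the given operations. *)
Let shU : {sh : super_hopf U | [/\ sgr sh = grU, smul sh = muu, sone sh = io 1 &
  [/\ scop sh = lin_pack DuL, scou sh = scal_pack epL & forall a, sant sh (io a) = io (ant a)]]}.
Proof.
have [S SP] := cid sub_antipode; have [SL SP1 SP2 SP3 SP4] := SP.
unshelve eexists (@SuperHopf k U grU muu (io 1) (lin_pack DuL) (scal_pack epL) (lin_pack SL)
  _ muA mu1x mux1 muP (ioP 1) DuA cuL cuR DuP _ _ _ _ _ SP1 SP3 SP4).
- by split.
- by move=> n x <-; exact: epP.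
- by apply: inj2; rewrite DuE ioE -[LHS]sw_id (s_Delta_iota H) // sw_cop1 // tmapE // ioE.
- move=> m n x y /= mx ny; apply: inj2; rewrite DuE muE.
  rewrite (Delta_mul_homog H ((homogE _ _).1 mx) ((homogE _ _).1 ny)).
  have tL : lin (tmap inc inc) by rewrite /tmap.
  rewrite (lin_sum _ _ _ tL); apply: eq_bigr => p _.
  rewrite (lin_sum _ _ _ tL); apply: eq_bigr => q _.
  rewrite (linZ _ _ tL); congr (_ *: _).
  transitivity (tmap inc inc (\sw_(x1, x2 <- Du x) \sw_(y1, y2 <- Du y)
    (muu (Pu p x1) (Pu q y1) ⊗ muu (Pu (m - p) x2) (Pu (n - q) y2)))); last by [].
  rewrite /tmap; swn_r.
  under [RHS]eq_sw do under eq_sw do rewrite !muE !PuE.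
  under [RHS]eq_sw => x1 x2.
    rewrite (sw_Du _ (F := fun a b => mul (P p (inc x1)) (P q a)
      ⊗ mul (P (m - p) (inc x2)) (P (n - q) b))) //.
    over.
  by rewrite (sw_Du _ (F := fun c d => \sw_(a, b <- Delta (inc y))
    (mul (P p c) (P q a) ⊗ mul (P (m - p) d) (P (n - q) b)))).
- by change (epu (io 1) = 1); rewrite /epu ioE (sx_pi0_iota H) cou1.
- by move=> x y; change (epu (muu x y) = epu x * epu y); rewrite /epu muE (s_pi0_mul H) couM.
split=> //; split=> // a; change (S (io a) = io (ant a)).
by rewrite SP2 ?ioP // /S0 ioE (sx_pi0_iota H).
Qed.

Lemma sub_exterior_algebra : exists E : aug_ext_algebra A U,
  [/\ forall a, inc (ext_inj E a) = iota a, forall n x, inc (gproj E n x) = P n (inc x),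
      forall x y, inc (smul E x y) = mul (inc x) (inc y), inc (sone E) = iota 1 &
  [/\ forall x, tmap inc inc (scop E x) = Delta (inc x), forall x, scou E x = cou (pi0 (inc x)),
      forall x, inc (ext_codiff E x) = ii (inc x) & forall x, inc (ext_diff E x) = dd (inc x)]].
Proof.
have [sh [gE mE oE [DE eE aE]]] := shU.
have hE n x : homog sh n x -> P n (inc x) = inc x.
  by rewrite /homog gE => h; apply/homogE.
have hE' n x : P n (inc x) = inc x -> homog sh n x.
  by move=> h; rewrite /homog gE; apply/homogE.
have gPE n x : gproj sh n x = Pu n x by rewrite gE.
have der (f : W -> W) (fu : U -> U) : lin f -> (forall x, inc (fu x) = f (inc x)) ->
    (forall x y, f (mul x y) = mul (f x) y + mul (sg x) (f y)) -> super_derivation sh fu.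
  move=> fL fE fM n x y /hE h; rewrite mE; apply: inj.
  rewrite fE (linD incL) (linZ _ _ incL) !muE !fE fM; congr (_ + _).
  by rewrite -{1}h (sg_P H) (linZ _ _ (sx_mull H _)) h.
have coder (f : W -> W) (fu : U -> U) : lin f -> lin fu -> (forall x, inc (fu x) = f (inc x)) ->
    (forall x, Delta (f x) = \sw_(x1, x2 <- Delta x) (f x1 ⊗ x2 + sg x1 ⊗ f x2)) ->
    super_coderivation sh fu.
  move=> fL fuL fE fD n x /hE h; rewrite DE; apply: inj2.
  transitivity (tmap inc inc (\sw_(x1, x2 <- Du x) (fu x1 ⊗ x2)
    + \sum_(p < n.+1) (-1) ^+ p *: \sw_(x1, x2 <- Du x) (Pu p x1 ⊗ fu x2))); last first.
    congr (tmap _ _ (_ + _)); apply: eq_bigr => p _; congr (_ *: _).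
    by swx; rewrite gPE.
  transitivity (tmap inc inc (Du (fu x))); first by [].
  have tL : lin (tmap inc inc) by rewrite /tmap.
  rewrite DuE fE fD sw_add (linD tL); congr (_ + _).
    rewrite /tmap; swn_r; under [RHS]eq_sw do rewrite fE.
    by rewrite (sw_Du _ (F := fun a b => f a ⊗ b)).
  rewrite (sw_Delta_sg_homog H h (F := fun a b => a ⊗ f b)) //.
  rewrite (lin_sum _ _ _ tL); apply: eq_bigr => p _; rewrite (linZ _ _ tL); congr (_ *: _).
  rewrite /tmap; swn_r; under [RHS]eq_sw do rewrite PuE fE.
  by rewrite (sw_Du _ (F := fun a b => P p a ⊗ f b)).
have H1 : injective io.
  move=> a b /(congr1 inc); rewrite !ioE => /(congr1 pi0).
  by rewrite !(sx_pi0_iota H).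
have H2 x : homog sh 0 x <-> exists a, x = io a.
  split=> [/hE h|[a ->]]; last by apply: hE'; rewrite ioE iotaP.
  by exists (pi0 (inc x)); apply: inj; rewrite ioE -[LHS]h (sx_P0 H).
have H3 : io 1 = sone sh by rewrite oE.
have H4 a b : io (a * b) = smul sh (io a) (io b).
  by rewrite mE; apply: inj; rewrite muE !ioE (s_mul_iota H).
have H5 a : scop sh (io a) = tmap io io (cop a).
  rewrite DE; apply: inj2; transitivity (tmap inc inc (Du (io a))); first by [].
  rewrite DuE ioE -[LHS]sw_id (s_Delta_iota H) // /tmap; swn; swx.
  by rewrite !ioE.
have H6 a : scou sh (io a) = cou a.
  by rewrite eE; transitivity (epu (io a)); rewrite // /epu ioE (sx_pi0_iota H).
have H7 n x : homog sh n x -> homog sh n.+1 (du x).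
  by move=> /hE h; apply: hE'; rewrite duE (P_d H HD) h.
have H8 x : du (du x) = 0.
  by apply: inj; rewrite !duE (s_d2 H HD) (lin0 incL).
have H9 : super_derivation sh du.
  by apply: der duE _ => //; exact: (s_d_mul H HD).
have H10 : super_coderivation sh du.
  apply: coder duE _ => // x; rewrite -[LHS]sw_id (s_Delta_d H HD) //.
have H11 x : homog sh 0 x -> iu x = 0.
  move=> /hE h; apply: inj; rewrite iuE -h (coinner_P0 H psiL) (lin0 incL) //.
have H12 n x : homog sh n.+1 x -> homog sh n (iu x).
  by move=> /hE h; apply: hE'; rewrite iuE -{1}h (P_coinner H psiL) (P_P H) eqxx h.
have H13 x : iu (iu x) = 0.
  by apply: inj; rewrite !iuE i2 ?(lin0 incL) //; exact: inP.
have H14 : super_derivation sh iu.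
  by apply: der iuE _ => //; exact: (coinner_mul H psiL psi_inv).
have H15 : super_coderivation sh iu.
  apply: coder iuE _ => // x; rewrite -[LHS]sw_id (s_Delta_coinner H psiL) //.
exists (@AugExtAlgebra k A U sh (lin_pack ioL) (lin_pack duL) (lin_pack iuL)
  H1 H2 H3 H4 H5 H6 aE H7 H8 H9 H10 H11 H12 H13 H14 H15).
split; first exact: ioE.
- by move=> n x; rewrite -PuE -gPE.
- by move=> x y; rewrite -muE -mE.
- by rewrite -ioE H3.
split; [| |exact: iuE|exact: duE].
- by move=> x; rewrite -DuE; congr (tmap _ _ _); rewrite /= DE.
- by move=> x; rewrite /= eE.
Qed.

End SubExteriorAlgebra.

End ShuffleTheory.

(** * The braided shuffle product on words *)

Section Words.

Variables (k : fieldType) (V : lmodType k).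
Implicit Types (U : lmodType k) (s : seq V).

Lemma lin_wlift U (f : seq V -> U) : multilin f -> lin (fun t => wlift t f).
Proof. exact: wlift_linear. Qed.

Lemma lin_word s1 s2 : lin (fun v : V => word (s1 ++ v :: s2)).
Proof. exact: word_multilin. Qed.

Lemma lin_word1 : lin (fun v : V => word [:: v]).
Proof. exact: (lin_word [::] [::]). Qed.

Lemma talg_ext U (f g : talg V -> U) : lin f -> lin g ->
  (forall s, f (word s) = g (word s)) -> forall t, f t = g t.
Proof.
move=> lf lg e t; have [s ->] := talg_span t.
by rewrite !lin_sum //; apply: eq_bigr => p _; rewrite !linZ // e.
Qed.

Lemma wlift_ext U (f g : seq V -> U) t : (forall s, f s = g s) -> wlift t f = wlift t g.
Proof. by move=> e; congr (wlift t _); apply/funext. Qed.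

Lemma lin_tcatl t' : lin (fun t : talg V => tcat t t'). Proof. exact: (tcat_bilin V).1. Qed.
Lemma lin_tcatr t : lin (fun t' : talg V => tcat t t'). Proof. exact: (tcat_bilin V).2. Qed.

Lemma tcat_word s s' : tcat (word s) (word s') = word (s ++ s').
Proof.
rewrite /tcat wlift_word => [|s1 s2 c v v'].
  by rewrite wlift_word // => s1 s2 c v v'; rewrite !catA word_multilin.
apply: (@wlift_param _ _ _ _ (fun v s' => word ((s1 ++ v :: s2) ++ s'))) => s0 d u u'.
by rewrite -!catA /= word_multilin.
Qed.

End Words.

Ltac lin_letter :=
  match goal with
  | |- lin (fun x => word (cons (@?g x) nil)) =>
      apply (@lin_comp _ _ _ _ (fun v => word [:: v]) g); [apply lin_word1 | lin_tac]
  end.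

Ltac lin_talg :=
  lazymatch goal with
  | |- lin (fun x => word _) => first [lin_letter | apply lin_word1]
  | |- lin (fun x => tcat x _) => apply lin_tcatl
  | |- lin (fun x => tcat _ x) => apply lin_tcatr
  | |- lin (fun x => tproj _ x) => apply tproj_linear
  | |- lin (fun x => decon x) => apply decon_linear
  end.
Ltac lin_atom ::= lin_talg.

Section WordOps.

Variables (k : fieldType) (V : lmodType k).
Implicit Types (U : lmodType k) (s : seq V).

Lemma tcatA (t t' t'' : talg V) : tcat (tcat t t') t'' = tcat t (tcat t' t'').
Proof.
move: t; apply: talg_ext => // s; move: t'; apply: talg_ext => // s'.
by move: t''; apply: talg_ext => // s''; rewrite !tcat_word catA.
Qed.

Lemma tcat1t (t : talg V) : tcat (word [::]) t = t.
Proof. by move: t; apply: talg_ext => // s; rewrite tcat_word. Qed.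

Lemma tcatt1 (t : talg V) : tcat t (word [::]) = t.
Proof. by move: t; apply: talg_ext => // s; rewrite tcat_word cats0. Qed.

Lemma word_rcons s v : word (rcons s v) = tcat (word s) (word [:: v]).
Proof. by rewrite tcat_word cats1. Qed.

Lemma multilin_last U (f : seq V -> U) (g : seq V -> V -> U) :
  (forall s v, f (rcons s v) = g s v) -> (forall v, multilin (g^~ v)) ->
  (forall s, lin (g s)) -> multilin f.
Proof.
move=> fg gl gr s1 s2; case/lastP: s2 => [|s2 v] c x y.
  by rewrite !cats1 !fg gr.
by rewrite -!rcons_cons -!rcons_cat !fg gl.
Qed.

Lemma multilin_cons U (f : seq V -> U) (g : V -> seq V -> U) :
  (forall v s, f (v :: s) = g v s) -> (forall v, multilin (g v)) ->
  (forall s, lin (g^~ s)) -> multilin f.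
Proof.
move=> fg gl gr [|u s1] s2 c x y /=; first by rewrite !fg gr.
by rewrite !fg gl.
Qed.

Definition lamt (t : talg V) : (talg V ⊗ V)%type :=
  \word_(s <- t) (if s is v :: s' then word (belast v s') ⊗ last v s' else 0).

Let lamw_rcons s v : (if rcons s v is u :: s' then word (belast u s') ⊗ last u s' else 0)
  = word s ⊗ v.
Proof. by case: s => [|u s] //=; rewrite belast_rcons last_rcons. Qed.

Let lamw_multilin :
  multilin (fun s => if s is u :: s' then word (belast u s') ⊗ last u s' else 0).
Proof.
apply: multilin_last lamw_rcons _ _ => [v s1 s2|s] //.
exact: (lin_comp (lin_tpurel _) (lin_word _ _)).
Qed.

Lemma lin_lamt : lin lamt. Proof. exact: lin_wlift lamw_multilin. Qed.

Lemma lamt_rcons s v : lamt (word (rcons s v)) = word s ⊗ v.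
Proof. by rewrite /lamt wlift_word ?lamw_rcons. Qed.

Lemma lamt1 : lamt (word [::]) = 0.
Proof. by rewrite /lamt wlift_word. Qed.

Definition sgt (t : talg V) : talg V := \word_(s <- t) ((-1) ^+ size s *: word s).

Let sgw_multilin : multilin (fun s => (-1) ^+ size s *: word s).
Proof. by move=> s1 s2 c x y; rewrite !size_cat /= word_multilin scalerDr !scalerA [_ * c]mulrC.
  Qed.

Lemma lin_sgt : lin sgt. Proof. exact: lin_wlift sgw_multilin. Qed.
Lemma sgt_word s : sgt (word s) = (-1) ^+ size s *: word s.
Proof. by rewrite /sgt wlift_word. Qed.

Definition part (b : bool) (t : talg V) : talg V :=
  \word_(s <- t) (if odd (size s) == b then word s else 0).

Let parw_multilin b : multilin (fun s => if odd (size s) == b then word s else 0).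
Proof.
move=> s1 s2 c x y; rewrite !size_cat /=.
by case: ifP => _; rewrite ?word_multilin // scaler0 addr0.
Qed.

Lemma lin_part b : lin (part b). Proof. exact: lin_wlift (parw_multilin b). Qed.
Lemma part_word b s : part b (word s) = if odd (size s) == b then word s else 0.
Proof. by rewrite /part wlift_word. Qed.

Lemma tproj_word n s : tproj n (word s) = if size s == n then word s else 0.
Proof.
rewrite /tproj wlift_word // => s1 s2 c v v'; rewrite !size_cat /=.
by case: ifP => _; rewrite ?word_multilin // scaler0 addr0.
Qed.

Let tcou_multilin : @multilin k V k^o (fun s => if s is [::] then 1 else 0).
Proof. by move=> [|u s1] s2 c x y /=; rewrite scaler0 addr0. Qed.

Lemma scal_tcou : scal (@tcou k V). Proof. exact: (lin_wlift tcou_multilin). Qed.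
Lemma tcou_word s : tcou (word s) = if s is [::] then 1 else 0.
Proof. exact: (wlift_word _ tcou_multilin). Qed.
Lemma tcou_rcons s v : tcou (word (rcons s v)) = 0.
Proof. by rewrite tcou_word; case: s. Qed.

Let deconw_multilin :
  multilin (fun s => \sum_(i < (size s).+1) word (take i s) ⊗ word (drop i s)).
Proof.
move=> s1 s2 c v v'.
rewrite !size_cat /= scaler_sumr -big_split /=; apply: eq_bigr => i _.
rewrite !take_cat !drop_cat; case: ltnP => hi.
  by rewrite word_multilin (lin_tpurer _ _).
case: (_ - _)%N => [|j] /=; first by rewrite (word_multilin [::]) (lin_tpurer _ _).
by rewrite word_multilin (lin_tpurel _ _).
Qed.

Lemma decon_word s :
  decon (word s) = \sum_(i < (size s).+1) word (take i s) ⊗ word (drop i s).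
Proof. exact: wlift_word deconw_multilin. Qed.

Lemma decon1 : decon (word [::]) = word [::] ⊗ word [::] :> (talg V ⊗ talg V)%type.
Proof. by rewrite decon_word big_ord_recl big_ord0 addr0. Qed.

Lemma decon_rcons s v : decon (word (rcons s v))
  = \sw_(e1, e2 <- decon (word s)) (e1 ⊗ tcat e2 (word [:: v])) + word (rcons s v) ⊗ word [::].
Proof.
rewrite !decon_word size_rcons big_ord_recr /=.
have -> : take (size s).+1 (rcons s v) = rcons s v by rewrite -(size_rcons s v) take_size.
have -> : drop (size s).+1 (rcons s v) = [::] by rewrite -(size_rcons s v) drop_size.
congr (_ + _).
rewrite sw_big //; apply: eq_bigr => i _.
have le : (i <= size s)%N by rewrite -ltnS.
rewrite swE // tcat_word cats1 drop_rcons //.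
by have -> : take i (rcons s v) = take i s by rewrite -cats1 takel_cat.
Qed.

End WordOps.

Ltac lin_talg ::=
  lazymatch goal with
  | |- lin (fun x => word _) => first [lin_letter | apply lin_word1]
  | |- lin (fun x => tcat x _) => apply lin_tcatl
  | |- lin (fun x => tcat _ x) => apply lin_tcatr
  | |- lin (fun x => tproj _ x) => apply tproj_linear
  | |- lin (fun x => decon x) => apply decon_linear
  | |- lin (fun x => lamt x) => apply lin_lamt
  | |- lin (fun x => sgt x) => apply lin_sgt
  | |- lin (fun x => part _ x) => apply lin_part
  end.
Ltac scal_atom ::= apply scal_tcou.

Ltac sw_rule ::= sw_hopf.

(** * Action and coaction on words *)

Section CrossedWords.

Variables (k : fieldType) (A : hopf_algebra k) (V : crossed_module A).
Implicit Types (U : lmodType k) (s : seq V).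

Lemma lin_tcoact : lin (@tcoact k A V). Proof. exact: tcoact_linear. Qed.

Lemma tcoact_word s : tcoact (word s) = word_coact s.
Proof. exact: wlift_word (@word_coact_multilin k A V). Qed.

Lemma sw_word_coact_cat s s' U (F : talg V -> A -> U) :
  linl F -> linr F -> tlift (word_coact (s ++ s')) F
  = \sw_(t0, t1 <- word_coact s) \sw_(u0, u1 <- word_coact s') F (tcat t0 u0) (t1 * u1).
Proof.
elim: s F => [|v s IH] F F1 F2 /=.
  by rewrite swE //; apply: eq_sw => x a; rewrite tcat1t mul1r.
swn; apply: eq_sw => v0 v1.
rewrite (IH (fun x a => F (tcat (word [:: v0]) x) (v1 * a))) //.
by swx; swx; rewrite tcatA mulrA.
Qed.

Lemma sw_tcoact_rcons s v U (F : talg V -> A -> U) :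
  linl F -> linr F -> tlift (tcoact (word (rcons s v))) F
  = \sw_(t0, t1 <- tcoact (word s)) \sw_(v0, v1 <- coact v)
      F (tcat t0 (word [:: v0])) (t1 * v1).
Proof.
move=> F1 F2; rewrite !tcoact_word -cats1 sw_word_coact_cat // /=.
by swx; swn_l; swx; rewrite tcatt1 mulr1.
Qed.

Lemma sw_tcoact1 U (F : talg V -> A -> U) :
  linl F -> linr F -> tlift (tcoact (word [::])) F = F (word [::]) 1.
Proof. by move=> F1 F2; rewrite tcoact_word swE. Qed.

Lemma lin_word_act s : lin (fun a : A => word_act s a).
Proof. by elim: s => [|v s IH] /=. Qed.

Lemma word_act_multilin a : multilin (fun s : seq V => word_act s a).
Proof.
move=> s1; elim: s1 a => [|u s1 IH] a s2 /=.
  by apply: (@lin_tliftr _ _ _ _ _ _ (fun x a1 a2 => tcat (word [:: x ◁ a1]) (word_act s2 a2))).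
apply: (@lin_tliftr _ _ _ _ _ _ (fun x a1 a2 =>
  tcat (word [:: u ◁ a1]) (word_act (s1 ++ x :: s2) a2))) => a1 a2.
exact: (lin_comp (lin_tcatr _) (IH a2 s2)).
Qed.

Lemma tact_word s a : tact (word s) a = word_act s a.
Proof. exact: wlift_word (word_act_multilin a). Qed.

Lemma lin_tactl a : lin (fun t : talg V => tact t a).
Proof. exact: lin_wlift (word_act_multilin a). Qed.

Lemma lin_tactr (t : talg V) : lin (fun a : A => tact t a).
Proof. by apply: wlift_param => s; exact: lin_word_act. Qed.

Lemma word_act_cat s s' a : word_act (s ++ s') a
  = \sw_(a1, a2 <- cop a) tcat (word_act s a1) (word_act s' a2).
Proof.
have L := lin_word_act; elim: s a => [|v s IH] a /=.
  rewrite -[LHS](sw_couL a) //; swx.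
  by rewrite (linZ _ _ (lin_tcatl _)) tcat1t.
under eq_sw do rewrite IH.
swn; rewrite -(sw_copA _ (F := fun x y z => tcat (word [:: v ◁ x])
  (tcat (word_act s y) (word_act s' z)))) //.
by swx; swx; rewrite tcatA.
Qed.

Lemma tact_rcons s v a : tact (word (rcons s v)) a
  = \sw_(a1, a2 <- cop a) tcat (tact (word s) a1) (word [:: v ◁ a2]).
Proof.
rewrite tact_word -cats1 word_act_cat; apply: eq_sw => a1 a2.
rewrite tact_word /= -[in RHS](sw_couR a2 (F := fun a => word [:: v ◁ a])) //.
by congr tcat; swx; rewrite (linZ _ _ (lin_tcatr _)) tcatt1.
Qed.

Lemma tact1 a : tact (word [::] : talg V) a = cou a *: word [::].
Proof. by rewrite tact_word. Qed.

Lemma word_coact_homog s U (F : talg V -> A -> U) :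
  linl F -> linr F -> tlift (word_coact s) F = \sw_(t0, t1 <- word_coact s) F (tproj (size s) t0)
    t1.
Proof.
elim: s F => [|v s IH] F F1 F2 /=; first by rewrite !swE // tproj_word.
swn; apply: eq_sw => v0 v1.
rewrite (IH (fun x a => F (tcat (word [:: v0]) x) (v1 * a))) //; apply: eq_sw => t0 t1.
congr (F _ _); move: t0; apply: talg_ext => // s'.
by rewrite tcat_word !tproj_word /= eqSS; case: ifP => _; rewrite ?tcat_word // (lin0 (lin_tcatr
  _)).
Qed.

(** The coaction preserves the length, so words as long as s suffice. This lets signs depending on
    the length move under the coaction. *)
Lemma word_coact_ext s U (F G : talg V -> A -> U) :
  linl F -> linr F -> linl G -> linr G ->
  (forall s' a, size s' = size s -> F (word s') a = G (word s') a) ->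
  tlift (word_coact s) F = tlift (word_coact s) G.
Proof.
move=> F1 F2 G1 G2 e; rewrite word_coact_homog // [RHS]word_coact_homog //.
apply: eq_sw => t a; move: t; apply: talg_ext => // s'; rewrite tproj_word.
by case: eqP => [/e //|_]; rewrite (lin0 (F1 _)) (lin0 (G1 _)).
Qed.

End CrossedWords.

Ltac lin_cross :=
  lazymatch goal with
  | |- lin (fun x => tcoact x) => apply lin_tcoact
  | |- lin (fun x => tact x _) => apply lin_tactl
  | |- lin (fun x => tact _ x) => apply lin_tactr
  | |- _ => lin_talg
  end.
Ltac lin_atom ::= lin_cross.

(** * Braid operators and braided binomials *)

Section Braid.

Variables (k : fieldType) (A : hopf_algebra k) (V : crossed_module A).
Implicit Types (U : lmodType k) (s : seq V).

(** [braid] on words with positions counted from 0, so that an induction on j strips first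
    letters. *)
Let bw j s : talg V :=
  if drop j s is v :: w :: s2 then
    \sw_(w0, w1 <- coact w) word (take j s ++ [:: w0, v ◁ w1 & s2])
  else word s.

Let bw_cons j u s : bw j.+1 (u :: s) = tcat (word [:: u]) (bw j s).
Proof.
rewrite /bw /=; case: (drop j s) => [|v [|w s2]]; rewrite ?tcat_word //.
by swn_r; swx; rewrite tcat_word.
Qed.

Let bw_multilin j : multilin (bw j).
Proof.
have [aL aR] := act_bilin V.
elim: j => [|j IH].
  move=> [|u [|w s1]] s2; rewrite /bw /=.
  - case: s2 => [|w s2]; first exact: lin_word1.
    apply: (@lin_tliftr _ _ _ _ _ _ (fun v w0 w1 => word [:: w0, v ◁ w1 & s2])) => w0 w1.
    exact: (lin_comp (lin_word [:: w0] s2) (aL w1)).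
  - apply: (@lin_tliftl _ _ _ _ _ (fun w => coact w) (fun w0 w1 => word [:: w0, u ◁ w1 & s2])).
    + by move=> w1; exact: (lin_word [::]).
    + by move=> w0; exact: (lin_comp (lin_word [:: w0] s2) (aR u)).
    + exact: lin_linear.
  - apply: (@lin_tliftr _ _ _ _ _ _ (fun v w0 w1 => word [:: w0, u ◁ w1 & s1 ++ v :: s2])) => w0 w1.
    exact: (lin_word [:: w0, u ◁ w1 & s1] s2).
apply: (multilin_cons (g := fun u s => tcat (word [:: u]) (bw j s))) => [u s|u s1 s2|s].
- exact: bw_cons.
- exact: (lin_comp (lin_tcatr _) (IH s1 s2)).
- exact: (lin_comp (lin_tcatl _) (@lin_word1 k V)).
Qed.

Lemma lin_braid i : lin (@braid k A V i).
Proof. exact: lin_wlift (bw_multilin i.-1). Qed.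

Lemma braid_word (x : seq V) v w s2 : braid (size x).+1 (word (rcons x v ++ w :: s2))
  = \sw_(w0, w1 <- coact w) word (rcons (rcons x w0) (v ◁ w1) ++ s2).
Proof.
rewrite /braid wlift_word; last exact: bw_multilin.
rewrite /= cat_rcons drop_size_cat // take_size_cat //.
by swx; rewrite -!cats1 -!catA.
Qed.

Lemma on_belast_multilin (f : talg V -> talg V) : lin f ->
  multilin (fun s => tcat (f (word (take (size s).-1 s))) (word (drop (size s).-1 s))).
Proof.
move=> fL; apply: (multilin_last (g := fun s v => tcat (f (word s)) (word [:: v]))) => [s v|v s1
  s2|s].
- by rewrite size_rcons /= -cats1 take_size_cat // drop_size_cat.
- exact: (lin_comp (lin_comp (lin_tcatl _) fL) (lin_word s1 s2)).
- exact: (lin_comp (lin_tcatr _) (@lin_word1 k V)).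
Qed.

Lemma lin_on_belast (f : talg V -> talg V) : lin f -> lin (on_belast f).
Proof. by move=> fL; exact: lin_wlift (on_belast_multilin fL). Qed.

Lemma on_belast_rcons (f : talg V -> talg V) s v : lin f ->
  on_belast f (word (rcons s v)) = tcat (f (word s)) (word [:: v]).
Proof.
move=> fL; rewrite /on_belast wlift_word; last exact: on_belast_multilin.
by rewrite size_rcons /= -cats1 take_size_cat // drop_size_cat.
Qed.

Lemma on_belast_tcat (f : talg V -> talg V) t v : lin f ->
  on_belast f (tcat t (word [:: v])) = tcat (f t) (word [:: v]).
Proof.
move=> fL; move: t; apply: talg_ext => [||s].
- exact: (lin_comp (lin_on_belast fL) (lin_tcatl _)).
- exact: (lin_comp (lin_tcatl _) fL).
by rewrite tcat_word cats1 on_belast_rcons.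
Qed.

Let nb i (x : talg V) := - braid i x.
Let nbL i : lin (nb i). Proof. exact: (lin_opp (lin_braid i)). Qed.

Lemma lin_braid_chain r n : lin (braid_chain nb r n).
Proof.
rewrite /braid_chain; move: (n - r)%N => m; elim: m r => [|m IH] r /=; first exact: lin_id.
exact: (lin_comp (IH r.+1) (nbL r)).
Qed.

Lemma lin_braided_binom n r : lin (braided_binom nb n r).
Proof.
elim: n r => [|n IH] [|r] //=.
apply: lin_add; last exact: lin_on_belast.
exact: (lin_comp (lin_on_belast (IH r)) (lin_braid_chain r.+1 n.+1)).
Qed.

Lemma braided_binom0 n t : braided_binom nb n 0 t = t. Proof. by case: n. Qed.

Lemma on_belast0 t : on_belast (fun _ => 0) t = 0 :> talg V.
Proof.
move: t; apply: talg_ext => [||s]; [exact/lin_on_belast/lin_cst0|exact: lin_cst0|].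
rewrite /on_belast wlift_word; last by apply: (@on_belast_multilin (fun=> 0)); exact: lin_cst0.
exact: (lin0 (lin_tcatl _)).
Qed.

Lemma braided_binom_gt n r t : (n < r)%N -> braided_binom nb n r t = 0.
Proof.
elim: n r t => [|n IH] [|r] t //=; rewrite ltnS => nr.
have e m : (n < m)%N -> braided_binom nb n m = fun=> 0.
  by move=> nm; apply/funext => u; rewrite IH.
by rewrite (e r) // (e r.+1) ?on_belast0 ?addr0 // ltnW.
Qed.

Lemma braided_binom_nn s : braided_binom nb (size s) (size s) (word s) = word s.
Proof.
elim/last_ind: s => [|s v IH] //; rewrite size_rcons /= /braid_chain subnn /=.
rewrite on_belast_rcons ?IH -?word_rcons; last exact: lin_braided_binom.
have -> : braided_binom nb (size s) (size s).+1 = fun=> 0.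
  by apply/funext => t; rewrite braided_binom_gt.
by rewrite on_belast0 addr0.
Qed.

(** One braiding at a time, v moves to the right through s', each step contributing a sign and the
    action of one coacted letter; [actM] collects these actions into the coaction of the whole word
    s'. *)
Lemma braid_chain_word s' (x : seq V) v :
  braid_chain nb (size x).+1 ((size x).+1 + size s') (word (rcons x v ++ s'))
  = (-1) ^+ size s' *: \sw_(t0, t1 <- word_coact s') tcat (tcat (word x) t0) (word [:: v ◁ t1]).
Proof.
elim: s' x v => [|w s' IH] x v.
  rewrite /braid_chain addn0 subnn /= expr0 scale1r swE // tcatt1 tcat_word act1 cats0 cats1 //.
(* Raising both bounds by one keeps their difference: after its first braiding, the chain is the one
   for the prefix lengthened by w0. *)
have step t : braid_chain nb (size x).+1 ((size x).+1 + (size s').+1) t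
    = braid_chain nb (size x).+2 ((size x).+2 + size s') (nb (size x).+1 t).
  by rewrite /braid_chain !addKn.
have L := lin_braid_chain (size x).+2 ((size x).+2 + size s').
rewrite [size (w :: s')]/= step /nb braid_word (linN _ L) (sw_lin _ _ L) exprS mulN1r scaleNr.
congr (- _) => /=.
under eq_sw => w0 w1 do rewrite -[X in braid_chain nb X.+1]( size_rcons x w0) -[X in braid_chain
  nb _ (X.+1 + _)](size_rcons x w0) IH.
rewrite sw_scale; congr (_ *: _); swn_r; swx; swx.
by rewrite actM -cats1 -tcat_word !tcatA.
Qed.

End Braid.

(** * The shuffle product by last letters *)

Section ShuffleProduct.

Variables (k : fieldType) (A : hopf_algebra k) (V : crossed_module A).
Implicit Types (U : lmodType k) (s : seq V).

Let shw s s' : talg V := braided_binom (fun i x => - braid i x) (size s + size s') (size s)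
  (word (s ++ s')).

Let shw_multilinl s' : multilin (shw^~ s').
Proof.
move=> s1 s2 c x y; rewrite /shw !size_cat /=.
have L := lin_braided_binom (V := V) (size s1 + (size s2).+1 + size s') (size s1 + (size s2).+1).
by rewrite -!catA; exact: (lin_comp L (lin_word s1 (s2 ++ s'))).
Qed.

Let shw_multilinr s : multilin (shw s).
Proof.
move=> s1 s2 c x y; rewrite /shw !size_cat /=.
have L := lin_braided_binom (V := V) (size s + (size s1 + (size s2).+1)) (size s).
by rewrite !catA; exact: (lin_comp L (lin_word (s ++ s1) s2)).
Qed.

Let shw_multilin t' : multilin (fun s => wlift t' (shw s)).
Proof.
move=> s1 s2; apply: (@wlift_param _ _ _ _ (fun v s' => shw (s1 ++ v :: s2) s')) => s'.
exact: shw_multilinl.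
Qed.

Lemma lin_sh_mull t' : lin (fun t : talg V => sh_mul t t').
Proof. exact: lin_wlift (shw_multilin t'). Qed.

Lemma lin_sh_mulr t : lin (fun t' : talg V => sh_mul t t').
Proof. by apply: wlift_param => s; exact: lin_wlift (shw_multilinr s). Qed.

Let sh_mul_word s s' : sh_mul (word s) (word s') = shw s s'.
Proof.
exact: (etrans (wlift_word s (shw_multilin _)) (wlift_word s' (shw_multilinr s))).
Qed.

Lemma sh_mul1t (t : talg V) : sh_mul (word [::]) t = t.
Proof.
move: t; apply: talg_ext => //; first exact: lin_sh_mulr.
by move=> s; rewrite sh_mul_word /shw braided_binom0.
Qed.

Lemma sh_mult1 (t : talg V) : sh_mul t (word [::]) = t.
Proof.
move: t; apply: talg_ext => //; first exact: lin_sh_mull.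
by move=> s; rewrite sh_mul_word /shw addn0 cats0 braided_binom_nn.
Qed.

Let sh_mul_braid s v z U (h : talg V -> U) : lin h ->
  (-1) ^+ size z *: (\sw_(t0, t1 <- word_coact z)
      h (tcat (braided_binom (fun i x => - braid i x) (size s + size z) (size s) (tcat (word s) t0))
           (word [:: v ◁ t1])))
  = \sw_(t0, t1 <- tcoact (word z)) h (tcat (sh_mul (word s) (sgt t0)) (word [:: v ◁ t1])).
Proof.
move=> lh; have L1 := lin_sh_mulr (word s).
have L2 := lin_braided_binom (V := V) (size s + size z) (size s).
rewrite tcoact_word -sw_scale; apply: word_coact_ext => // s' a e.
rewrite sgt_word e (linZ _ _ L1) (linZ _ _ (lin_tcatl _)) (linZ _ _ lh) sh_mul_word.
by rewrite /shw e tcat_word.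
Qed.

(** The two summands of the braided binomial: the last position is taken by w, or by v after the
    chain has carried it through s' and w. *)
Lemma sh_mul_rcons s v s' w :
  sh_mul (word (rcons s v)) (word (rcons s' w))
  = tcat (sh_mul (word (rcons s v)) (word s')) (word [:: w])
    + \sw_(t0, t1 <- tcoact (word (rcons s' w)))
        tcat (sh_mul (word s) (sgt t0)) (word [:: v ◁ t1]).
Proof.
have L2 := lin_braided_binom (V := V) (size s + (size s').+1) (size s).
have L3 := lin_on_belast L2.
rewrite sh_mul_word /shw !size_rcons /= [RHS]addrC; congr (_ + _).
  have := braid_chain_word (rcons s' w) s v; rewrite size_rcons addSn => ->.
  rewrite (linZ _ _ L3) (sw_lin _ _ L3).
  rewrite -[RHS](sh_mul_braid _ _ _ (h := fun x => x)) // size_rcons.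
  by congr (_ *: _); apply: eq_sw => t0 t1; rewrite on_belast_tcat.
rewrite -rcons_cat addnS on_belast_rcons -?addSn; last exact: lin_braided_binom.
by rewrite sh_mul_word /shw size_rcons.
Qed.

Lemma lamt_tcat1 (t : talg V) v : lamt (tcat t (word [:: v])) = t ⊗ v.
Proof. by move: t; apply: talg_ext => // s; rewrite -word_rcons lamt_rcons. Qed.

Lemma tcou_tcat1 (t : talg V) v : tcou (tcat t (word [:: v])) = 0.
Proof.
move: t; apply: (@talg_ext _ _ k^o) => [||s].
- by apply: (@scal_comp _ _ _ (@tcou k V)).
- exact: lin_cst0.
- by rewrite -word_rcons tcou_rcons.
Qed.

End ShuffleProduct.

Ltac lin_shuffle :=
  lazymatch goal with
  | |- lin (fun x => sh_mul x _) => apply lin_sh_mull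
  | |- lin (fun x => sh_mul _ x) => apply lin_sh_mulr
  | |- _ => lin_cross
  end.
Ltac lin_atom ::= lin_shuffle.

Section ShuffleProductLast.

Variables (k : fieldType) (A : hopf_algebra k) (V : crossed_module A).
Implicit Types (U : lmodType k) (s : seq V) (e z : talg V).

Lemma lamt_sh_mul e z : lamt (sh_mul e z)
  = \sw_(z', w <- lamt z) (sh_mul e z' ⊗ w)
    + \sw_(e', v <- lamt e) \sw_(z0, z1 <- tcoact z) (sh_mul e' (sgt z0) ⊗ v ◁ z1).
Proof.
move: e; apply: talg_ext => // s; move: z; apply: talg_ext => // s'.
case/lastP: s => [|s v]; first by rewrite lamt1 sw0 // addr0; under eq_sw do rewrite sh_mul1t;
  rewrite sh_mul1t sw_id.
case/lastP: s' => [|s' w].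
  rewrite lamt1 sw0 // add0r sh_mult1 lamt_rcons swE //; swn_r.
  by rewrite sw_tcoact1 // act1 sgt_word scale1r sh_mult1.
rewrite !lamt_rcons !swE // sh_mul_rcons (linD (@lin_lamt _ _)) lamt_tcat1; congr (_ + _).
by swn_l; swx; rewrite lamt_tcat1.
Qed.

Lemma tcou_sh_mul e z : tcou (sh_mul e z) = tcou e * tcou z.
Proof.
have L : scal (@tcou k V) by exact: scal_tcou.
move: e; apply: (@talg_ext _ _ k^o) => [||s].
- by apply: (@scal_comp _ _ _ (@tcou k V)).
- exact: (scal_mulr (tcou z) L).
move: z; apply: (@talg_ext _ _ k^o) => [||s'].
- by apply: (@scal_comp _ _ _ (@tcou k V)).
- exact: (scal_mull _ L).
case/lastP: s => [|s v]; first by rewrite sh_mul1t (tcou_word [::]) mul1r.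
case/lastP: s' => [|s' w]; first by rewrite sh_mult1 (tcou_word [::]) mulr1.
rewrite sh_mul_rcons !tcou_rcons mul0r (linD (U := talg V) (V := k^o) L) tcou_tcat1 add0r.
rewrite (sw_lin (Z := k^o) _ _ L).
by transitivity (\sw_(x, y <- tcoact (word (rcons s' w))) (0 : k^o)); [swx; rewrite
  tcou_tcat1|rewrite sw_zero].
Qed.

Lemma tcou_tact e a : tcou (tact e a) = cou a * tcou e.
Proof.
have L : scal (@tcou k V) by exact: scal_tcou.
move: e; apply: (@talg_ext _ _ k^o) => [||s].
- by apply: (@scal_comp _ _ _ (@tcou k V)).
- exact: (scal_mull _ L).
case/lastP: s => [|s v].
  by rewrite tact1 (linZ (V := k^o) _ _ L) /= tcou_word.
rewrite tact_rcons tcou_rcons mulr0 (sw_lin (Z := k^o) _ _ L).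
by transitivity (\sw_(x, y <- cop a) (0 : k^o)); [swx; rewrite tcou_tcat1|rewrite sw_zero].
Qed.

Lemma lamt_tact e a : lamt (tact e a)
  = \sw_(e', v <- lamt e) \sw_(a1, a2 <- cop a) (tact e' a1 ⊗ v ◁ a2).
Proof.
move: e; apply: talg_ext => // s; case/lastP: s => [|s v].
  by rewrite tact1 (linZ _ _ (@lin_lamt _ _)) lamt1 sw0 // scaler0.
rewrite lamt_rcons swE // tact_rcons; swn_l; swx.
by rewrite lamt_tcat1.
Qed.

End ShuffleProductLast.

(** * The maps omega~ and delta *)

Section ShuffleDelta.

Variables (k : fieldType) (A : hopf_algebra k) (V : crossed_module A).
Variable omega : {linear aug_ideal A -> V}.
Implicit Types (U : lmodType k) (s : seq V) (e z : talg V).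

Lemma lin_omega_tilde : lin (omega_tilde omega).
Proof.
move=> c x y; rewrite /omega_tilde -linearP; congr (omega _); apply: val_inj => /=.
by rewrite linearP /= [in LHS]scalerDl scalerBr opprD scalerA addrACA.
Qed.

Lemma omega_tilde1 : omega_tilde omega 1 = 0.
Proof.
rewrite /omega_tilde; have -> : aug_proj 1 = 0 :> aug_ideal A.
  by apply: val_inj; rewrite /= cou1 scale1r subrr.
exact: linear0.
Qed.

Hypothesis omega_map : aug_crossed_map omega.

(** π(a b) = π(a) b + ε(a) π(b), and ω is a module map. *)
Lemma omega_tildeM a b :
  omega_tilde omega (a * b) = omega_tilde omega a ◁ b + cou a *: omega_tilde omega b.
Proof.
rewrite /omega_tilde -omega_map.1 -linearZ -linearD; congr (omega _); apply: val_inj => /=.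
rewrite couM mulrBl -scalerAl mul1r scalerBr scalerA addrA addrNK //.
Qed.

(** ω is a comodule map, applied to a - ε(a) 1; the correction contributes a multiple of omega~(1) =
    0. *)
Lemma omega_tilde_coact a : coact (omega_tilde omega a)
  = \sw_(a1, b <- cop a) \sw_(a2, a3 <- cop b) (omega_tilde omega a2 ⊗ ant a1 * a3).
Proof.
have L := lin_omega_tilde; rewrite omega_map.2 /aug_coact /=.
have M : lin (tmap omega (@id A)) by exact: lin_tmap.
have e a1 b : tmap omega id (\sw_(a2, a3 <- cop b) (aug_proj a2 ⊗ ant a1 * a3))
    = \sw_(a2, a3 <- cop b) (omega_tilde omega a2 ⊗ ant a1 * a3).
  by rewrite (sw_lin _ _ M); apply: eq_sw => a2 a3; rewrite tmapE.
rewrite (sw_lin _ _ M); under eq_sw do rewrite e.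
rewrite linearB linearZ swD // swN // swZ //; swn_l.
rewrite omega_tilde1 (lin0 (lin_tpurel _)) scaler0 subr0 //.
Qed.

Let word_delta_rcons n s v : n = (size s).+1 -> word_delta omega n (rcons s v)
  = tcat (word_delta omega (size s) s) (word [:: v])
    + (-1) ^+ n *: \sw_(t0, t1 <- word_coact (rcons s v)) tcat t0 (word [:: omega_tilde omega t1]).
Proof. by move=> -> /=; rewrite -cats1 take_size_cat // drop_size_cat. Qed.

(** The recursion runs on a counter and shortens the word from its end, so the induction bounds the
    number of letters and distinguishes whether the varying letter is the last one. *)
Let word_delta_multilin : multilin (fun s => word_delta omega (size s) s).
Proof.
have L := lin_omega_tilde.
suff h n s1 s2 : (size s1 + size s2 <= n)%N ->
    lin (fun v => word_delta omega (size s1 + (size s2).+1) (s1 ++ v :: s2)).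
  by move=> s1 s2 c x y; rewrite !size_cat /=; exact: (h _ _ _ (leqnn _)).
have C (s3 s4 : seq V) : lin (fun v => \sw_(t0, t1 <- word_coact (s3 ++ v :: s4))
    tcat t0 (word [:: omega_tilde omega t1])).
  by apply: lin_tliftl => //; exact: word_coact_multilin.
elim: n s1 s2 => [|n IH] s1 s2; case/lastP: s2 => [|s2 u].
- move=> _ c x y; rewrite !cats1 !word_delta_rcons ?addn1 //.
  move: c x y; apply: lin_add => //; apply: lin_scale; have := C s1 [::].
  by congr lin; apply/funext => v; rewrite cats1.
- by rewrite size_rcons addnS.
- move=> _ c x y; rewrite !cats1 !word_delta_rcons ?addn1 //.
  move: c x y; apply: lin_add => //; apply: lin_scale; have := C s1 [::].
  by congr lin; apply/funext => v; rewrite cats1.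
rewrite size_rcons addnS ltnS => le c x y; rewrite -!rcons_cons -!rcons_cat.
rewrite !word_delta_rcons ?size_cat ?addnS //= -/(size _).
move: c x y; apply: lin_add; last first.
  by apply: lin_scale; have := C s1 (rcons s2 u); congr lin; apply/funext => v; rewrite
    -rcons_cons rcons_cat.
by apply: (lin_comp (lin_tcatl _)); have := IH s1 s2 le; rewrite addnS.
Qed.

Lemma lin_sh_delta : lin (sh_delta omega).
Proof. exact: lin_wlift word_delta_multilin. Qed.

Lemma sh_delta1 : sh_delta omega (word [::]) = 0.
Proof. exact: wlift_word word_delta_multilin. Qed.

Lemma sh_delta_rcons s v : sh_delta omega (word (rcons s v))
  = tcat (sh_delta omega (word s)) (word [:: v])
    + \sw_(t0, t1 <- tcoact (word (rcons s v)))
        tcat (sgt t0) (word [:: omega_tilde omega t1]).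
Proof.
have L := lin_omega_tilde; rewrite /sh_delta !(wlift_word _ word_delta_multilin).
rewrite word_delta_rcons ?size_rcons // tcoact_word; congr (_ + _).
rewrite -sw_scale; apply: word_coact_ext => // s' a e.
by rewrite sgt_word e size_rcons (linZ _ _ (lin_tcatl _)).
Qed.

Lemma lamt_sh_delta e : lamt (sh_delta omega e)
  = \sw_(e', v <- lamt e) (sh_delta omega e' ⊗ v)
    + \sw_(e0, e1 <- tcoact e) (sgt e0 ⊗ omega_tilde omega e1).
Proof.
have L := lin_omega_tilde; have D := lin_sh_delta.
move: e; apply: talg_ext => // s; case/lastP: s => [|s v].
  rewrite sh_delta1 lamt1 sw0 // add0r sw_tcoact1 // omega_tilde1.
  by rewrite (lin0 (lin_tpurer _)) (lin0 (@lin_lamt _ _)).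
rewrite lamt_rcons swE // sh_delta_rcons (linD (@lin_lamt _ _)) lamt_tcat1; congr (_ + _).
by swn_l; swx; rewrite lamt_tcat1.
Qed.

Lemma tcou_sh_delta e : tcou (sh_delta omega e) = 0.
Proof.
have L : scal (@tcou k V) by exact: scal_tcou.
have D := lin_sh_delta.
move: e; apply: (@talg_ext _ _ k^o) => [||s].
- by apply: (@scal_comp _ _ _ (@tcou k V)).
- exact: lin_cst0.
case/lastP: s => [|s v]; first by rewrite sh_delta1 (lin0 (U := talg V) (V := k^o) L).
rewrite sh_delta_rcons (linD (U := talg V) (V := k^o) L) tcou_tcat1 add0r.
rewrite (sw_lin (Z := k^o) _ _ L).
by transitivity (\sw_(x, y <- tcoact (word (rcons s v))) (0 : k^o)); [swx; rewrite
  tcou_tcat1|rewrite sw_zero].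
Qed.

End ShuffleDelta.

(** * The bosonization A # Sh_-(V) *)

Section WordTests.

Variables (k : fieldType) (A : hopf_algebra k) (V : crossed_module A).
Implicit Types (U : lmodType k) (s : seq V) (e z : talg V).

Lemma tcou_sgt e : tcou (sgt e) = tcou e.
Proof.
move: e; apply: (@talg_ext _ _ k^o) => [||s].
- by apply: (@scal_comp _ _ _ (@tcou k V)).
- exact: scal_tcou.
rewrite sgt_word (linZ (V := k^o) _ _ (@scal_tcou k V)) tcou_word /=.
by case: s => [|v s]; rewrite ?expr0 ?scale1r ?scaler0.
Qed.

Lemma tcou_part b e : tcou (part b e) = if b then 0 else tcou e.
Proof.
have L : scal (fun e => if b then 0 else tcou e).
  by case: b; [exact: (@lin_cst0 _ _ k^o)|exact: scal_tcou].
move: e; apply: (@talg_ext _ _ k^o) => [||s] //.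
- by apply: (@scal_comp _ _ _ (@tcou k V)).
rewrite part_word; case: s => [|v s] /=.
  by case: b {L}; rewrite //= (lin0 (V := k^o) (@scal_tcou k V)).
rewrite [in RHS]tcou_word if_same.
by case: ifP; rewrite ?tcou_word // (lin0 (V := k^o) (@scal_tcou k V)).
Qed.

Lemma lamt_sgt e : lamt (sgt e) = - \sw_(e', v <- lamt e) (sgt e' ⊗ v).
Proof.
move: e; apply: talg_ext => // s; case/lastP: s => [|s v].
  by rewrite sgt_word scale1r lamt1 sw0 // oppr0.
rewrite sgt_word (linZ _ _ (@lin_lamt _ _)) lamt_rcons swE // sgt_word size_rcons.
by rewrite exprS mulN1r scaleNr (linZ _ _ (lin_tpurel _)).
Qed.

Lemma lamt_part b e : lamt (part b e) = \sw_(e', v <- lamt e) (part (~~ b) e' ⊗ v).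
Proof.
move: e; apply: talg_ext => // s; case/lastP: s => [|s v].
  by rewrite part_word lamt1 sw0 //; case: ifP; rewrite ?lamt1 // (lin0 (@lin_lamt _ _)).
rewrite part_word lamt_rcons swE // part_word size_rcons /=.
rewrite -[b in LHS]negbK (inj_eq negb_inj).
by case: ifP; rewrite ?lamt_rcons // (lin0 (@lin_lamt _ _)) (lin0 (lin_tpurel _)).
Qed.

Lemma sw_tcoact_cou e U (F : A -> U) : lin F ->
  \sw_(e0, e1 <- tcoact e) (tcou e0 *: F e1) = tcou e *: F 1.
Proof.
move=> lF; move: e; apply: talg_ext => // s; case/lastP: s => [|s v].
  by rewrite sw_tcoact1.
rewrite sw_tcoact_rcons // tcou_rcons scale0r -[RHS](sw_zero U (tcoact (word s))).
swx; rewrite -[RHS](sw_zero U (coact v)); swx.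
by rewrite tcou_tcat1 scale0r.
Qed.

Lemma sw_tcoact_lamt e U (F : talg V -> V -> A -> U) :
  lin3l F -> lin3m F -> lin3r F ->
  \sw_(e0, e1 <- tcoact e) \sw_(e', v <- lamt e0) F e' v e1
  = \sw_(e', v <- lamt e) \sw_(e0, e1 <- tcoact e') \sw_(v0, v1 <- coact v) F e0 v0 (e1 * v1).
Proof.
move=> F1 F2 F3; move: e; apply: talg_ext => // s; case/lastP: s => [|s v].
  by rewrite sw_tcoact1 // lamt1 !sw0.
rewrite sw_tcoact_rcons // lamt_rcons swE //; swx; swx.
by rewrite lamt_tcat1 swE.
Qed.

Lemma sw_decon_cou e U (F : talg V -> U) : lin F ->
  \sw_(e1, e2 <- decon e) (tcou e2 *: F e1) = F e.
Proof.
move=> lF; move: e; apply: talg_ext => // s; case/lastP: s => [|s v].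
  by rewrite decon1 swE // tcou_word scale1r.
rewrite decon_rcons swD // swE // tcou_word scale1r; swn_l.
rewrite -[RHS]add0r; congr (_ + _); rewrite -[RHS](sw_zero U (decon (word s))); swx.
by rewrite tcou_tcat1 scale0r.
Qed.

Lemma sw_decon_lamt e U (F : talg V -> talg V -> V -> U) :
  lin3l F -> lin3m F -> lin3r F ->
  \sw_(e1, e2 <- decon e) \sw_(e', v <- lamt e2) F e1 e' v
  = \sw_(e', v <- lamt e) \sw_(e1, e2 <- decon e') F e1 e2 v.
Proof.
move=> F1 F2 F3; move: e; apply: talg_ext => // s; case/lastP: s => [|s v].
  by rewrite decon1 swE // lamt1 !sw0.
rewrite decon_rcons swD // swE // lamt1 sw0 // addr0 lamt_rcons swE //; swn_l; swx.
by rewrite lamt_tcat1 swE.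
Qed.

End WordTests.

(** * The last-letter operations on A # Sh_-(V) *)

Section SmashOps.

Variables (k : fieldType) (A : hopf_algebra k) (V : crossed_module A).
Implicit Types (x y : A ⊗ talg V).

Definition smash_pi0 x : A := \sw_(a, e <- x) (tcou e *: a).

Definition smash_lam x : (A ⊗ talg V) ⊗ V := \sw_(a, e <- x) \sw_(e', v <- lamt e) ((a ⊗ e') ⊗ v).

Definition smash_rho x : (A ⊗ talg V) ⊗ A :=
  \sw_(a, e <- x) \sw_(a1, a2 <- cop a) \sw_(e0, e1 <- tcoact e) ((a1 ⊗ e0) ⊗ a2 * e1).

Definition smash_ops : shuffle_ops V (A ⊗ talg V)%type := {|
  so_iota := fun a => a ⊗ word [::];
  so_pi0 := smash_pi0;
  so_app := fun x v => \sw_(a, e <- x) (a ⊗ tcat e (word [:: v]));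
  so_lam := smash_lam;
  so_P := @smash_proj k A V;
  so_rho := smash_rho;
  so_Delta := @smash_cop k A V;
  so_mul := @smash_mul k A V;
  so_sg := tmap id (@sgt k V);
  so_par := fun b => tmap id (part b)
|}.

Lemma smash_projE n a (e : talg V) : smash_proj n (a ⊗ e) = a ⊗ tproj n e.
Proof. by rewrite /smash_proj tmapE //; exact: tproj_linear. Qed.

Lemma lin_smash_proj n : lin (@smash_proj k A V n).
Proof. by apply: lin_tmap => //; exact: tproj_linear. Qed.

Lemma smash_ext (U : lmodType k) (f g : A ⊗ talg V -> U) : lin f -> lin g ->
  (forall a s, f (a ⊗ word s) = g (a ⊗ word s)) -> forall x, f x = g x.
Proof.
move=> lf lg e; apply: tens_ext => // a t; move: t; apply: talg_ext => //.
Qed.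

Lemma smash_proj_sum x : exists N, forall M, (N <= M)%N -> x = \sum_(n < M) smash_proj n x.
Proof.
pose Q x := exists N, forall M, (N <= M)%N -> x = \sum_(n < M) smash_proj n x.
have L := lin_smash_proj.
have Q0 : Q 0 by exists 0%N => M _; rewrite big1 // => n _; rewrite (lin0 (L n)).
have QD c y z : Q y -> Q z -> Q (c *: y + z).
  move=> [N hN] [N' hN']; exists (maxn N N') => M; rewrite geq_max => /andP[h h'].
  rewrite [in LHS](hN M) // [in LHS](hN' M) // scaler_sumr -big_split.
  by apply: eq_bigr => n _; rewrite /= L.
have Qw a s : Q (a ⊗ word s).
  exists (size s).+1 => M h; rewrite (bigD1 (Ordinal h)) //= smash_projE tproj_word eqxx.
  rewrite big1 ?addr0 // => n ne; rewrite smash_projE tproj_word.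
  case: eqP => [e|_]; last exact: (lin0 (lin_tpurer _)).
  by case/eqP: ne; apply/val_inj.
have Qt a (t : talg V) : Q (a ⊗ t).
  have [r ->] := talg_span t; elim: r => [|p r IH]; first by rewrite big_nil (lin0 (lin_tpurer _)).
  by rewrite big_cons (linD (lin_tpurer _)) (linZ _ _ (lin_tpurer _)); exact: QD.
have [r ->] := tens_span x; elim: r => [|p r IH]; first by rewrite big_nil.
by rewrite big_cons; exact: QD.
Qed.

Lemma smash_pi0E a (e : talg V) : smash_pi0 (a ⊗ e) = tcou e *: a.
Proof. by rewrite /smash_pi0 swE. Qed.

Lemma smash_lamE a (e : talg V) : smash_lam (a ⊗ e) = \sw_(e', v <- lamt e) ((a ⊗ e') ⊗ v).
Proof. by rewrite /smash_lam swE. Qed.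

Lemma smash_rhoE a (e : talg V) : smash_rho (a ⊗ e)
  = \sw_(a1, a2 <- cop a) \sw_(e0, e1 <- tcoact e) ((a1 ⊗ e0) ⊗ a2 * e1).
Proof. by rewrite /smash_rho swE. Qed.

Lemma smash_copE a (e : talg V) : smash_cop (a ⊗ e)
  = \sw_(a1, a2 <- cop a) \sw_(e1, e2 <- decon e)
      \sw_(e10, e11 <- tcoact e1) ((a1 ⊗ e10) ⊗ (a2 * e11 ⊗ e2)).
Proof. by rewrite /smash_cop swE. Qed.

Lemma smash_mulE a b (e z : talg V) : smash_mul (a ⊗ e) (b ⊗ z)
  = \sw_(b1, b2 <- cop b) (a * b1 ⊗ sh_mul (tact e b2) z).
Proof. by rewrite /smash_mul !swE. Qed.

Lemma lin_smash_pi0 : lin smash_pi0. Proof. by rewrite /smash_pi0. Qed.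
Lemma lin_smash_lam : lin smash_lam. Proof. by rewrite /smash_lam. Qed.
Lemma lin_smash_rho : lin smash_rho. Proof. by rewrite /smash_rho. Qed.
Lemma lin_smash_cop : lin (@smash_cop k A V). Proof. by rewrite /smash_cop. Qed.
Lemma lin_smash_mull y : lin (fun x => smash_mul x y). Proof. by rewrite /smash_mul. Qed.
Lemma lin_smash_mulr x : lin (fun y => smash_mul x y). Proof. by rewrite /smash_mul. Qed.

End SmashOps.

Ltac lin_smash :=
  lazymatch goal with
  | |- lin (fun x => tmap _ _ x) => apply lin_tmap; lin_tac
  | |- lin (fun x => smash_proj _ x) => apply lin_smash_proj
  | |- lin (fun x => smash_pi0 x) => apply lin_smash_pi0
  | |- lin (fun x => smash_lam x) => apply lin_smash_lam
  | |- lin (fun x => smash_rho x) => apply lin_smash_rho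
  | |- lin (fun x => smash_cop x) => apply lin_smash_cop
  | |- lin (fun x => smash_mul x _) => apply lin_smash_mull
  | |- lin (fun x => smash_mul _ x) => apply lin_smash_mulr
  | |- _ => lin_shuffle
  end.
Ltac lin_atom ::= lin_smash.

Section SmashTests.

Variables (k : fieldType) (A : hopf_algebra k) (V : crossed_module A) (U : lmodType k).

Lemma sw_smash_lam a (e : talg V) (F : A ⊗ talg V -> V -> U) :
  linl F -> linr F -> tlift (smash_lam (a ⊗ e)) F = \sw_(e', v <- lamt e) F (a ⊗ e') v.
Proof. by move=> F1 F2; rewrite smash_lamE; swn_l. Qed.

Lemma sw_smash_rho a (e : talg V) (F : A ⊗ talg V -> A -> U) :
  linl F -> linr F -> tlift (smash_rho (a ⊗ e)) F
  = \sw_(a1, a2 <- cop a) \sw_(e0, e1 <- tcoact e) F (a1 ⊗ e0) (a2 * e1).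
Proof. by move=> F1 F2; rewrite smash_rhoE; swn_l. Qed.

Lemma sw_smash_cop a (e : talg V) (F : A ⊗ talg V -> A ⊗ talg V -> U) :
  linl F -> linr F -> tlift (smash_cop (a ⊗ e)) F
  = \sw_(a1, a2 <- cop a) \sw_(e1, e2 <- decon e) \sw_(e10, e11 <- tcoact e1)
      F (a1 ⊗ e10) (a2 * e11 ⊗ e2).
Proof. by move=> F1 F2; rewrite smash_copE; swn_l. Qed.

End SmashTests.

Ltac sw_rule ::= first
  [ apply sw_smash_lam; lin_tac | apply sw_smash_rho; lin_tac | apply sw_smash_cop; lin_tac
  | sw_hopf ].

Section SmashAxioms.

Variables (k : fieldType) (A : hopf_algebra k) (V : crossed_module A).
Implicit Types (x y : A ⊗ talg V).

Lemma smash_axioms : shuffle_axioms (smash_ops V).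
Proof.
split=> [||v|x|||||y|x|||||||||||||||||||] /=; try lin_tac.
- apply: smash_ext; [lin_tac | lin_tac | move=> a s]; rewrite smash_projE smash_pi0E tproj_word
  tcou_word.
  by case: s => [|v s]; rewrite ?scale1r // scale0r (lin0 (lin_tpurer _)) (lin0 (lin_tpurel _)).
- move=> n; apply: smash_ext; [lin_tac | lin_tac | move=> a s]; rewrite smash_projE smash_lamE;
  swn_r.
  case/lastP: s => [|s v].
    by rewrite tproj_word lamt1 sw0 // (lin0 (lin_tpurer _)).
  rewrite lamt_rcons swE // smash_projE swE // !tproj_word size_rcons eqSS.
  case: ifP => _; first by rewrite -word_rcons.
  by rewrite (lin0 (lin_tcatl _)).
- exact: smash_proj_sum.
- by move=> a; rewrite smash_pi0E tcou_word scale1r.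
- by move=> a; rewrite smash_lamE lamt1 sw0.
- move=> x v; move: x; apply: tens_ext; [lin_tac | lin_tac | move=> a e].
  by rewrite swE // smash_pi0E tcou_tcat1 scale0r.
- move=> x v; move: x; apply: tens_ext; [lin_tac | lin_tac | move=> a e].
  by rewrite swE // smash_lamE lamt_tcat1 swE.
- by apply: tens_ext; [lin_tac | lin_tac | move=> a e]; rewrite tmapE // !smash_pi0E tcou_sgt.
- apply: tens_ext; [lin_tac | lin_tac | move=> a e]; rewrite tmapE // !smash_lamE lamt_sgt swN //.
  by congr (- _); swn; swx; rewrite tmapE.
- move=> b; apply: tens_ext; [lin_tac | lin_tac | move=> a e].
  by rewrite tmapE // !smash_pi0E tcou_part; case: b; rewrite ?scale0r.
- move=> b; apply: tens_ext; [lin_tac | lin_tac | move=> a e]; rewrite tmapE // !smash_lamE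
  lamt_part.
  by swn; swx; rewrite tmapE.
- apply: tens_ext; [lin_tac | lin_tac | move=> a e]; rewrite smash_rhoE smash_pi0E linearZ /=;
  swn_l.
  rewrite -{2}[cop a]sw_id -sw_scale; apply: eq_sw => a1 a2.
  have := sw_tcoact_cou e (F := fun c => a1 ⊗ (a2 * c)); rewrite mulr1 => <- //.
  by swx; rewrite smash_pi0E (linZ _ _ (lin_tpurel _)).
- apply: tens_ext; [lin_tac | lin_tac | move=> a e]; swn.
  rewrite [RHS]sw_exch; swx.
  rewrite (sw_tcoact_lamt e (F := fun e' v e1 => (_ ⊗ e') ⊗ v ⊗ _ * e1)) //.
  by swx; swx; swx; rewrite mulrA.
- apply: tens_ext; [lin_tac | lin_tac | move=> a e]; rewrite smash_copE smash_rhoE; swn_l; swx.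
  rewrite -[RHS](sw_decon_cou e (F := fun e => \sw_(e0, e1 <- tcoact e) ((_ ⊗ e0) ⊗ _ * e1))) //.
  swx; rewrite -sw_scale; swx.
  by rewrite smash_pi0E (linZ _ _ (lin_tpurer _)).
- apply: tens_ext; [lin_tac | lin_tac | move=> a e]; swn.
  rewrite [RHS]sw_exch; swx.
  rewrite -[RHS](sw_decon_lamt e (F := fun e1 e2 v =>
    \sw_(e10, e11 <- tcoact e1) ((_ ⊗ e10) ⊗ (_ * e11 ⊗ e2) ⊗ v))) //.
  by swx; rewrite sw_exch.
- move=> x y; move: x; apply: tens_ext; [lin_tac | lin_tac | move=> a e].
  move: y; apply: tens_ext; [lin_tac | lin_tac | move=> b z].
  rewrite smash_mulE !smash_pi0E; swn_l; rewrite -scalerAl -scalerAr scalerA.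
  rewrite -(sw_couR b (F := fun b => (tcou e * tcou z) *: (a * b))) //; swx.
  by rewrite smash_pi0E tcou_sh_mul tcou_tact scalerA mulrA.
- move=> x y; move: x; apply: tens_ext; [lin_tac | lin_tac | move=> a e].
  move: y; apply: tens_ext; [lin_tac | lin_tac | move=> b z].
  rewrite smash_mulE (sw_lin _ _ (@lin_smash_lam _ _ _)).
  under eq_sw => b1 b2 do rewrite smash_lamE lamt_sh_mul lamt_tact.
  swn.
  congr (_ + _); first by rewrite [LHS]sw_exch; swx; rewrite smash_mulE; swn_r.
  rewrite [LHS]sw_exch; apply: eq_sw => e' v.
  (* b is split in three: for the product in A, for the action on e' and for the action on the last
     letter v. *)
  rewrite -(sw_copA b (F := fun b1 b2 b3 => \sw_(z0, z1 <- tcoact z)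
    ((a * b1 ⊗ sh_mul (tact e' b2) (sgt z0)) ⊗ v ◁ b3 ◁ z1))) //; swx; rewrite [LHS]sw_exch; swx.
  by rewrite tmapE // smash_mulE; swn_r; swx; rewrite actM.
Qed.

Variable omega : {linear aug_ideal A -> V}.
Hypothesis omega_map : aug_crossed_map omega.

Lemma smash_diff_axioms : diff_axioms (smash_ops V) (omega_tilde omega) (smash_diff omega).
Proof.
have L := lin_omega_tilde omega; have D := lin_sh_delta omega.
have dE a (e : talg V) : smash_diff omega (a ⊗ e)
    = \sw_(a1, a2 <- cop a) (a1 ⊗ sh_mul (word [:: omega_tilde omega a2]) e)
      + a ⊗ sh_delta omega e by rewrite /smash_diff swE.
have dL : lin (smash_diff omega) by rewrite /smash_diff.
split => //=.
- exact: omega_tilde1.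
- exact: omega_tildeM.
- exact: omega_tilde_coact.
- apply: tens_ext; [lin_tac | lin_tac | move=> a e].
  rewrite dE (linD (@lin_smash_pi0 _ _ _)) smash_pi0E tcou_sh_delta scale0r addr0; swn_l.
  rewrite -[RHS](sw_zero A (cop a)); swx.
  by rewrite smash_pi0E tcou_sh_mul (tcou_word [:: _]) mul0r scale0r.
- apply: tens_ext; [lin_tac | lin_tac | move=> a e].
  rewrite dE (linD (@lin_smash_lam _ _ _)) smash_lamE lamt_sh_delta (sw_lin _ _ (@lin_smash_lam _
    _ _)).
  under eq_sw => a1 a2 do rewrite smash_lamE lamt_sh_mul -[word [:: _]]/(word (rcons [::] _))
    lamt_rcons.
  swn.
  rewrite addrACA; congr (_ + _).
    rewrite [X in X + _]sw_exch -sw_add; swx; rewrite dE (linD (lin_tpurel _)).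
    by congr (_ + _); swn_r.
  (* A counit gives the letter from delta the shape of the letter from the product, and
     [omega_tildeM] adds the two up to omega~(a_(2) e_1). *)
  rewrite -(sw_couR a (F := fun b => \sw_(e0, e1 <- tcoact e)
    ((b ⊗ sgt e0) ⊗ omega_tilde omega e1))) //.
  rewrite -sw_add; swx; rewrite -sw_scale -sw_add; swx; rewrite tmapE // sh_mul1t omega_tildeM //.
  by rewrite (linD (lin_tpurer _)) (linZ _ _ (lin_tpurer _)).
Qed.

End SmashAxioms.

Ltac sw_rule ::= fail.

(** * Deconcatenation and coaction inside Sweedler sums *)

Section Deconcatenation.

Variables (k : fieldType) (V : lmodType k).
Implicit Types (U : lmodType k) (s : seq V) (e : talg V).

Lemma wlift_lin U (f : talg V -> U) e : lin f -> \word_(s <- e) f (word s) = f e.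
Proof.
move=> fL; have m : multilin (fun s => f (word s)).
  by move=> s1 s2; exact: (lin_comp fL (lin_word s1 s2)).
by move: e; apply: talg_ext => [|//|s]; [exact: lin_wlift | rewrite wlift_word].
Qed.

Lemma decon_cons v s : decon (word (v :: s))
  = word [::] ⊗ word (v :: s) + \sw_(e1, e2 <- decon (word s)) (tcat (word [:: v]) e1 ⊗ e2).
Proof.
rewrite !decon_word big_ord_recl; congr (_ + _); rewrite sw_big //.
by apply: eq_bigr => i _; rewrite swE // tcat_word.
Qed.

Lemma sw_decon_couL e U (F : talg V -> U) : lin F ->
  \sw_(e1, e2 <- decon e) (tcou e1 *: F e2) = F e.
Proof.
move=> lF; move: e; apply: talg_ext => // s; elim/last_ind: s F lF => [|s v IH] F lF.
  by rewrite decon1 swE // tcou_word scale1r.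
rewrite decon_rcons swD // swE // tcou_rcons scale0r addr0; swn_l.
by rewrite (IH (fun e => F (tcat e (word [:: v])))) // -word_rcons.
Qed.

Lemma decon_tcat1 e v : decon (tcat e (word [:: v]))
  = \sw_(e1, e2 <- decon e) (e1 ⊗ tcat e2 (word [:: v])) + tcat e (word [:: v]) ⊗ word [::].
Proof. by move: e; apply: talg_ext => // s; rewrite -word_rcons decon_rcons. Qed.

Lemma sw_deconA e U (F : talg V -> talg V -> talg V -> U) :
  lin3l F -> lin3m F -> lin3r F ->
  \sw_(e1, e2 <- decon e) \sw_(x, y <- decon e1) F x y e2
  = \sw_(e1, e2 <- decon e) \sw_(y, z <- decon e2) F e1 y z.
Proof.
move=> F1 F2 F3; move: e; apply: talg_ext => // s.
elim/last_ind: s F F1 F2 F3 => [|s v IH] F F1 F2 F3; first by rewrite decon1 !swE // decon1 !swE.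
rewrite !decon_rcons !swD // !swE // decon1 decon_rcons swD // !swE // addrA; congr (_ + _).
swn; rewrite (IH (fun x y z => F x y (tcat z (word [:: v])))) // -sw_add; swx.
by rewrite decon_tcat1 swD // swE //; congr (_ + _); swn_r.
Qed.

End Deconcatenation.

Section CoactionTests.

Variables (k : fieldType) (A : hopf_algebra k) (V : crossed_module A).
Implicit Types (U : lmodType k) (e : talg V).

Lemma sw_tcoact_cons v e U (F : talg V -> A -> U) :
  linl F -> linr F -> tlift (tcoact (tcat (word [:: v]) e)) F
  = \sw_(v0, v1 <- coact v) \sw_(t0, t1 <- tcoact e) F (tcat (word [:: v0]) t0) (v1 * t1).
Proof.
move=> F1 F2; move: e; apply: talg_ext => // s.
by rewrite tcat_word !tcoact_word /=; swn.
Qed.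

Lemma sw_tcoact_couR e U (F : talg V -> U) : lin F ->
  \sw_(e0, e1 <- tcoact e) (cou e1 *: F e0) = F e.
Proof.
move=> lF; move: e; apply: talg_ext => // s; elim/last_ind: s F lF => [|s v IH] F lF.
  by rewrite sw_tcoact1 // cou1 scale1r.
rewrite sw_tcoact_rcons // word_rcons -(IH (fun e => F (tcat e (word [:: v])))) //; swx.
rewrite -(sw_coact_cou v (F := fun v => F (tcat _ (word [:: v])))) // -sw_scale; swx.
by rewrite couM scalerA.
Qed.

End CoactionTests.

Section Ext0.

Variables (k : fieldType) (V : lmodType k) (psi : V -> k) (psiL : scal psi).
Implicit Types (U : lmodType k) (s : seq V) (e : talg V).

Lemma scal_ext0 : scal (ext0 psi).
Proof. exact: (ext0_scalar (scal_pack psiL)). Qed.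

Lemma ext0_word s : ext0 psi (word s) = if s is [:: v] then psi v else 0.
Proof.
apply: (@wlift_word _ _ k^o) => -[|u s1] s2 c v v' /=; last first.
  by case: s1 => [|? ?] /=; rewrite scaler0 addr0.
by case: s2 => [|? ?]; rewrite ?psiL // scaler0 addr0.
Qed.

Lemma ext0_tcat1 e v : ext0 psi (tcat e (word [:: v])) = tcou e * psi v.
Proof.
have L := scal_ext0; move: e; apply: (@talg_ext _ _ k^o) => [||s].
- by apply: (@scal_comp _ _ _ (ext0 psi)).
- exact: (scal_mulr _ (@scal_tcou k V)).
rewrite tcat_word ext0_word tcou_word; case: s => [|u [|u' s]] /=; by rewrite ?mul1r ?mul0r.
Qed.

Lemma ext0_1tcat v e : ext0 psi (tcat (word [:: v]) e) = psi v * tcou e.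
Proof.
have L := scal_ext0; move: e; apply: (@talg_ext _ _ k^o) => [||s].
- by apply: (@scal_comp _ _ _ (ext0 psi)).
- exact: (scal_mull _ (@scal_tcou k V)).
by rewrite tcat_word ext0_word tcou_word; case: s => [|u s] /=; rewrite ?mulr1 ?mulr0.
Qed.

Lemma ext0_lamt e U (u : U) :
  \sw_(e', v <- lamt e) ((tcou e' * psi v) *: u) = ext0 psi e *: u.
Proof.
have L := scal_ext0; move: e; apply: talg_ext => // s.
case/lastP: s => [|s v]; first by rewrite lamt1 sw0 // ext0_word scale0r.
by rewrite lamt_rcons swE // word_rcons ext0_tcat1.
Qed.

End Ext0.

Ltac scal_smash := first [ apply scal_tcou | apply scal_ext0; assumption ].
Ltac scal_atom ::= scal_smash.

(** * The codifferential on words *)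

Section SmashCoinner.

Variables (k : fieldType) (A : hopf_algebra k) (V : crossed_module A).
Variables (psi : V -> k) (psiL : scal psi).
Implicit Types (U : lmodType k) (s : seq V) (e : talg V) (a b c : A).

Local Notation o := (smash_ops V).
Local Notation lcv := (lconv o psi).
Local Notation rcv := (rconv o psi).
Local Notation theta := (ext0 psi).

Lemma lconv_smash a e : lcv (a ⊗ e)
  = \sw_(e1, e2 <- decon e) \sw_(e10, e11 <- tcoact e1) (theta e10 *: (a * e11 ⊗ e2)).
Proof.
rewrite /lconv /= sw_smash_cop //.
under eq_sw do under eq_sw do under eq_sw do rewrite smash_lamE.
rewrite -(sw_couL a (F := fun a => \sw_(e1, e2 <- decon e) \sw_(e10, e11 <- tcoact e1)
  (theta e10 *: (a * e11 ⊗ e2)))) //.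
swx; rewrite -sw_scale; swx; rewrite -sw_scale; swx.
rewrite -ext0_lamt //; swn; swx.
by rewrite smash_pi0E linearZ /=; congr (_ *: _); rewrite mulrA; congr (_ * _); exact: mulrC.
Qed.

Lemma rconv_smash_lamt a e : rcv (a ⊗ e) = \sw_(e', v <- lamt e) (psi v *: (a ⊗ e')).
Proof. by rewrite /rconv /= smash_lamE; swn_l. Qed.

Lemma rconv_smash a e : rcv (a ⊗ e) = \sw_(e1, e2 <- decon e) (theta e2 *: (a ⊗ e1)).
Proof.
rewrite rconv_smash_lamt; under [RHS]eq_sw do rewrite -ext0_lamt //.
rewrite (sw_decon_lamt e (F := fun e1 e' v => (tcou e' * psi v) *: (a ⊗ e1))) //; swx.
rewrite -(sw_decon_cou _ (F := fun e => psi _ *: (a ⊗ e))) //; swx.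
by rewrite scalerA.
Qed.

(** The super-commutator is the explicit codifferential: the left convolution removes the first
    letter and multiplies a by its coaction, the right one removes the last letter. *)
Lemma coinner_word a s : coinner o psi (a ⊗ word s)
  = if s is v :: s' then
      \sw_(v0, v1 <- coact v) (psi v0 *: (a * v1 ⊗ word s'))
      + ((-1) ^+ size s * psi (last v s')) *: (a ⊗ word (belast v s'))
    else 0.
Proof.
rewrite /coinner /= tmapE // sgt_word rconv_smash_lamt lconv_smash.
case: s => [|v s].
  rewrite decon1 swE // sw_tcoact1 // ext0_word // scale0r add0r.
  by rewrite (linZ _ _ (@lin_lamt _ _)) lamt1 scaler0 sw0.
congr (_ + _).
  rewrite decon_cons swD // swE // sw_tcoact1 // ext0_word // scale0r add0r; swn_l.
  under eq_sw do rewrite sw_tcoact_cons //.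
  rewrite sw_exch; apply: eq_sw => v0 v1.
  under eq_sw do under eq_sw do rewrite ext0_1tcat //.
  rewrite -(sw_decon_couL (word s) (F := fun e => psi v0 *: (a * v1 ⊗ e))) //.
  apply: eq_sw => e1 e2; have := sw_tcoact_cou e1 (F := fun b => psi v0 *: (a * (v1 * b) ⊗ e2)).
  by rewrite mulr1 => <- //; swx; rewrite mulrC scalerA.
by rewrite (linZ _ _ (@lin_lamt _ _)) lastI lamt_rcons swZ // swE // scalerA.
Qed.

End SmashCoinner.

Ltac lin_smash_coinner :=
  lazymatch goal with
  | |- lin (fun x => lconv _ _ x) => apply (lin_lconv (smash_axioms _)); assumption
  | |- lin (fun x => rconv _ _ x) => apply (lin_rconv (smash_axioms _)); assumption
  | |- lin (fun x => coinner _ _ x) => apply (lin_coinner (smash_axioms _)); assumption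
  | |- lin (fun x => coinner_sq _ _ x) => apply (lin_coinner_sq (smash_axioms _)); assumption
  | |- lin (fun x => cosq_test _ _ x) => apply (lin_cosq_test (smash_axioms _)); assumption
  | |- _ => lin_smash
  end.
Ltac lin_atom ::= lin_smash_coinner.

(** * B_theta as the kernel of the square *)

Section SquareOnWords.

Variables (k : fieldType) (A : hopf_algebra k) (V : crossed_module A).
Variables (psi : {scalar V}).
Let psiL : scal psi. Proof. exact: scal_scalar. Qed.
Implicit Types (U : lmodType k) (s : seq V) (e b : talg V) (a c : A).

Local Notation o := (smash_ops V).
Local Notation theta := (ext0 psi).
Local Notation lcv := (lconv o psi).
Local Notation rcv := (rconv o psi).
Local Notation J := (coinner_sq o psi).

(** The convolutions with theta * theta on T(V), where no coaction enters. [conv2l] is what the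
    counit of A leaves of [lcv] applied twice, by [cou_lconv2]. *)
Definition conv2l e : talg V :=
  \sw_(e1, c <- decon e) \sw_(e2, e3 <- decon c) ((theta e1 * theta e2) *: e3).

Definition conv2r e : talg V :=
  \sw_(e1, c <- decon e) \sw_(e2, e3 <- decon c) ((theta e2 * theta e3) *: e1).

Lemma lin_conv2l : lin conv2l. Proof. by rewrite /conv2l. Qed.
Lemma lin_conv2r : lin conv2r. Proof. by rewrite /conv2r. Qed.

Let lconv2E e : lcv (lcv (1 ⊗ e)) = \sw_(e1, c <- decon e) \sw_(e2, e3 <- decon c)
  \sw_(x0, x1 <- tcoact e1) \sw_(y0, y1 <- tcoact e2)
    ((theta x0 * theta y0) *: (x1 * y1 ⊗ e3)).
Proof.
rewrite lconv_smash //; swn_l; apply: eq_sw => e1 c; rewrite [RHS]sw_exch; apply: eq_sw => x0 x1.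
rewrite lconv_smash // mul1r -sw_scale; swx; rewrite -sw_scale; swx.
by rewrite scalerA.
Qed.

Let rconv2E a e : rcv (rcv (a ⊗ e)) = a ⊗ conv2r e.
Proof.
rewrite rconv_smash //; swn_l; rewrite /conv2r; swn_r.
under eq_sw do rewrite rconv_smash // -sw_scale.
under eq_sw do under eq_sw do rewrite scalerA.
rewrite (sw_deconA e (F := fun x y z => (theta z * theta y) *: (a ⊗ x))) //.
by swx; swx; rewrite mulrC.
Qed.

Let cou_lconv2 e : \sw_(c, u <- lcv (lcv (1 ⊗ e))) (cou c *: u) = conv2l e.
Proof.
rewrite lconv2E; swn_l; apply: eq_sw => e1 c; swx.
rewrite -(sw_tcoact_couR e1 (F := fun x => (theta x * theta _) *: _)) //; swx.
rewrite -(sw_tcoact_couR _ (F := fun y => (theta _ * theta y) *: _)) // -sw_scale; swx.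
by rewrite couM !scalerA; congr (_ *: _); exact: mulrC.
Qed.

Let conv_rl e U (F : talg V -> talg V -> U) : linl F ->
  linr F ->
  \sw_(e1, e2 <- decon e) F (conv2r e1) e2 = \sw_(e1, e2 <- decon e) F e1 (conv2l e2).
Proof.
move=> F1 F2; rewrite /conv2l /conv2r; swn.
rewrite (sw_deconA e (F := fun x y z =>
  \sw_(e2, e3 <- decon y) ((theta e2 * theta e3) *: F x z))) //; apply: eq_sw => e1 u.
by rewrite (sw_deconA u (F := fun x y z => (theta x * theta y) *: F e1 z)).
Qed.

Let decon_conv2l e : decon (conv2l e) = \sw_(e1, e2 <- decon e) (conv2l e1 ⊗ e2).
Proof.
rewrite /conv2l; swn; rewrite [RHS](sw_deconA e (F := fun x y z =>
  \sw_(e2, e3 <- decon y) ((theta x * theta e2) *: (e3 ⊗ z)))) //; apply: eq_sw => e1 u.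
rewrite [RHS](sw_deconA u (F := fun x y z => (theta e1 * theta x) *: (y ⊗ z))) //; swx.
by rewrite sw_scale sw_id.
Qed.

Let decon_conv2r e : decon (conv2r e) = \sw_(e1, e2 <- decon e) (e1 ⊗ conv2r e2).
Proof.
rewrite /conv2r; swn; rewrite -(sw_deconA e (F := fun x y z =>
  \sw_(e2, e3 <- decon z) ((theta e2 * theta e3) *: (x ⊗ y)))) //; apply: eq_sw => e1 u.
by rewrite [RHS]sw_exch; swx; rewrite sw_scale sw_id.
Qed.

Lemma coinner_sq_smash e : J (1 ⊗ e) = lcv (lcv (1 ⊗ e)) - 1 ⊗ conv2r e.
Proof. by rewrite /coinner_sq (coinner2 (smash_axioms V) psiL) rconv2E. Qed.

(** Both convolutions commute with left multiplication by A, so [J] is determined by its values at 1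
    ⊗ e. *)
Lemma coinner_sq_act a e : J (a ⊗ e) = tmap (fun c => a * c) id (J (1 ⊗ e)).
Proof.
have l1 c : lcv (c ⊗ e) = tmap (fun d => c * d) id (lcv (1 ⊗ e)).
  by rewrite !lconv_smash // /tmap; swn_r; swx; swx; rewrite mul1r.
have l2 (x : A ⊗ talg V) : lcv (tmap (fun d => a * d) id x) = tmap (fun d => a * d) id (lcv x).
  move: x; apply: tens_ext; [lin_tac | lin_tac |].
  move=> c z; rewrite tmapE // !lconv_smash // /tmap; swn_r; swx; swx.
  by rewrite mulrA.
rewrite /coinner_sq !(coinner2 (smash_axioms V) psiL) !rconv2E l1 l2.
have L : lin (tmap (fun c => a * c) (@id (talg V))) by exact: lin_tmap.
rewrite (linD L) (linN _ L).
by rewrite tmapE // mulr1.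
Qed.

(** A test on T(V): unlike in the coproduct of A # Sh_-(V), the first leg carries no coaction.
    [cosq_test_smash] shows that this makes no difference for the kernel. *)
Definition cosq_words b : talg V ⊗ A ⊗ talg V :=
  \sw_(b1, b2 <- decon b) (b1 ⊗ J (1 ⊗ b2)).

Lemma lin_cosq_words : lin cosq_words. Proof. by rewrite /cosq_words. Qed.

Let B_lhsE b : B_lhs psi b = \sw_(b1, b2 <- decon b) (b1 ⊗ lcv (lcv (1 ⊗ b2))).
Proof.
rewrite /B_lhs /decon4; apply: eq_sw => b1 c; rewrite lconv2E; swn_r; swx; swx; swx; swx.
by rewrite -(linZ _ _ (lin_tpurer _)).
Qed.

Let B_midE b : B_mid psi b = \sw_(b1, b2 <- decon b) (b1 ⊗ (1 : A) ⊗ conv2l b2).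
Proof.
by rewrite /B_mid /decon4; apply: eq_sw => b1 c; rewrite /conv2l; swn_r.
Qed.

Let B_rhsE b : B_rhs psi b = \sw_(b1, b2 <- decon b) (conv2l b1 ⊗ (1 : A) ⊗ b2).
Proof.
rewrite /B_rhs /decon4 /conv2l; swn_r.
rewrite (sw_deconA b (F := fun x y z => \sw_(e2, e3 <- decon y)
  ((theta x * theta e2) *: (e3 ⊗ (1 : A) ⊗ z)))) //; apply: eq_sw => e1 u.
by rewrite (sw_deconA u (F := fun x y z => (theta e1 * theta x) *: (y ⊗ (1 : A) ⊗ z))).
Qed.

(** Write l and r for [conv2l] and [conv2r], so that r b1 ⊗ b2 = b1 ⊗ l b2 always. Either side of
    the equivalence yields l b = r b through counits, and this spreads to the legs because decon (l
    b) = l b1 ⊗ b2 and decon (r b) = b1 ⊗ r b2. *)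
Lemma B_predP b : b \in B_pred psi <-> cosq_words b = 0.
Proof.
have l2L := lin_conv2l; have r2L := lin_conv2r.
have words0 : cosq_words b = \sw_(b1, b2 <- decon b) (b1 ⊗ lcv (lcv (1 ⊗ b2)))
    - \sw_(b1, b2 <- decon b) (b1 ⊗ (1 : A) ⊗ conv2r b2).
  by rewrite -sw_sub; swx; rewrite coinner_sq_smash (linD (lin_tpurer _)) (linN _ (lin_tpurer _)).
(* [mid] applies the counit of A to the middle factor, and [ins] puts the unit back. *)
pose mid (t : talg V ⊗ A ⊗ talg V) := \sw_(x, u <- t) \sw_(c, z <- u) (cou c *: (x ⊗ z)).
have midl : mid (\sw_(b1, b2 <- decon b) (b1 ⊗ lcv (lcv (1 ⊗ b2))))
    = \sw_(b1, b2 <- decon b) (b1 ⊗ conv2l b2).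
  by rewrite /mid; swn_l; swx; rewrite -cou_lconv2; swn_r.
have mid1 (f g : talg V -> talg V) : lin f -> lin g ->
    mid (\sw_(b1, b2 <- decon b) (f b1 ⊗ (1 : A) ⊗ g b2)) = \sw_(b1, b2 <- decon b) (f b1 ⊗ g b2).
  by move=> fL gL; rewrite /mid; swn_l; swx; rewrite cou1 scale1r.
pose ins (t : talg V ⊗ talg V) := \sw_(x, z <- t) (x ⊗ (1 : A) ⊗ z).
have insE (f g : talg V -> talg V) : lin f -> lin g ->
    ins (\sw_(b1, b2 <- decon b) (f b1 ⊗ g b2)) = \sw_(b1, b2 <- decon b) (f b1 ⊗ (1 : A) ⊗ g b2).
  by move=> fL gL; rewrite /ins; swn_l.
have r2l2 : \sw_(b1, b2 <- decon b) (b1 ⊗ conv2l b2) = \sw_(b1, b2 <- decon b) (conv2r b1 ⊗ b2).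
  by rewrite (conv_rl b (F := fun x y => x ⊗ y)).
rewrite /B_pred /in_mem /= B_lhsE B_midE B_rhsE words0; split.
  case/andP => /eqP e1 /eqP e2; apply/eqP; rewrite subr_eq0; apply/eqP; rewrite e1.
  have e3 : \sw_(b1, b2 <- decon b) (b1 ⊗ conv2l b2) = \sw_(b1, b2 <- decon b) (conv2l b1 ⊗ b2).
    by rewrite -(mid1 id conv2l) // -(mid1 conv2l id) // e2.
  have e4 : conv2r b = conv2l b.
    rewrite -(sw_decon_cou b (F := conv2r)) // -(sw_decon_cou b (F := conv2l)) //.
    by sw_by (congr1 (fun t => \sw_(x, y <- t) (tcou y *: x)) (etrans (esym r2l2) e3)).
  rewrite -(insE id conv2l) // -(insE id conv2r) //; congr ins.
  by rewrite e3 -decon_conv2l -e4 decon_conv2r.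
move=> /eqP; rewrite subr_eq0 => /eqP e1.
have e2 : \sw_(b1, b2 <- decon b) (b1 ⊗ conv2l b2) = \sw_(b1, b2 <- decon b) (b1 ⊗ conv2r b2).
  by rewrite -midl e1 (mid1 id conv2r).
have e3 : conv2l b = conv2r b.
  rewrite -(sw_decon_couL b (F := conv2r)) // -(sw_decon_couL b (F := conv2l)) //.
  by sw_by (congr1 (fun t => \sw_(x, y <- t) (tcou x *: y)) e2).
have e4 : \sw_(b1, b2 <- decon b) (b1 ⊗ (1 : A) ⊗ conv2l b2)
    = \sw_(b1, b2 <- decon b) (b1 ⊗ (1 : A) ⊗ conv2r b2).
  by rewrite -(insE id conv2l) // -(insE id conv2r) // e2.
rewrite e4 e1 eqxx /= -(insE conv2l id) // -(insE id conv2r) //; apply/eqP; congr ins.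
by rewrite -decon_conv2l e3 decon_conv2r.
Qed.

End SquareOnWords.

(** * Comparison of the tests on A # Sh_-(V) and on words *)

Section SmashSquare.

Variables (k : fieldType) (A : hopf_algebra k) (V : crossed_module A) (psi : {scalar V}).
Let psiL : scal psi. Proof. exact: scal_scalar. Qed.
Implicit Types (U : lmodType k) (x : A ⊗ talg V) (e : talg V) (a c : A).

Local Notation o := (smash_ops V).
Local Notation J := (coinner_sq o psi).
Local Notation G := (cosq_words psi).

Let right_test x := \sw_(x1, x2 <- smash_cop x) (x1 ⊗ J x2).

Let right_testE a e : right_test (a ⊗ e) = \sw_(e1, e2 <- decon e)
  \sw_(y0, y1 <- smash_rho (a ⊗ e1)) \sw_(c, u <- J (1 ⊗ e2)) (y0 ⊗ y1 * c ⊗ u).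
Proof.
rewrite /right_test smash_copE; under [RHS]eq_sw do rewrite smash_rhoE; swn.
rewrite sw_exch; swx; swx; swx.
by rewrite coinner_sq_act /tmap; swn.
Qed.

Lemma lin_tmap_cosq_words : lin (tmap (@id A) G).
Proof. exact: lin_tmap (lin_cosq_words psi). Qed.

(** The map y ⊗ c to y_0 ⊗ y_1 c of [right_testE] is undone by y ⊗ c to y_0 ⊗ S(y_1) c. *)
Let words_of_right x : tmap id G x = \sw_(y, w <- right_test x) \sw_(y0, y1 <- smash_rho y)
  \sw_(a, t <- y0) \sw_(c, u <- w) (a ⊗ t ⊗ ant y1 * c ⊗ u).
Proof.
move: x; apply: tens_ext => [||a e].
- exact: lin_tmap_cosq_words.
- by rewrite /right_test.
rewrite tmapE //.
rewrite right_testE /cosq_words; swn; apply: eq_sw => e1 e2.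
under [RHS]eq_sw do rewrite sw_exch.
rewrite (s_rhoA (smash_axioms V) (a ⊗ e1) (F := fun z0 z1 y1 =>
  \sw_(c, u <- J (1 ⊗ e2)) \sw_(a, t <- z0) (a ⊗ t ⊗ ant z1 * (y1 * c) ⊗ u))) //=.
transitivity (\sw_(y0, y1 <- smash_rho (a ⊗ e1)) (cou y1 *: \sw_(a, t <- y0) (a ⊗ t ⊗ J (1 ⊗ e2)))).
  by rewrite (s_rho_cou (smash_axioms V) (a ⊗ e1)
    (F := fun y0 => \sw_(a, t <- y0) (a ⊗ t ⊗ J (1 ⊗ e2)))) // swE.
apply: eq_sw => y0 y1.
have := sw_antL y1 (fun d => \sw_(c, u <- J (1 ⊗ e2)) \sw_(a, t <- y0) (a ⊗ t ⊗ d * c ⊗ u)).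
rewrite (_ : (\sw_(c, u <- J (1 ⊗ e2)) \sw_(a, t <- y0) (a ⊗ t ⊗ 1 * c ⊗ u))
  = \sw_(a, t <- y0) (a ⊗ t ⊗ J (1 ⊗ e2))); last first.
  rewrite sw_exch; swx; rewrite -[J (1 ⊗ e2) in RHS]sw_id; swn_r.
  by swx; rewrite mul1r.
by move=> <- //; swx; swx; swx; rewrite mulrA.
Qed.

Let right_of_words x : right_test x = \sw_(a, t <- tmap id G x) \sw_(e1, w <- t)
  \sw_(y0, y1 <- smash_rho (a ⊗ e1)) \sw_(c, u <- w) (y0 ⊗ y1 * c ⊗ u).
Proof.
move: x; apply: tens_ext => [||a e].
- by rewrite /right_test.
- by apply: lin_tliftl => //; exact: lin_tmap_cosq_words.
rewrite tmapE //.
by rewrite right_testE swE // /cosq_words; swn.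
Qed.

Lemma cosq_test_smash x : cosq_test o psi x = 0 <-> tmap id G x = 0.
Proof.
split=> [/(cosq_test_right (smash_axioms V) psiL) /= e | e].
  by rewrite words_of_right /right_test e sw0.
apply: (cosq_test_of_right (smash_axioms V) psiL) => /=; rewrite -/(right_test x).
by rewrite right_of_words e sw0.
Qed.

End SmashSquare.

(** * The inclusion of A ⊗ B_theta(V) *)

Section Sub.

Variables (k : fieldType) (A : hopf_algebra k) (V : crossed_module A) (theta : {scalar V}).
Let thetaL : scal theta. Proof. exact: scal_scalar. Qed.
Implicit Types (x : A ⊗ talg V) (a : A).

Local Notation o := (smash_ops V).
Local Notation K := (cosq_test o theta).

Lemma smash_couE x : smash_cou x = cou (smash_pi0 x).
Proof.
have sL : scal (fun a : A => cou a) by exact: scal_scalar.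
rewrite /smash_cou /smash_pi0 (sw_lin (Z := k^o) _ _ sL); apply: (@eq_sw k k^o) => a e.
by rewrite linearZ /= mulrC.
Qed.

Lemma smash_codiffE x : smash_codiff theta x = coinner o theta x.
Proof.
rewrite -[x in RHS]sw_id (sw_lin _ _ (lin_coinner (smash_axioms V) thetaL)).
apply: eq_sw => a e.
rewrite -(wlift_lin e (f := fun t => coinner o theta (a ⊗ t))) //.
by apply: wlift_ext => s; rewrite coinner_word.
Qed.

Lemma lin_B_val : lin (@B_val _ _ _ theta).
Proof. by move=> c y z; exact: (linearP (val : B_theta theta -> talg V)). Qed.

Lemma lin_smash_incl : lin (@smash_incl _ _ _ theta).
Proof. exact: lin_tmap (@lin_id _ _) lin_B_val. Qed.

Lemma smash_inclE a (b : B_theta theta) : smash_incl (a ⊗ b) = a ⊗ B_val b.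
Proof. by rewrite /smash_incl tmapE //; exact: lin_B_val. Qed.

Lemma smash_incl_test y : K (smash_incl (y : A ⊗ B_theta theta)) = 0.
Proof.
apply/cosq_test_smash; move: y; apply: tens_ext => [||a b].
- exact: lin_comp (@lin_tmap_cosq_words _ _ _ theta) lin_smash_incl.
- exact: lin_cst0.
rewrite smash_inclE tmapE //.
by rewrite ((B_predP _ _).1 (valP b)) (lin0 (lin_tpurer _)).
Qed.

(** The retraction is id ⊗ q for a retraction q onto B_theta(V). By [ker_proj] the kernel of the
    test consists of sums of tensors a ⊗ b with b in B_theta(V), and there id ⊗ q is the
    identity. *)
Lemma smash_incl_retract : exists r : A ⊗ talg V -> A ⊗ B_theta theta,
  [/\ lin r, cancel (@smash_incl _ _ _ theta) r & forall x, K x = 0 -> smash_incl (r x) = x].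
Proof.
have BL := lin_B_val; have [q qL qK] := lin_retract BL (val_inj : injective (@B_val _ _ _ theta)).
have rL : lin (tmap (@id A) q) by exact: lin_tmap.
exists (tmap id q); split=> //.
  apply: tens_ext => [||a b] //; first exact: (lin_comp rL lin_smash_incl).
  by rewrite smash_inclE tmapE // qK.
have [p [pL pG pid _ pr]] := ker_proj (lin_cosq_words theta).
move=> x /cosq_test_smash /pr e.
suff h y : smash_incl (tmap id q (tmap id p y)) = tmap id p y by have := h x; rewrite e.
move: y {x e}; apply: tens_ext => [||a t].
- by apply: (lin_comp lin_smash_incl); apply: (lin_comp rL); exact: lin_tmap.
- exact: lin_tmap.
rewrite !tmapE // smash_inclE; congr (_ ⊗ _).
have /B_predP h := pG t.
by rewrite -[p t]/(B_val (BTheta h)) qK.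
Qed.

End Sub.

(** * The two conditions of the theorem *)

Section Conditions.

Variables (k : fieldType) (A : hopf_algebra k) (V : crossed_module A) (psi : V -> k).
Hypothesis psiL : scal psi.
Implicit Types (a : A) (e b : talg V).

Local Notation o := (smash_ops V).

Definition first_letter e := \word_(s <- e) (if s is v :: s' then psi v *: word s' else 0).
Definition last_letter e :=
  \word_(s <- e) (if s is v :: s' then psi (last v s') *: word (belast v s') else 0).

Let first_multilin : multilin (fun s => if s is v :: s' then psi v *: word s' else 0).
Proof.
apply: (multilin_cons (g := fun v s' => psi v *: word s')) => [v s|v s1 s2|s] //.
exact: (lin_scale _ (lin_word s1 s2)).
Qed.

Let last_multilin :
  multilin (fun s => if s is v :: s' then psi (last v s') *: word (belast v s') else 0).
Proof.
apply: (multilin_last (g := fun s v => psi v *: word s)) => [s v|v s1 s2|s] //.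
  by case: s => [|u s] //=; rewrite last_rcons belast_rcons.
exact: (lin_scale _ (lin_word s1 s2)).
Qed.

Let lin_first : lin first_letter. Proof. exact: lin_wlift first_multilin. Qed.
Let lin_last : lin last_letter. Proof. exact: lin_wlift last_multilin. Qed.

(** For a coinvariant psi nothing is lost under the counit, by [coinner_coinv]; this is then the
    factor of i(1 ⊗ e) in T(V), whose vanishing is the second condition. *)
Definition coinner_words e : talg V := \sw_(c, u <- coinner o psi (1 ⊗ e)) (cou c *: u).

Lemma lin_coinner_words : lin coinner_words.
Proof. by rewrite /coinner_words. Qed.

Lemma coinner_words_homog n b : tproj n b = b ->
  coinner_words b = first_letter b + (-1) ^+ n *: last_letter b.
Proof.
have pL := @tproj_linear k V n; have L := lin_coinner_words.
move=> <-; move: b; apply: talg_ext => [||s].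
- exact: (lin_comp L pL).
- exact: (lin_add (lin_comp lin_first pL) (lin_scale _ (lin_comp lin_last pL))).
rewrite tproj_word; case: eqP => [<-|_]; last first.
  by rewrite (lin0 L) (lin0 lin_first) (lin0 lin_last) scaler0 addr0.
rewrite /coinner_words coinner_word // /first_letter /last_letter !wlift_word //.
case: s => [|v s]; first by rewrite sw0 // scaler0 addr0.
rewrite swD // swZ // swE // cou1 scale1r scalerA; congr (_ + _); swn_l.
rewrite -(sw_coact_cou v (F := fun v => psi v *: word s)) //; swx.
by rewrite mul1r scalerA mulrC.
Qed.

Lemma coinner_words_tproj0 e : coinner_words (tproj 0 e) = 0.
Proof.
have pL := @tproj_linear k V 0; have L := lin_coinner_words.
move: e; apply: talg_ext => [||s].
- exact: (lin_comp L pL).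
- exact: lin_cst0.
rewrite tproj_word; case: eqP => [/size0nil ->|_]; last exact: lin0 L.
by rewrite /coinner_words coinner_word // sw0.
Qed.

(** The codifferential of a single letter is the defect of coinvariance of psi; its vanishing is the
    first condition. *)
Lemma pi0_coinner_word1 w :
  smash_pi0 (coinner o psi (1 ⊗ word [:: w])) = \sw_(w0, w1 <- coact w) (psi w0 *: w1) - psi w *: 1.
Proof.
rewrite coinner_word // (linD (@lin_smash_pi0 _ _ _)) (linZ _ _ (@lin_smash_pi0 _ _ _)) /=.
rewrite smash_pi0E tcou_word scale1r expr1 mulN1r scaleNr; congr (_ - _); swn_l; swx.
by rewrite smash_pi0E tcou_word scale1r mul1r.
Qed.

Hypothesis psi_coinv : forall w, \sw_(w0, w1 <- coact w) (psi w0 *: w1) = psi w *: (1 : A).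

(** Coinvariance replaces the coaction of the first letter by the unit, so the factor a is left
    untouched. *)
Lemma coinner_coinv a e : coinner o psi (a ⊗ e) = a ⊗ coinner_words e.
Proof.
have L := lin_coinner_words.
move: e; apply: talg_ext => [||s]; [lin_tac | exact: (lin_comp (lin_tpurer _) L) |].
rewrite /coinner_words !coinner_word //; case: s => [|v s]; first by rewrite sw0 // (lin0
  (lin_tpurer _)).
have e (c : A) : \sw_(v0, v1 <- coact v) (psi v0 *: (c * v1 ⊗ word s)) = c ⊗ (psi v *: word s).
  by sw_by (congr1 (fun d => c * d ⊗ word s) (psi_coinv v)); rewrite mulr1.
rewrite !e swD // swZ // !swE // !cou1 !scale1r (linD (lin_tpurer _)); congr (_ + _).
by rewrite (linZ _ _ (lin_tpurer _)).
Qed.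

End Conditions.

Theorem proposition4p6 (k : fieldType) (char_k : 2%N \notin [pchar k])
    (A : hopf_algebra k) (ant_bij : bijective (ant : A -> A))
    (Lambda1 : crossed_module A)
    (theta : {scalar Lambda1}) (theta_inv : right_invariant theta)
    (omega : {linear aug_ideal A -> Lambda1}) (omega_map : aug_crossed_map omega) :
  (exists E : aug_ext_algebra A (A ⊗ B_theta theta)%type, inherited omega E)
  <->
  (forall w : Lambda1,
     \sw_(w0, u <- coact w) \sw_(w1, w2 <- cop u)
       ((theta w0 * theta (omega_tilde omega w1)) *: w2)
     = theta_omega theta omega w *: (1 : A)) /\
  (forall (n : nat) (b : talg Lambda1),
     (0 < n)%N -> tproj n b = b -> b \in B_pred theta ->
     \word_(s <- b)
       (if s is v :: s' then theta_omega theta omega v *: word s' else 0)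
     = (-1) ^+ n.-1 *:
       \word_(s <- b)
         (if s is v :: s' then
            theta_omega theta omega (last v s') *: word (belast v s')
          else 0)).
Proof.
have H := smash_axioms Lambda1; have HD := smash_diff_axioms omega_map.
have thetaL : scal theta by exact: scal_scalar.
have twL : scal (theta_omega theta omega) := scal_psi_omt HD thetaL.
have oL := lin_omega_tilde omega.
(* By coassociativity, the first condition is the coinvariance of [theta_omega]. *)
have twE w : \sw_(w0, u <- coact w) \sw_(w1, w2 <- cop u)
      ((theta w0 * theta (omega_tilde omega w1)) *: w2)
    = \sw_(w0, w1 <- coact w) (theta_omega theta omega w0 *: w1).
  rewrite -(sw_coactA w (F := fun x y z => (theta x * theta (omega_tilde omega y)) *: z)) //; swx.
  by rewrite (psi_omtE (omega_tilde omega) theta).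
pose o := smash_ops Lambda1.
split=> [[E [_ _ _ _ _ _ iE dE]] | [c1 c2]].
  (* E provides i^2 = 0 on A ⊗ B_theta(V) and a d that maps this space to itself, so both terms of
     [coinner2_d] that contain i^2 vanish. *)
  have tw0 b : b \in B_pred theta -> coinner o (theta_omega theta omega) (1 ⊗ b) = 0.
    move=> hb; pose y := (1 : A) ⊗ BTheta hb; have -> : 1 ⊗ b = smash_incl y by rewrite smash_inclE.
    have i2 (z : A ⊗ B_theta theta) : coinner o theta (coinner o theta (smash_incl z)) = 0.
      have e y' : coinner o theta (smash_incl y') = smash_incl (ext_codiff E y').
        by rewrite iE smash_codiffE.
      by rewrite !e ext_codiff2 (lin0 (@lin_smash_incl _ _ _ theta)).
    have := coinner2_d H HD thetaL theta_inv (smash_incl y); rewrite -dE !i2.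
    by rewrite (lin0 (dx_dd HD)) sub0r => /eqP; rewrite eq_sym oppr_eq0 => /eqP.
  split=> [w | n b n0 nb hb].
    have /tw0 e : word [:: w] \in B_pred theta.
      apply/B_predP; rewrite /cosq_words -[word _]/(word (rcons [::] w)) decon_rcons decon1.
      (* i lowers the degree by one, so i^2 vanishes in degrees 0 and 1, and all words of length one
         pass the test. *)
      have J0 s : (size s <= 1)%N -> coinner_sq o theta (1 ⊗ word s) = 0.
        rewrite /coinner_sq coinner_word //; case: s => [|v [|u s]] // _; first exact: lin0
          (lin_coinner H thetaL).
        have c0 c : coinner o theta (c ⊗ word [::]) = 0 by rewrite coinner_word.
        rewrite (linD (lin_coinner H thetaL)) (linZ _ _ (lin_coinner H thetaL)) c0 scaler0 addr0.
        rewrite (sw_lin _ _ (lin_coinner H thetaL)) -[RHS](sw_zero _ (coact v)); swx.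
        by rewrite (linZ _ _ (lin_coinner H thetaL)) c0 scaler0.
      rewrite swD // !swE // tcat1t !J0 // !(lin0 (lin_tpurer _)) addr0 //.
    rewrite twE; apply/eqP; rewrite -subr_eq0 -pi0_coinner_word1 // e.
    by rewrite (lin0 (@lin_smash_pi0 _ _ _)).
  have := coinner_words_homog twL nb; rewrite /coinner_words tw0 // sw0 // => /esym/eqP.
  (* Moving the term in (-1)^n to the other side gives the exponent n - 1, legitimate as n > 0. *)
  by rewrite addr_eq0 -scaleNr -{1}(prednK n0) exprS mulN1r opprK => /eqP.
have tw0 z : cosq_test o theta z = 0 -> coinner o (theta_omega theta omega) z = 0.
  have [r [_ _ h]] := smash_incl_retract theta; move=> /h <-; move: (r z).
  have c1' w := etrans (esym (twE w)) (c1 w).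
  apply: tens_ext => [||a [b hb]].
  - exact: (lin_comp (lin_coinner H twL) (@lin_smash_incl _ _ _ theta)).
  - exact: lin_cst0.
  rewrite smash_inclE /= coinner_coinv //.
  have [N hN] := smash_proj_sum ((1 : A) ⊗ b).
  (* The second condition concerns homogeneous elements. The components of b lie in B_theta(V) again
     because the test respects the degree, and in degree 0 the codifferential vanishes. *)
  have b0 n : coinner_words (theta_omega theta omega) (tproj n b) = 0.
    case: n => [|n]; first exact: coinner_words_tproj0.
    have pn : tproj n.+1 (tproj n.+1 b) = tproj n.+1 b.
      move: (b); apply: talg_ext => [||s]; [exact: lin_comp (@tproj_linear _ _ _) (@tproj_linear _
        _ _)| exact: tproj_linear |].
      by rewrite tproj_word; case: ifP => [e|_]; rewrite ?tproj_word ?e // (lin0 (@tproj_linear _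
        _ _)).
    rewrite (coinner_words_homog twL pn); apply/eqP; rewrite addr_eq0 -scaleNr exprS mulN1r opprK.
    apply/eqP; apply: (c2 n.+1) => //; apply/B_predP.
    have := smash_incl_test ((1 : A) ⊗ BTheta hb); rewrite smash_inclE /=.
    move=> /(cosq_test_P H thetaL n.+1) /cosq_test_smash; rewrite /= smash_projE tmapE // => e.
    have := congr1 (fun t => \sw_(c, u <- t) (cou c *: u)) e.
    by rewrite swE // cou1 scale1r sw0.
  have L := lin_coinner_words twL.
  have := congr1 (fun t => \sw_(c, u <- t) (cou c *: coinner_words (theta_omega theta omega) u))
    (hN N (leqnn N)).
  rewrite swE // cou1 scale1r sw_big // big1 => [->|n _]; first exact: lin0 (lin_tpurer _).
  by rewrite smash_projE swE // b0 scaler0.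
have [r [rL rK rt]] := smash_incl_retract theta.
have inK x : smash_incl (r x) = x -> cosq_test o theta x = 0 by move=> <-; exact: smash_incl_test.
have iL := @lin_smash_incl _ _ _ theta.
have [|||||||E [jE gE mE oE [DE eE iE dE]]] :=
  sub_exterior_algebra H HD thetaL theta_inv iL rL rK.
- by move=> a; apply: rt; exact: cosq_test_iota.
- by move=> n x /inK h; apply: rt; exact: cosq_test_P.
- by move=> x y /inK hx /inK hy; apply: rt; exact: cosq_test_mul.
- by move=> x /inK h; apply: rt; exact: (cosq_test_d H HD).
- by move=> x /inK h; apply: rt; exact: cosq_test_coinner.
(* Both legs of the coproduct lie in the kernel of the test, on which [smash_incl] after [r] is the
   identity. *)
- move=> x /inK h; have [p [pL p0 _ pD]] := cosq_test_sub H thetaL.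
  rewrite -(pD x h); have rpL := lin_comp iL (lin_comp rL pL).
  have tL : lin (tmap (fun x => smash_incl (r x)) (fun x => smash_incl (r x))).
    by apply: lin_tmap; exact: lin_comp iL rL.
  move: (so_Delta _ x); apply: tens_ext => [||x1 x2].
  + exact: (lin_comp tL (lin_tmap pL pL)).
  + exact: lin_tmap.
  by rewrite !tmapE ?rt //; exact: lin_comp iL rL.
- by move=> x /inK h; exact: (cosq_test0 H thetaL).
exists E; split=> //.
- by move=> x; rewrite eE smash_couE.
- by move=> x; rewrite iE smash_codiffE.
Qed.
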